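(* Let $\Omega\subset\mathbb{R}^n$ be a bounded convex domain. Let $u,\tilde u\in C(\overline\Omega)$ be convex functions with $u=\tilde u=0$ on $\partial\Omega$ and $\mu_u\ge\mu_{\tilde u}$ in $\Omega$. Then for all $\alpha\in[0,1]$ and all $x_0\in\Omega$, $$|\tilde u(x_0)-u(x_0)|^n\le C(n)\,[\mathrm{diam}(\Omega)]^{n-1}\,\mathrm{dist}^{\alpha}(x_0,\partial\Omega)\int_\Omega\mathrm{dist}^{1-\alpha}(\cdot,\partial\Omega)\,(d\mu_u-d\mu_{\tilde u}),$$ where $C(n)>0$ is a constant depending only on $n$.
   Context: For a convex function $u$ on $\Omega$, the subdifferential is $\partial u(x)=\{q\in\mathbb{R}^n: u(y)\ge u(x)+q\cdot(y-x)\ \forall y\in\Omega\}$, and the Monge--Ampère measure is $\mu_u(S)=|\partial u(S)|$ (Lebesgue measure) for Borel $S\subset\Omega$, where $\partial u(S)=\bigcup_{x\in S}\partial u(x)$; it is a Radon measure on $\Omega$. The integral is with respect to the nonnegative measure $\mu_u-\mu_{\tilde u}$ (and may be $+\infty$). *)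

(* Defs.v *)
From HB Require Import structures.
From mathcomp Require Import all_boot all_order all_algebra.
From mathcomp Require Import all_classical all_reals all_analysis.

Set Implicit Arguments.
Unset Strict Implicit.
Unset Printing Implicit Defensive.

Import Order.TTheory GRing.Theory Num.Theory.
Import numFieldNormedType.Exports.

Local Open Scope classical_set_scope.
Local Open Scope ring_scope.

(* The canonical norm of 'rV[R]_n is the sup norm; it induces the usual
   topology and bounded sets, but lengths have to be Euclidean. *)
Section euclidean.
Context {R : realType} {n : nat}.
Implicit Types (x y : 'rV[R]_n) (A : set 'rV[R]_n).

Definition dotv x y : R := \sum_(i < n) x 0 i * y 0 i.

Definition enorm x : R := Num.sqrt (dotv x x).

Definition dist x A : R := inf [set enorm (x - y) | y in A].

Definition diam A : R := sup [set enorm (x - y) | x in A & y in A].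

Definition boundary A : set 'rV[R]_n := closure A `\` interior A.

(* Connectedness is omitted because convex sets are connected. *)
Definition bounded_convex_domain A :=
  [/\ open A, A !=set0, bounded_set A & convex_set A].

End euclidean.

(* Lebesgue measure on R^n: the outer measure generated by the volume of
   half-open boxes, restricted to its Caratheodory-measurable sets. *)
Section lebesgue.
Context {R : realType} {n : nat}.
Local Open Scope ereal_scope.

Definition box (ab : 'rV[R]_n * 'rV[R]_n) : set 'rV[R]_n :=
  [set x | forall i, x 0%R i \in `]ab.1 0%R i, ab.2 0%R i]].

Definition box_volume (ab : 'rV[R]_n * 'rV[R]_n) : R :=
  (\prod_(i < n) Num.max 0 (ab.2 0 i - ab.1 0 i))%R.

Definition box_cover (A : set 'rV[R]_n) : set (set ('rV[R]_n * 'rV[R]_n)) :=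
  [set D | countable D /\ A `<=` \bigcup_(ab in D) box ab].

Definition lebesgue_outer (A : set 'rV[R]_n) : \bar R :=
  ereal_inf [set \esum_(ab in D) (box_volume ab)%:E | D in box_cover A].

Lemma box_volume_ge0 ab : 0 <= (box_volume ab)%:E.
Proof. by rewrite lee_fin; apply: prodr_ge0 => i _; rewrite le_max lexx. Qed.

Lemma lebesgue_outer_ge0 A : 0 <= lebesgue_outer A.
Proof.
apply: le_ereal_inf_tmp => _ [D _ <-].
by apply: esum_ge0 => ab _; exact: box_volume_ge0.
Qed.

Lemma lebesgue_outer0 : lebesgue_outer set0 = 0.
Proof.
apply/eqP; rewrite eq_le lebesgue_outer_ge0 andbT.
apply: ereal_inf_lbound; exists set0; last exact: esum_set0.
by split; [exact: countable0|exact: sub0set].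
Qed.

Lemma le_lebesgue_outer : {homo lebesgue_outer : A B / A `<=` B >-> A <= B}.
Proof.
move=> A B AB; apply: ereal_inf_le_tmp => _ [D [cD BD] <-].
by exists D => //; split => //; exact: subset_trans BD.
Qed.

Lemma lebesgue_outer_sigma_subadditive : sigma_subadditive lebesgue_outer.
Proof.
move=> A; have [[i ioo]|] := pselect (exists i, lebesgue_outer (A i) = +oo).
  rewrite (eseries_pinfty _ _ ioo) ?leey// => k _.
  by rewrite -ltNye (lt_le_trans _ (lebesgue_outer_ge0 _)).
rewrite -forallNE => Aoo.
apply/lee_addgt0Pr => e e0.
rewrite (le_trans _ (epsilon_trick _ _ (ltW e0)))//; last first.
  by move=> k; exact: lebesgue_outer_ge0.
pose P k D := box_cover (A k) D /\
  \esum_(ab in D) (box_volume ab)%:E <=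
    lebesgue_outer (A k) + (e / (2 ^ k.+1)%:R)%:E.
have [G PG] : {G & forall k, P k (G k)}.
  apply: (@choice _ _ P) => k.
  have ek0 : (0 < e / (2 ^ k.+1)%:R)%R by rewrite divr_gt0// ltr0n expn_gt0.
  have fin : lebesgue_outer (A k) \is a fin_num.
    rewrite ge0_fin_numE ?lebesgue_outer_ge0//.
    by rewrite ltey; apply/eqP; exact: Aoo.
  have [_ [D AD <-] lt] := lb_ereal_inf_adherent ek0 fin.
  by exists D; split => //; exact: ltW.
apply: (@le_trans _ _ (\esum_(ab in \bigcup_k G k) (box_volume ab)%:E)).
  apply: ereal_inf_lbound; exists (\bigcup_k G k) => //; split.
    by apply: bigcup_countable => // k _; exact: (PG k).1.1.
  move=> x [k _ /(PG k).1.2[ab Gab xab]].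
  by exists ab => //; exists k.
rewrite seqDU_bigcup_eq nneseries_sum_bigcup; last 2 first.
- exact: trivIset_seqDU.
- by move=> ab; exact: box_volume_ge0.
apply: lee_nneseries => k _; last first.
  apply: (le_trans _ (PG k).2); apply: ereal_sup_le => _ [X [fX XG] <-].
  by exists X => //; split => //; apply: (subset_trans XG); exact: subset_seqDU.
by move=> _; apply: esum_ge0 => ab _; exact: box_volume_ge0.
Qed.

HB.instance Definition _ := isOuterMeasure.Build R 'rV[R]_n lebesgue_outer
  lebesgue_outer0 lebesgue_outer_ge0 le_lebesgue_outer
  lebesgue_outer_sigma_subadditive.

Definition lebesgue_rV (A : set (caratheodory_type lebesgue_outer)) : \bar R :=
  lebesgue_outer A.

HB.instance Definition _ := isMeasure.Build _ _ _ lebesgue_rV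
  (@caratheodory_measure0 _ _ lebesgue_outer)
  (@caratheodory_measure_ge0 _ _ lebesgue_outer)
  (@caratheodory_measure_sigma_additive _ _ lebesgue_outer).

End lebesgue.

Section monge_ampere.
Context {R : realType} {n : nat}.
Implicit Types (Omega S : set 'rV[R]_n) (u v : 'rV[R]_n -> R).
Local Open Scope ereal_scope.

Definition subdifferential Omega u (x : 'rV[R]_n) : set 'rV[R]_n :=
  [set q | forall y, Omega y -> (u x + dotv q (y - x) <= u y)%R].

Definition borel_rV := g_sigma_algebraType (@open 'rV[R]_n).

Definition monge_ampere Omega u (S : set borel_rV) : \bar R :=
  lebesgue_rV (\bigcup_(x in S) subdifferential Omega u x).

(* The nonnegative Borel measure mu_u - mu_v on Omega. Both measures may be
   infinite on Omega but are finite on compact subsets, so the difference is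
   taken inside each compact K and Omega is exhausted by such K. *)
Definition monge_ampere_diff Omega u v (S : set borel_rV) : \bar R :=
  ereal_sup [set monge_ampere Omega u (S `&` K) - monge_ampere Omega v (S `&` K)
            | K in [set K : set 'rV[R]_n | compact K /\ K `<=` Omega]].

End monge_ampere.

(* Main.v *)
(* Write phi = u - v, extended by 0, and say that q is a slope of phi at x if the plane of
   gradient q through (x, phi x) stays below phi. Replacing phi by the supremum of such
   planes, the superadditivity |∂v(K)| + |∂phi(K)| <= |∂(v + phi)(K)| of the Monge-Ampere
   measure of convex functions (a Brunn-Minkowski argument on finite nets) bounds the measure
   of the slopes of phi touching in K by (mu_u - mu_v)(K). With u and v exchanged this also
   gives u <= v.
   It remains to prove a weighted Aleksandrov estimate for phi. Let kappa be a minimum of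
   finitely many affine functions equal to 1 at x0, with 0 <= kappa <= 2 dist / dist(x0) where
   phi is very negative. Planes through (x0, p) are slid from below to phi + s kappa, for s
   in a range of size m = |phi x0|: the touching height at the point where the plane touches
   increases in s at rate kappa, and if kappa has gradient -th there, then p + s th is a slope
   of phi. As p + s th depends on p piecewise by translations, integrating over s and over a
   set of slopes p of measure about m^n / (diam^(n-1) dist(x0)) bounds this measure by the
   integral of kappa against the measure of the slopes of phi. Finally
   dist(x0)^(1 - alpha) kappa <= 2 dist^(1 - alpha). *)

Require Import Defs.
From mathcomp Require Import all_boot all_order all_algebra.
From mathcomp Require Import all_classical all_reals all_analysis.
From mathcomp Require Import ring lra zify measurable_realfun.
From mathcomp Require finmap.

Set Implicit Arguments.
Unset Strict Implicit.
Unset Printing Implicit Defensive.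

Import Order.TTheory GRing.Theory Num.Theory.
Import numFieldNormedType.Exports.

Local Open Scope classical_set_scope.
Local Open Scope ring_scope.

(** * Lebesgue outer measure of boxes *)

(** The Aleksandrov argument with weight 1 gives only alpha = 1. A weight bounded both by 1 and by a
    multiple of dist / dist(x0) covers all alpha at once. It is a minimum of affine functions
    because adding an affine function translates slopes and so preserves their measure, whereas a
    curved weight would distort them. Two translated pieces overlap only in slopes touching at two
    distinct points, which form a null set by monotonicity.

    As a supremum over compact sets, [monge_ampere_diff] is handled as a mere set function, without
    additivity. The integral is therefore bounded from below by one simple function, with distinct
    values on disjoint compact bands of kappa. The integrations over s and over the values of kappa
    are finite sums: s runs through multiples of m / 2, and kappa is compared with the fractions (j
    + 1) / J.

    The constant is 48 (4n)^n: 2 (4n)^n from the volume of the cubes, 3 from the overlap of the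
    height windows, 2 from rounding kappa down to its levels, 2 from replacing levels by compact
    bands, and 2 from kappa <= 2 dist / dist(x0). *)

Section lebesgue_boxes.
Context {R : realType}.

Let indic_itv_le (c a b : R) : 0 <= c ->
  (\int[lebesgue_measure]_t (c * \1_(`]a, b]) t)%:E =
   (c * Num.max 0 (b - a))%:E)%E.
Proof.
move=> c0.
under eq_integral do rewrite EFinM.
rewrite ge0_integralZl_EFin//; last first.
  exact/measurable_EFinP/measurable_indic.
rewrite integral_indic// setIT EFinM; congr (_ * _)%E.
rewrite /= lebesgue_measure_itv/= lte_fin; case: ltP => ab.
  by rewrite -EFinB; congr EFin; apply/esym/max_idPr; rewrite subr_ge0 ltW.
by congr EFin; apply/esym/max_idPl; rewrite subr_le0.
Qed.

(* Each step of the induction integrates the hypothesis over the last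
   coordinate, replacing one interval indicator by the interval length. *)
Lemma box_indicator_series_le (k : nat) (c0 : R) (c : nat -> R)
    (A B : nat -> nat -> R) (a b : nat -> R) :
  0 <= c0 -> (forall j, 0 <= c j) ->
  (forall x : nat -> R,
    ((c0 * \prod_(i < k) \1_(`]a i, b i]) (x i))%:E <=
     \sum_(0 <= j <oo) (c j * \prod_(i < k) \1_(`]A j i, B j i]) (x i))%:E)%E) ->
  ((c0 * \prod_(i < k) Num.max 0 (b i - a i))%:E <=
   \sum_(0 <= j <oo) (c j * \prod_(i < k) Num.max 0 (B j i - A j i))%:E)%E.
Proof.
elim: k c0 c => [|k IH] c0 c c0_ge0 c_ge0 hyp.
  by have := hyp (fun=> 0); under eq_eseriesr do rewrite big_ord0;
    rewrite big_ord0 => h; under eq_eseriesr do rewrite big_ord0; rewrite big_ord0.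
have rot (r s t : R) : r * (s * t) = r * t * s by rewrite mulrA mulrAC.
rewrite big_ord_recr/= rot.
under eq_eseriesr => j _ do rewrite big_ord_recr/= rot.
have max_ge0 (r : R) : 0 <= Num.max 0 r by rewrite le_max lexx.
have prod_ge0 (a' b' : nat -> R) (x : nat -> R) :
    0 <= \prod_(i < k) (\1_(`]a' i, b' i]) (x i) : R).
  by apply: prodr_ge0.
apply: IH => [|j|x]; rewrite ?mulr_ge0//.
pose y t i := if i == k then t else x i.
have prodE (a' b' : nat -> R) t : \prod_(i < k.+1) (\1_(`]a' i, b' i]) (y t i) : R) =
    (\prod_(i < k) \1_(`]a' i, b' i]) (x i)) * \1_(`]a' k, b' k]) t.
  rewrite big_ord_recr/= /y eqxx; congr (_ * _).
  by apply: eq_bigr => i _; rewrite ltn_eqF.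
rewrite mulrAC -indic_itv_le ?mulr_ge0//.
under [leRHS]eq_eseriesr => j _ do rewrite mulrAC -indic_itv_le ?mulr_ge0//.
rewrite -integral_nneseries//; first last.
- by move=> j t _; rewrite lee_fin !mulr_ge0.
- by move=> j; apply/measurable_EFinP/measurable_funM.
apply: ge0_le_integral => //.
- by move=> t _; rewrite lee_fin !mulr_ge0.
- by apply/measurable_EFinP/measurable_funM.
- apply: ge0_emeasurable_sum => [j t _ _|j _]; first by rewrite lee_fin !mulr_ge0.
  by apply/measurable_EFinP/measurable_funM.
move=> t _; have := hyp (y t); rewrite prodE mulrA => /le_trans; apply.
by apply: lee_nneseries => j _; rewrite ?prodE ?mulrA// lee_fin !mulr_ge0.
Qed.

End lebesgue_boxes.

(** * Measurable sets, translations and null sets of Lebesgue outer measure *)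

Section lebesgue_outer_theory.
Context {R : realType} {n : nat}.
Hypothesis n_gt0 : (0 < n)%N.
Implicit Types (A B : set 'rV[R]_n) (ab : 'rV[R]_n * 'rV[R]_n).
Local Open Scope ereal_scope.
Local Notation mu := (@lebesgue_outer R n).

Lemma lebesgue_outer_box_le ab : mu (box ab) <= (box_volume ab)%:E.
Proof.
apply: ereal_inf_lbound; exists [set ab]; last first.
  by rewrite esum_set1// box_volume_ge0.
by split; [exact: countable1 | move=> x xab; exists ab].
Qed.

Lemma lebesgue_outer_seq_le A (ab : nat -> 'rV[R]_n * 'rV[R]_n) :
  A `<=` \bigcup_k box (ab k) -> mu A <= \sum_(0 <= k <oo) (box_volume (ab k))%:E.
Proof.
move=> /le_lebesgue_outer /le_trans; apply.
apply: (le_trans (lebesgue_outer_sigma_subadditive _)).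
by apply: lee_nneseries => k *; [exact: lebesgue_outer_ge0|exact: lebesgue_outer_box_le].
Qed.

(** Countable covers become sequences. An index outside the range of the injection [f] gets the
    degenerate box (0, 0), whose volume is 0 because n > 0. *)
Lemma lebesgue_outer_seq_lt A (c : \bar R) : mu A < c ->
  exists2 ab : nat -> 'rV[R]_n * 'rV[R]_n, A `<=` \bigcup_k box (ab k) &
    \sum_(0 <= k <oo) (box_volume (ab k))%:E < c.
Proof.
move=> /ereal_inf_lt[_ [D [/countable_injP[f finj] AD] <-] Dc].
pose P k := [set ab | D ab /\ f ab = k].
pose e k := xget (0, 0)%R (P k).
have fK ab : D ab -> e (f ab) = ab.
  move=> Dab; rewrite /e; case: xgetP => [y -> [Dy fy]|/(_ ab)[]//].
  by apply: finj => //; exact/mem_set.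
exists e.
  by move=> x /AD[ab Dab xab]; exists (f ab) => //; rewrite fK.
apply: le_lt_trans Dc.
rewrite nneseries_esumT; last by move=> k; exact: box_volume_ge0.
rewrite [X in _ <= X](_ : _ = \esum_(k in f @` D) (box_volume (e k))%:E); last first.
  by rewrite esum_image//; apply: eq_esum => ab Dab; rewrite fK.
rewrite [leRHS]esum_mkcond; apply: le_esum => k _.
case: ifPn => // /negP; rewrite inE => kD.
rewrite /e; case: xgetP => [y _ [Dy fy]|_]; first by case: kD; exists y.
rewrite lee_fin /box_volume (bigD1 (Ordinal n_gt0))//= subrr.
by rewrite (max_idPl _)// mul0r.
Qed.


(** No compactness is involved: a cover amounts to a pointwise inequality between products of
    interval indicators, which [box_indicator_series_le] integrates one coordinate at a time. *)
Lemma box_volume_le_lebesgue_outer ab : (box_volume ab)%:E <= mu (box ab).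
Proof.
rewrite leNgt; apply/negP => /lebesgue_outer_seq_lt[e sub]; apply/negP.
rewrite -leNgt.
pose co (v : 'rV[R]_n) (i : nat) : R := v 0%R (insubd (Ordinal n_gt0) i).
have volE (cd : 'rV[R]_n * 'rV[R]_n) :
    box_volume cd = (1 * \prod_(i < n) Num.max 0 (co cd.2 i - co cd.1 i))%R.
  by rewrite mul1r; apply: eq_bigr => i _; rewrite /co valKd.
have prod_ge0 (cd : 'rV[R]_n * 'rV[R]_n) (x : nat -> R) :
    (0 <= \prod_(i < n) \1_(`]co cd.1 i, co cd.2 i]) (x i) :> R)%R.
  by apply: prodr_ge0.
have prodE (cd : 'rV[R]_n * 'rV[R]_n) (x : nat -> R) :
    box cd (\row_i x i) ->
    (\prod_(i < n) \1_(`]co cd.1 i, co cd.2 i]) (x i) = 1 :> R)%R.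
  move=> cdx; apply: big1 => i _; rewrite indicE mem_set//=.
  by have := cdx i; rewrite mxE /co valKd.
rewrite volE; under eq_eseriesr => k _ do rewrite volE.
apply: (@box_indicator_series_le R n 1 (fun=> 1%R) (fun k => co (e k).1)
  (fun k => co (e k).2) (co ab.1) (co ab.2)) => // x; rewrite mul1r.
under eq_eseriesr => k _ do rewrite mul1r.
have [abx|nabx] := pselect (box ab (\row_i x i)).
  have [k _ ekx] := sub _ abx.
  rewrite prodE// (_ : 1%:E =
    (\prod_(i < n) \1_(`]co (e k).1 i, co (e k).2 i]) (x i))%:E)%R; last by rewrite prodE.
  apply: le_trans (nneseries_lim_ge k.+1 _); last by move=> j *; rewrite lee_fin; exact: prod_ge0.
  by rewrite big_nat_recr//= leeDr// sume_ge0// => j _; rewrite lee_fin; exact: prod_ge0.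
rewrite [X in X%:E](_ : _ = 0)%R; last first.
  move/existsNP : nabx => [i nabx]; rewrite (bigD1 i)//= indicE memNset ?mul0r//=.
  by move: nabx; rewrite mxE /co valKd.
by apply: nneseries_ge0 => k _ _; rewrite lee_fin; exact: prod_ge0.
Qed.

Lemma lebesgue_outer_box ab : mu (box ab) = (box_volume ab)%:E.
Proof.
by apply/eqP; rewrite eq_le lebesgue_outer_box_le box_volume_le_lebesgue_outer.
Qed.

Let lebesgue_outer_translate_le A (v : 'rV[R]_n) : mu [set x + v | x in A]%R <= mu A.
Proof.
rewrite leNgt; apply/negP => /lebesgue_outer_seq_lt[e sub]; apply/negP.
rewrite -leNgt; pose tr k := ((e k).1 + v, (e k).2 + v)%R.
rewrite [leRHS](_ : _ = \sum_(0 <= k <oo) (box_volume (tr k))%:E); last first.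
  apply: eq_eseriesr => k _; congr EFin; apply: eq_bigr => i _; rewrite !mxE.
  by congr Num.max; ring.
apply: lebesgue_outer_seq_le => _ [x /sub[k _ ekx] <-]; exists k => // i.
by have := ekx i; rewrite !in_itv/= !mxE ltrD2r lerD2r.
Qed.

Lemma lebesgue_outer_translate A (v : 'rV[R]_n) : mu [set x + v | x in A]%R = mu A.
Proof.
apply/eqP; rewrite eq_le lebesgue_outer_translate_le/=.
rewrite [leLHS](_ : _ = mu [set x - v | x in [set x + v | x in A]]%R).
  exact: lebesgue_outer_translate_le.
congr mu; rewrite image_comp -[LHS]image_id; apply: eq_imagel => x _ /=.
by rewrite addrK.
Qed.

Let interval_cut_le (a b r : R) :
  (Num.max 0 (Num.min b r - a) + Num.max 0 (b - Num.max a r) <= Num.max 0 (b - a))%R.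
Proof.
have [ar|ra] := leP a r; have [br|rb] := leP b r.
- by rewrite (_ : Num.max 0 (b - r) = 0)%R ?addr0//; apply/max_idPl; rewrite subr_le0.
- rewrite (_ : Num.max 0 (r - a) = r - a)%R; last by apply/max_idPr; rewrite subr_ge0.
  rewrite (_ : Num.max 0 (b - r) = b - r)%R; last by apply/max_idPr; rewrite subr_ge0 ltW.
  by rewrite le_max; apply/orP; right; lra.
- rewrite (_ : Num.max 0 (b - a) = 0)%R; last first.
    by apply/max_idPl; rewrite subr_le0 (le_trans br) ?ltW.
  by rewrite addr0.
- rewrite (_ : Num.max 0 (r - a) = 0)%R ?add0r//.
  by apply/max_idPl; rewrite subr_le0 ltW.
Qed.

(** The hyperplane x_i = r cuts every box of a cover of X into the boxes [e1 k] and [e2 k], and the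
    two volumes add up to at most the original one. *)
Lemma caratheodory_halfspace i (r : R) :
  mu.-caratheodory [set x : 'rV[R]_n | (x 0 i <= r)%R].
Proof.
apply: le_caratheodory_measurable => X.
rewrite leNgt; apply/negP => /lebesgue_outer_seq_lt[e sub]; apply/negP.
rewrite -leNgt.
pose upd (v : 'rV[R]_n) s : 'rV[R]_n := (\row_j if j == i then s else v 0 j)%R.
pose e1 k := ((e k).1, upd (e k).2 (Num.min ((e k).2 0 i) r))%R.
pose e2 k := (upd (e k).1 (Num.max ((e k).1 0 i) r), (e k).2)%R.
have e1P : mu (X `&` [set x | (x 0 i <= r)%R]) <= \sum_(0 <= k <oo) (box_volume (e1 k))%:E.
  apply: lebesgue_outer_seq_le => x [/sub[k _ ekx] /= xr]; exists k => // j.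
  have := ekx j; rewrite !in_itv/= !mxE => /andP[-> xe].
  by case: (eqVneq j i) xe => [->|_] xe; rewrite ?le_min ?xr ?xe.
have e2P : mu (X `&` ~` [set x | (x 0 i <= r)%R]) <= \sum_(0 <= k <oo) (box_volume (e2 k))%:E.
  apply: lebesgue_outer_seq_le => x [/sub[k _ ekx] /= /negP]; rewrite -ltNge => xr.
  exists k => // j; have := ekx j; rewrite !in_itv/= !mxE => /andP[xe ->].
  by case: (eqVneq j i) xe => [->|_] xe; rewrite andbT// ?gt_max ?xr ?xe.
apply: (le_trans (leeD e1P e2P)).
rewrite -nneseriesD; [|by move=> *; exact: box_volume_ge0..].
apply: lee_nneseries => k *; first by rewrite adde_ge0// box_volume_ge0.
have volE (cd : 'rV[R]_n * 'rV[R]_n) : box_volume cd = (Num.max 0 (cd.2 0 i - cd.1 0 i) *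
    \prod_(j < n | j != i) Num.max 0 (cd.2 0 j - cd.1 0 j))%R.
  by rewrite /box_volume (bigD1 i).
rewrite -EFinD lee_fin !volE /= !mxE eqxx.
rewrite [X in (_ * X + _)%R](_ : _ =
  \prod_(j < n | j != i) Num.max 0 ((e k).2 0 j - (e k).1 0 j))%R; last first.
  by apply: eq_bigr => j /negbTE ji; rewrite !mxE ji.
rewrite [X in (_ + _ * X)%R](_ : _ =
  \prod_(j < n | j != i) Num.max 0 ((e k).2 0 j - (e k).1 0 j))%R; last first.
  by apply: eq_bigr => j /negbTE ji; rewrite !mxE ji.
rewrite -mulrDl ler_wpM2r ?interval_cut_le//.
by apply: prodr_ge0 => j _; rewrite le_max lexx.
Qed.

Lemma caratheodory_box ab : mu.-caratheodory (box ab).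
Proof.
rewrite (_ : box ab = \big[setI/setT]_(i < n)
    ([set x | (x 0 i <= ab.2 0 i)%R] `&` ~` [set x | (x 0 i <= ab.1 0 i)%R])).
  elim/big_ind : _ => [|B C|i _].
  - by rewrite -setC0; exact/caratheodory_measurable_setC/caratheodory_measurable_set0.
  - exact: caratheodory_measurable_setI.
  - apply: caratheodory_measurable_setI; first exact: caratheodory_halfspace.
    exact/caratheodory_measurable_setC/caratheodory_halfspace.
rewrite -bigcap_seq; apply/seteqP; split=> x.
  move=> abx i _; have := abx i; rewrite in_itv/= => /andP[ax xb].
  by split => //=; apply/negP; rewrite -ltNge.
move=> xab i; have [//|/= xb /negP] := xab i; first exact: mem_index_enum.
by rewrite in_itv/= -ltNge => ->.
Qed.

(** An open set is the union of the rational cubes that it contains; the pairs of a centre and an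
    inverse radius are enumerated through [unpickle]. *)
Lemma caratheodory_open (U : set 'rV[R]_n) : open U -> mu.-caratheodory U.
Proof.
move=> oU.
pose B (p : 'rV[rat]_n * nat) : set 'rV[R]_n :=
  box (map_mx ratr p.1 - const_mx p.2.+1%:R^-1, map_mx ratr p.1 + const_mx p.2.+1%:R^-1)%R.
pose F k := if unpickle k is Some p then
  if pselect (B p `<=` U) then B p else set0 else set0.
rewrite (_ : U = \bigcup_k F k).
  apply: caratheodory_measurable_bigcup => k; rewrite /F.
  case: unpickle => [p|]; last exact: caratheodory_measurable_set0.
  case: pselect => ? /=; last exact: caratheodory_measurable_set0.
  exact: caratheodory_box.
apply/seteqP; split => [x Ux|x [k _]]; last first.
  by rewrite /F; case: unpickle => [p|//]; case: pselect => [pU /pU|].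
have /nbhs_ballP[e /= e0 xeU] : nbhs x U by exact: open_nbhs_nbhs.
have [k ke] : exists k, (k.+1%:R^-1 < e / 2 :> R)%R.
  have e20 : (0 < e / 2)%R by rewrite divr_gt0.
  have [k _ /(_ k (leqnn k))] := near_infty_natSinv_lt (PosNum e20).
  by exists k.
have [q xq] : {q : 'I_n -> rat & forall i,
    (ratr (q i) - k.+1%:R^-1 < x 0 i < ratr (q i) + k.+1%:R^-1)%R}.
  apply: (@choice _ _ (fun i q => (ratr q - k.+1%:R^-1 < x 0 i < ratr q + k.+1%:R^-1)%R)) => i.
  have k0 : (0 < k.+1%:R^-1 :> R)%R by [].
  have [|q] := @rat_in_itvoo R (x 0 i - k.+1%:R^-1)%R (x 0 i + k.+1%:R^-1)%R.
    by rewrite ltrD2l gtrN.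
  rewrite in_itv/= => /andP[q1 q2]; exists q.
  by rewrite ltrBlDr q2 -ltrBlDr q1.
pose p := ((\row_i q i)%R, k) : 'rV[rat]_n * nat.
have Bx : B p x.
  by move=> i; have /andP[h1 h2] := xq i; rewrite in_itv/= !mxE h1 ltW.
have BU : B p `<=` U.
  move=> y Bpy; apply: xeU; rewrite -ball_normE/= [X in (X < _)%R]mx_normrE.
  apply/bigmax_ltP; split => //= -[i j] _ /=; rewrite (ord1 i) ltr_norml.
  have := Bpy j; have := xq j; rewrite in_itv/= !mxE => /andP[h1 h2] /andP[h3 h4].
  by set d := (k.+1%:R^-1)%R in ke h1 h2 h3 h4 *; apply/andP; split; lra.
by exists (pickle p) => //; rewrite /F pickleK; case: pselect.
Qed.

Lemma caratheodory_closed (F : set 'rV[R]_n) : closed F -> mu.-caratheodory F.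
Proof.
by move=> cF; rewrite -(setCK F); apply/caratheodory_measurable_setC/caratheodory_open/closed_openC.
Qed.

Lemma bounded_lebesgue_outer_fin A (M : R) :
  (forall x, A x -> forall i, `|x 0 i| <= M)%R -> mu A < +oo.
Proof.
move=> AM; apply: (@le_lt_trans _ _ (mu (box (const_mx (- M - 1), const_mx M)%R))).
  apply: le_lebesgue_outer => x /AM xM i; have := xM i.
  by rewrite in_itv/= !mxE ler_norml => /andP[h1 ->]; rewrite andbT; lra.
by rewrite lebesgue_outer_box ltry.
Qed.

Lemma caratheodory_translate A (v : 'rV[R]_n) :
  mu.-caratheodory A -> mu.-caratheodory [set x + v | x in A]%R.
Proof.
move=> mA X; have tK (Y : set 'rV[R]_n) :
    [set x + v | x in [set x - v | x in Y]]%R = Y.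
  rewrite image_comp -[RHS]image_id; apply: eq_imagel => x _ /=.
  by rewrite subrK.
have tI (Y Z : set 'rV[R]_n) : [set x + v | x in Y `&` Z]%R =
    [set x + v | x in Y]%R `&` [set x + v | x in Z]%R.
  apply/seteqP; split => [_ [x [Yx Zx] <-]|_ [[x Yx <-] [y Zy /addIr yx]]].
    by split; exists x.
  by exists x => //; split => //; rewrite -yx.
have tC (Y : set 'rV[R]_n) : [set x + v | x in ~` Y]%R = ~` [set x + v | x in Y]%R.
  apply/seteqP; split => [_ [x nYx <-] [y Yy /addIr yx]|x nYx].
    by apply: nYx; rewrite -yx.
  exists (x - v)%R; last by rewrite subrK.
  by move=> Yx; apply: nYx; exists (x - v)%R => //; rewrite subrK.
rewrite -[in LHS](tK X) lebesgue_outer_translate (mA [set x - v | x in X]%R).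
by rewrite -(lebesgue_outer_translate (_ `&` A) v) -(lebesgue_outer_translate (_ `&` ~` A) v)
  !tI tC tK.
Qed.

(* A bounded set cannot contain infinitely many disjoint copies of A unless A
   is null. *)
Lemma lebesgue_outer_disjoint_translates_eq0 A (M : R) (v : 'rV[R]_n) :
  mu.-caratheodory A -> (forall x, A x -> forall i, `|x 0 i| <= M)%R ->
  (forall (t : R) x, (0 < t)%R -> A x -> ~ A (x + t *: v)%R) -> mu A = 0.
Proof.
move=> mA AM Av.
pose T k := [set x + (k.+1%:R^-1 *: v) | x in A]%R.
have mT k : mu.-caratheodory (T k) by exact: caratheodory_translate.
have ltT j k : (j < k)%N -> T j `&` T k = set0.
  move=> jk; apply/seteqP; split => // _ [[x Ax <-] [y Ay yx]].
  apply: (Av (j.+1%:R^-1 - k.+1%:R^-1)%R x _ Ax).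
    by rewrite subr_gt0 ltf_pV2 ?posrE// ltr_nat ltnS.
  rewrite scalerBl addrA -yx addrK//.
have tT : trivIset setT T.
  apply/trivIsetP => j k _ _; rewrite neq_ltn => /orP[/ltT//|/ltT].
  by rewrite setIC.
apply/eqP; rewrite eq_le lebesgue_outer_ge0 andbT leNgt; apply/negP => A0.
have : mu (\bigcup_k T k) < +oo.
  apply: (@bounded_lebesgue_outer_fin _ (M + `|v|)%R) => _ [k _ [x Ax <-]] i.
  rewrite !mxE (le_trans (ler_normD _ _))// lerD//; first exact: AM.
  rewrite normrM ger0_norm// (le_trans (ler_piMl _ _))// ?invf_le1 ?ler1n//.
  rewrite [leRHS]mx_normrE; apply/bigmax_geP; right => /=; exists (ord0, i) => //.
have -> : mu (\bigcup_k T k) = \sum_(0 <= k <oo) mu (T k).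
  apply/esym/cvg_lim => //.
  exact: (caratheodory_measure_sigma_additive mT tT (caratheodory_measurable_bigcup mT)).
under eq_eseriesr do rewrite lebesgue_outer_translate.
have Afin : mu A \is a fin_num.
  by rewrite ge0_fin_numE ?lebesgue_outer_ge0// (bounded_lebesgue_outer_fin AM).
rewrite -(fineK Afin) lte_fin in A0 *; set a := fine (mu A) in A0 *.
have a_ge0 : 0 <= a%:E by rewrite lee_fin ltW.
set S := (X in X < _) => Soo.
have Sge0 : 0 <= S by exact: nneseries_ge0.
have Sfin : S \is a fin_num by rewrite ge0_fin_numE.
have := @nneseries_lim_ge R (fun=> a%:E) xpredT 0 (Num.truncn (fine S / a)).+1 (fun _ _ _ => a_ge0).
rewrite -/S -(fineK Sfin) sumEFin sumr_const_nat subn0 lee_fin -mulr_natl.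
by rewrite -ler_pdivlMr// leNgt truncnS_gt.
Qed.

Lemma lebesgue_outer_bigcup0 (A : nat -> set 'rV[R]_n) :
  (forall k, mu (A k) = 0) -> mu (\bigcup_k A k) = 0.
Proof.
move=> A0; apply/eqP; rewrite eq_le lebesgue_outer_ge0 andbT.
apply: (le_trans (lebesgue_outer_sigma_subadditive _)).
by rewrite eseries0// => k _ _; exact: A0.
Qed.

(** Growing boxes reduce this to the bounded case. It is the source of the null sets below:
    hyperplanes, and slopes touching on both sides of a slab. *)
Lemma lebesgue_outer_translates_eq0 A (v : 'rV[R]_n) : mu.-caratheodory A ->
  (forall (t : R) x, (0 < t)%R -> A x -> ~ A (x + t *: v)%R) -> mu A = 0.
Proof.
move=> mA Av.
pose B k := A `&` box (const_mx (- k%:R), const_mx k%:R)%R.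
rewrite (_ : A = \bigcup_k B k).
  apply: lebesgue_outer_bigcup0 => k.
  apply: (@lebesgue_outer_disjoint_translates_eq0 (B k) k%:R%R v).
  - exact/caratheodory_measurable_setI/caratheodory_box.
  - move=> x [_ xk] j; have := xk j; rewrite in_itv/= !mxE ler_norml => /andP[/ltW -> ->].
    by [].
  - by move=> t x t0 [Ax _] [/(Av _ _ t0 Ax)].
apply/seteqP; split => [x Ax|x [k _ []//]].
exists (Num.truncn `|x|%R).+1 => //; split => // j; rewrite in_itv/= !mxE.
have xj : (`|x 0 j| <= `|x|)%R.
  by rewrite [leRHS]mx_normrE; apply/bigmax_geP; right => /=; exists (ord0, j).
by have := le_lt_trans xj (truncnS_gt _); rewrite ltr_norml => /andP[-> /ltW ->].
Qed.

Lemma hyperplane_lebesgue_outer0 i (c : R) : mu [set x : 'rV[R]_n | (x 0 i = c)%R] = 0.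
Proof.
apply: (@lebesgue_outer_translates_eq0 _ (delta_mx 0 i)%R); last first.
  by move=> t x t0 /= xc; rewrite !mxE !eqxx mulr1 xc; lra.
rewrite (_ : [set x | _] = [set x : 'rV[R]_n | (x 0 i <= c)%R] `&`
   ~` \bigcup_j [set x : 'rV[R]_n | (x 0 i <= c - j.+1%:R^-1)%R]).
  apply: caratheodory_measurable_setI; first exact: caratheodory_halfspace.
  apply: caratheodory_measurable_setC; apply: caratheodory_measurable_bigcup => j.
  exact: caratheodory_halfspace.
apply/seteqP; split => [x /= xc|x /= [xc xj]].
  split => /=; first by rewrite xc.
  case=> j _ /=; rewrite xc; have : (0 < j.+1%:R^-1 :> R)%R by [].
  by set d := (j.+1%:R^-1)%R; lra.
apply/eqP; rewrite eq_le xc/= leNgt; apply/negP => cx.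
have e0 : (0 < c - x 0 i)%R by rewrite subr_gt0.
have [j _ /(_ j (leqnn j))/= jc] := near_infty_natSinv_lt (PosNum e0).
by apply: xj; exists j => //=; rewrite lerBrDr addrC -lerBrDr ltW.
Qed.

Lemma lebesgue_outerU A B : mu.-caratheodory A ->
  mu (A `&` B) = 0 -> mu A + mu B <= mu (A `|` B).
Proof.
move=> mA AB0; rewrite (mA (A `|` B)) leeD//.
  by apply: le_lebesgue_outer => x Ax; split => //; left.
rewrite [leLHS](mA B) setIC AB0 add0e.
by apply: le_lebesgue_outer => x [Bx nAx]; split => //; right.
Qed.

Lemma lebesgue_outer_setD_le A B : mu.-caratheodory B ->
  mu A <= mu B + mu (A `\` B).
Proof.
move=> mB; rewrite (mB A) leeD//.
by apply: le_lebesgue_outer => x [].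
Qed.

Lemma lebesgue_outer_setU_le A B : mu (A `|` B) <= mu A + mu B.
Proof. exact: outer_measureU2. Qed.

Lemma lebesgue_outer_bigcup_gt (A : nat -> set 'rV[R]_n) (c : \bar R) :
  (forall k, mu.-caratheodory (A k)) -> {homo A : j k / (j <= k)%N >-> j `<=` k} ->
  c < mu (\bigcup_k A k) -> exists k, c < mu (A k).
Proof.
move=> mA ndA cA; apply: contrapT => /forallNP Ac.
have cvA : (lebesgue_rV : set (caratheodory_type mu) -> _) \o A @ \oo --> mu (\bigcup_k A k).
  apply: nondecreasing_cvg_mu => //; first exact: caratheodory_measurable_bigcup.
  by move=> j k /ndA /subsetPset.
have : limn ((lebesgue_rV : set (caratheodory_type mu) -> _) \o A) <= c.
  apply: lime_le; first by apply/cvg_ex; eexists; exact: cvA.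
  by apply: nearW => k /=; rewrite leNgt; apply/negP/Ac.
by rewrite (cvg_lim _ cvA)// leNgt cA.
Qed.

Lemma lebesgue_outer_bigcap_lt (A : nat -> set 'rV[R]_n) (c : \bar R) :
  (forall k, mu.-caratheodory (A k)) -> {homo A : j k / (j <= k)%N >-> k `<=` j} ->
  mu (A 0%N) < +oo -> mu (\bigcap_k A k) < c -> exists k, mu (A k) < c.
Proof.
move=> mA ndA A0 cA; apply: contrapT => /forallNP Ac.
have mcap : mu.-caratheodory (\bigcap_k A k).
  rewrite -[X in mu.-caratheodory X]setCK setC_bigcap.
  apply/caratheodory_measurable_setC/caratheodory_measurable_bigcup => k.
  exact/caratheodory_measurable_setC.
have cvA : (lebesgue_rV : set (caratheodory_type mu) -> _) \o A @ \oo --> mu (\bigcap_k A k).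
  apply: nonincreasing_cvg_mu => //.
  by move=> j k /ndA /subsetPset.
have : c <= limn ((lebesgue_rV : set (caratheodory_type mu) -> _) \o A).
  apply: lime_ge; first by apply/cvg_ex; eexists; exact: cvA.
  by apply: nearW => k /=; rewrite leNgt; apply/negP/Ac.
by rewrite (cvg_lim _ cvA)// leNgt cA.
Qed.

End lebesgue_outer_theory.

(** * Continuity and slopes *)

Section dot_product.
Context {R : realType} {n : nat}.
Implicit Types (q x y : 'rV[R]_n) (a : R).

Lemma coord_le_norm x i : `|x 0 i| <= `|x|.
Proof.
by rewrite [leRHS]mx_normrE; apply/bigmax_geP; right => /=; exists (ord0, i).
Qed.

Lemma norm_rV_le x a : 0 <= a -> (forall i, `|x 0 i| <= a) -> `|x| <= a.
Proof.
move=> a0 xa; rewrite [leLHS]mx_normrE; apply/bigmax_leP; split => //= -[i j] _.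
by rewrite (ord1 i).
Qed.

Lemma dotvC q x : dotv q x = dotv x q.
Proof. by apply: eq_bigr => i _; rewrite mulrC. Qed.

Lemma dotvDr q x y : dotv q (x + y) = dotv q x + dotv q y.
Proof. by rewrite /dotv -big_split; apply: eq_bigr => i _; rewrite mxE mulrDr. Qed.

Lemma dotvZr q x a : dotv q (a *: x) = a * dotv q x.
Proof. by rewrite /dotv mulr_sumr; apply: eq_bigr => i _; rewrite mxE mulrCA. Qed.

Lemma dotvNr q x : dotv q (- x) = - dotv q x.
Proof. by rewrite -scaleN1r dotvZr mulN1r. Qed.

Lemma dotvBr q x y : dotv q (x - y) = dotv q x - dotv q y.
Proof. by rewrite dotvDr dotvNr. Qed.

Lemma dotv0r q : dotv q 0 = 0.
Proof. by rewrite -(scale0r 0) dotvZr mul0r. Qed.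

Lemma dotvDl q x y : dotv (x + y) q = dotv x q + dotv y q.
Proof. by rewrite !(dotvC _ q) dotvDr. Qed.

Lemma dotvZl q x a : dotv (a *: x) q = a * dotv x q.
Proof. by rewrite !(dotvC _ q) dotvZr. Qed.

Lemma dotvNl q x : dotv (- x) q = - dotv x q.
Proof. by rewrite !(dotvC _ q) dotvNr. Qed.

Lemma dotvBl q x y : dotv (x - y) q = dotv x q - dotv y q.
Proof. by rewrite !(dotvC _ q) dotvBr. Qed.

Lemma dotv0l q : dotv 0 q = 0.
Proof. by rewrite dotvC dotv0r. Qed.

Lemma dotv_delta q i : dotv q (delta_mx 0 i) = q 0 i.
Proof.
rewrite /dotv (bigD1 i)//= mxE !eqxx mulr1 big1 ?addr0// => j /negbTE ji.
by rewrite mxE ji andbF mulr0.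
Qed.

Lemma dotv_sqrD x y : dotv (x + y) (x + y) = dotv x x + 2 * dotv x y + dotv y y.
Proof. by rewrite dotvDr !dotvDl (dotvC y x); ring. Qed.

Lemma dotv_norm_le q x : `|dotv q x| <= n%:R * (`|q| * `|x|).
Proof.
apply: (le_trans (ler_norm_sum _ _ _)).
rewrite mulr_natl -[X in _ *+ X]card_ord -sumr_const; apply: ler_sum => i _.
by rewrite normrM ler_pM// coord_le_norm.
Qed.

Lemma cvg_dotv (T : Type) (F : set_system T) (f g : T -> 'rV[R]_n) q x : Filter F ->
  f @ F --> q -> g @ F --> x -> (fun t => dotv (f t) (g t)) @ F --> dotv q x.
Proof.
move=> FF fq gx.
apply: (@cvg_big _ _ +%R) => [|i _]; first exact: add_continuous.
apply: cvgM.
  by apply: (@cvg_comp _ _ _ f (fun v : 'rV[R]_n => v 0 i) _ _ _ fq); exact: coord_continuous.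
by apply: (@cvg_comp _ _ _ g (fun v : 'rV[R]_n => v 0 i) _ _ _ gx); exact: coord_continuous.
Qed.

Lemma continuous_dotv (T : topologicalType) (f g : T -> 'rV[R]_n) :
  continuous f -> continuous g -> continuous (fun t => dotv (f t) (g t)).
Proof. by move=> cf cg t; apply: cvg_dotv; [exact: cf|exact: cg]. Qed.

End dot_product.

Section continuous_pointwise.
Context {R : realType} {T : topologicalType}.

Lemma continuous_add (V : normedModType R) (f g : T -> V) :
  continuous f -> continuous g -> continuous (fun t => f t + g t).
Proof. by move=> cf cg t; apply: cvgD; [exact: cf|exact: cg]. Qed.

Lemma continuous_sub (V : normedModType R) (f g : T -> V) :
  continuous f -> continuous g -> continuous (fun t => f t - g t).
Proof. by move=> cf cg t; apply: cvgB; [exact: cf|exact: cg]. Qed.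

Lemma continuous_mul (f g : T -> R) :
  continuous f -> continuous g -> continuous (fun t => f t * g t).
Proof. by move=> cf cg t; apply: cvgM; [exact: cf|exact: cg]. Qed.

Lemma continuous_minr (f g : T -> R) :
  continuous f -> continuous g -> continuous (fun t => Num.min (f t) (g t)).
Proof. by move=> cf cg t; apply: (continuous_min (cf t) (cg t)). Qed.

End continuous_pointwise.

Lemma continuous_compose (T U W : topologicalType) (f : T -> U) (g : U -> W) :
  continuous f -> continuous g -> continuous (fun t => g (f t)).
Proof. by move=> cf cg t; exact: (@continuous_comp _ _ _ f g t (cf t) (cg (f t))). Qed.

Lemma continuous_fst (T U : topologicalType) : continuous (@fst T U).
Proof. by move=> p; exact: cvg_fst. Qed.

Lemma continuous_snd (T U : topologicalType) : continuous (@snd T U).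
Proof. by move=> p; exact: cvg_snd. Qed.

Lemma continuous_norm_fun (R : realType) (T : topologicalType) (V : normedModType R)
  (f : T -> V) : continuous f -> continuous (fun t => `|f t|).
Proof. by move=> cf t; apply: cvg_norm; exact: cf. Qed.

Lemma continuous_subr_cst (R : realType) (n : nat) (x : 'rV[R]_n) :
  continuous (fun y : 'rV[R]_n => y - x).
Proof.
by apply: continuous_sub; [move=> y; exact: cvg_id|exact: cst_continuous].
Qed.

(** Tube lemma. The slope sets below are closed, hence measurable, as projections of closed
    conditions on a pair of a slope and a touching point in a compact set. *)
Lemma closed_exists_compact (T U : topologicalType) (S : set U) (P : set (T * U)) :
  compact S -> closed P -> closed [set t | exists2 x, S x & P (t, x)].
Proof.
move=> /compact_near_coveringP cS cP.
rewrite -[X in closed X]setCK; apply: open_closedC; rewrite openE => t nt.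
have : \forall t' \near nbhs t, S `<=` (fun x => ~ P (t', x)).
  apply: cS => x Sx.
  have : nbhs (t, x) (~` P).
    by apply: open_nbhs_nbhs; split; [exact: closed_openC|move=> Ptx; apply: nt; exists x].
  case=> -[A B] /= [tA xB] AB; exists (B, A) => //= -[x' t'] /= [Bx' At'].
  exact: (AB (t', x')).
by apply: filterS => t' St' [x Sx]; exact: St'.
Qed.

Lemma closed_le_continuous (R : realType) (T : topologicalType) (f g : T -> R) :
  continuous f -> continuous g -> closed [set t | f t <= g t].
Proof.
move=> cf cg.
rewrite (_ : [set t | _] = (fun t => g t - f t) @^-1` [set r | 0 <= r]).
  apply: closed_comp; last exact: closed_ge.
  by move=> t _; apply: cvgB; [exact: cg|exact: cf].
by apply/seteqP; split => t /=; rewrite subr_ge0.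
Qed.

Lemma closed_slice (T U : topologicalType) (C : set (T * U)) (u : U) :
  closed C -> closed [set t | C (t, u)].
Proof.
move=> cC; rewrite (_ : [set t | _] = (fun t => (t, u)) @^-1` C)//.
apply: closed_comp => // t _.
by apply: cvg_pair; [exact: cvg_id|exact: cvg_cst].
Qed.

Lemma lipschitz_continuous (R : realType) (V : normedModType R) (w : V -> R) (L : R) :
  0 <= L -> (forall x y, w x <= w y + L * `|x - y|) -> continuous w.
Proof.
move=> L0 wL x; apply/cvgrPdist_lt => e e0.
have L1 : 0 < L + 1 by rewrite ltr_wpDl.
have : nbhs x (ball x (e / (L + 1))) by apply: nbhsx_ballx; rewrite divr_gt0.
apply: filterS => y; rewrite -ball_normE/= ltr_pdivlMr// mulrDr mulr1 => xy.
have := wL x y; have := wL y x; rewrite (distrC y) [L * _]mulrC.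
have := normr_ge0 (x - y); rewrite ltr_norml => h1 h2 h3.
by apply/andP; split; lra.
Qed.

(** * Slopes of planes touching a function on a set *)

Section slopes.
Context {R : realType} {n : nat}.
Implicit Types (x y q : 'rV[R]_n) (Z S K : set 'rV[R]_n) (phi : 'rV[R]_n -> R).
Local Notation mu := (@lebesgue_outer R n).

(** The set Z where the plane has to stay below [phi] varies: the domain, its closure, a compact
    neighbourhood, a finite net. Enlarging Z can only remove slopes. *)
Definition slopes Z phi S : set 'rV[R]_n :=
  \bigcup_(x in S) subdifferential Z phi x.

Lemma slopes_subset Z phi S K : S `<=` K -> slopes Z phi S `<=` slopes Z phi K.
Proof. by move=> SK q [x /SK Kx qx]; exists x. Qed.

Lemma slopesU Z phi S K : slopes Z phi (S `|` K) = slopes Z phi S `|` slopes Z phi K.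
Proof. exact: bigcup_setU. Qed.

Lemma closed_subdifferential (T : topologicalType) (X Q : T -> 'rV[R]_n) Z phi :
  continuous phi -> continuous X -> continuous Q ->
  closed [set t | subdifferential Z phi (X t) (Q t)].
Proof.
move=> cphi cX cQ.
rewrite (_ : [set t | _] = \bigcap_(y in Z)
    [set t | phi (X t) + dotv (Q t) (y - X t) <= phi y]).
  apply: closed_bigI => y _; apply: closed_le_continuous; last exact: cst_continuous.
  apply: continuous_add.
    exact: continuous_compose.
  apply: continuous_dotv => //.
  by apply: continuous_sub => //; exact: cst_continuous.
by apply/seteqP; split => t tZ y Zy; exact: tZ.
Qed.

Lemma closed_slopes Z phi S : continuous phi -> compact S -> closed (slopes Z phi S).
Proof.
move=> cphi cS; apply: (@closed_exists_compact _ _ S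
  [set p : 'rV[R]_n * 'rV[R]_n | subdifferential Z phi p.2 p.1] cS).
apply: (closed_subdifferential (X := snd) (Q := fst)) => //.
  exact: continuous_snd.
exact: continuous_fst.
Qed.

Lemma subdifferential_monotone Z phi x y p q : Z x -> Z y ->
  subdifferential Z phi x p -> subdifferential Z phi y q -> 0 <= dotv (p - q) (x - y).
Proof.
move=> Zx Zy /(_ y Zy) + /(_ x Zx); rewrite dotvBl !dotvBr; lra.
Qed.

(** The touching plane is tested at x + r e_i and x - r e_i, where [phi] differs from phi x by at
    most 2 M. *)
Lemma slopes_coord_bound Z phi S r M : 0 < r ->
  (forall x y, S x -> `|y - x| <= r -> Z y) -> (forall y, Z y -> `|phi y| <= M) ->
  forall q, slopes Z phi S q -> forall i, `|q 0 i| <= 2 * M / r.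
Proof.
move=> r0 SrZ phiM q [x Sx qx] i.
have Zx : Z x by apply: (SrZ x) => //; rewrite subrr normr0 ltW.
have side (e : R) : `|e| <= 1 -> e * q 0 i * r <= 2 * M.
  move=> e1.
  have Zy : Z (x + (r * e) *: delta_mx 0 i).
    apply: (SrZ x) => //; rewrite addrAC subrr add0r.
    apply: norm_rV_le; rewrite ?ltW// => j; rewrite !mxE eqxx /= normrM normrM.
    rewrite (gtr0_norm r0) -mulrA ler_piMr// ?(ltW r0)//.
    by rewrite mulr_ile1//; case: eqP; rewrite ?normr1 ?normr0.
  have := qx _ Zy; rewrite addrAC subrr add0r dotvZr dotv_delta.
  have := phiM _ Zx; have := phiM _ Zy; rewrite !ler_norml.
  move=> /andP[? ?] /andP[? ?] ?.
  have -> : e * q 0 i * r = r * e * q 0 i by ring.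
  lra.
have := side 1; have := side (-1); rewrite normrN normr1 => /(_ (lexx _)) h1 /(_ (lexx _)) h2.
rewrite ler_norml lerNl ler_pdivlMr// ler_pdivlMr//; apply/andP; split; lra.
Qed.

Section null.
Hypothesis n_gt0 : (0 < n)%N.

(** If q touches at y with y_i >= b and q + t e_i, t > 0, touches at x with x_i <= a, monotonicity
    gives t (x_i - y_i) >= 0, contradicting a < b. *)
Let slopes_separated_null Z phi i (a b : R) : continuous phi -> compact Z -> a < b ->
  mu (slopes Z phi (Z `&` [set x | x 0 i <= a]) `&`
      slopes Z phi (Z `&` [set x | b <= x 0 i])) = 0%E.
Proof.
move=> cphi cZ ab.
have cl (S : set 'rV[R]_n) : closed S -> closed (slopes Z phi (Z `&` S)).
  move=> cS; apply: closed_slopes => //.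
  apply: (@subclosed_compact _ _ Z) => //; apply: closedI => //.
  by apply: compact_closed => //; exact: norm_hausdorff.
have co : continuous (fun x : 'rV[R]_n => x 0 i) by exact: coord_continuous.
apply: (@lebesgue_outer_translates_eq0 _ _ n_gt0 _ (delta_mx 0 i)).
  apply: caratheodory_closed => //; apply: closedI; apply: cl.
    by apply: closed_le_continuous => //; exact: cst_continuous.
  by apply: closed_le_continuous => //; exact: cst_continuous.
move=> t q t0 [_ [y [Zy /= yb] qy]] [[x [Zx /= xa] qx] _].
have := subdifferential_monotone Zx Zy qx qy.
rewrite (addrC q) addrK dotvZl dotvC dotv_delta !mxE.
rewrite pmulr_rge0//; lra.
Qed.

Definition multiple_slopes Z phi : set 'rV[R]_n := [set q | exists x y,
  [/\ Z x, Z y, x != y, subdifferential Z phi x q & subdifferential Z phi y q]].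

(* A slope touching at two distinct points touches on both sides of a rational
   slab, and along the normal of the slab there is at most one such slope. *)
Lemma multiple_slopes_null Z phi : continuous phi -> compact Z ->
  mu (multiple_slopes Z phi) = 0%E.
Proof.
move=> cphi cZ.
pose N i (a b : R) := slopes Z phi (Z `&` [set x | x 0 i <= a]) `&`
  slopes Z phi (Z `&` [set x | b <= x 0 i]).
pose F k := if (unpickle k : option ('I_n * (rat * rat))) is Some (i, (a, b)) then
  if (a < b)%R then N i (ratr a) (ratr b) else set0 else set0.
suff sub : multiple_slopes Z phi `<=` \bigcup_k F k.
  apply/eqP; rewrite eq_le lebesgue_outer_ge0 andbT.
  apply: (le_trans (le_lebesgue_outer sub)).
  rewrite lebesgue_outer_bigcup0// => k; rewrite /F.
  case: unpickle => [[i [a b]]|]; last exact: lebesgue_outer0.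
  case: ifP => ab; last exact: lebesgue_outer0.
  by apply: slopes_separated_null => //; rewrite ltr_rat.
move=> q [x [y [Zx Zy xy qx qy]]].
have [i {}xy] : exists i, x 0 i != y 0 i.
  apply: contrapT => /forallNP xyE; move/eqP: xy; apply.
  by apply/rowP => i; have /negP := xyE i; rewrite negbK => /eqP.
have W x' y' : Z x' -> Z y' -> subdifferential Z phi x' q ->
    subdifferential Z phi y' q -> x' 0 i < y' 0 i -> (\bigcup_k F k) q.
  move=> Zx' Zy' qx' qy' xy'.
  have [a] := rat_in_itvoo xy'; rewrite in_itv/= => /andP[xa ay].
  have [b] := rat_in_itvoo ay; rewrite in_itv/= => /andP[ab byy].
  exists (pickle (i, (a, b))) => //; rewrite /F pickleK -(ltr_rat R) ab.
  by split; [exists x' => //; split => //=; exact: ltW|exists y' => //; split => //=; exact: ltW].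
by move: xy; rewrite neq_lt => /orP[xy|yx]; [exact: (W x y)|exact: (W y x)].
Qed.

Lemma slopes_disjoint_null Z phi S K : continuous phi -> compact Z ->
  S `<=` Z -> K `<=` Z -> S `&` K = set0 ->
  mu (slopes Z phi S `&` slopes Z phi K) = 0%E.
Proof.
move=> cphi cZ SZ KZ SK0.
apply/eqP; rewrite eq_le lebesgue_outer_ge0 andbT -(multiple_slopes_null cphi cZ).
apply: le_lebesgue_outer => q [[x Sx qx] [y Ky qy]]; exists x, y; split => //.
- exact: SZ.
- exact: KZ.
- apply/eqP => xyE; rewrite -[False]/(set0 x) -SK0; split => //.
  by rewrite xyE.
Qed.

End null.
End slopes.

(** * Convex functions and existence of subgradients *)

Section convexity.
Context {R : realType} {n : nat}.
Implicit Types (x y q : 'rV[R]_n) (Omega K : set 'rV[R]_n) (f g : 'rV[R]_n -> R).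

Definition convex_on Omega f := forall x y (t : R), Omega x -> Omega y ->
  0 <= t <= 1 -> f (t *: x + (1 - t) *: y) <= t * f x + (1 - t) * f y.

Lemma convex_function_on Omega f : convex_function Omega f -> convex_on Omega f.
Proof.
move=> cf x y t Ox Oy t01.
have /andP[t0 t1] := t01.
have := cf (Itv01 t0 t1) x y; rewrite !inE => /(_ Ox Oy).
by [].
Qed.

Lemma convex_setP Omega x y (t : R) : convex_set Omega -> Omega x -> Omega y ->
  0 <= t <= 1 -> Omega (t *: x + (1 - t) *: y).
Proof.
move=> cO Ox Oy /andP[t0 t1].
have := cO x y (Itv01 t0 t1); rewrite !inE => /(_ Ox Oy).
by [].
Qed.

Lemma convex_onD Omega f g : convex_on Omega f -> convex_on Omega g ->
  convex_on Omega (f \+ g).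
Proof.
move=> cf cg x y t Ox Oy t01 /=.
by rewrite (le_trans (lerD (cf _ _ _ Ox Oy t01) (cg _ _ _ Ox Oy t01)))//; lra.
Qed.

Lemma compact_norm_ball x (r : R) : compact [set y | `|y - x| <= r].
Proof.
apply: bounded_closed_compact.
  exists (`|x| + r); split; first exact: num_real.
  move=> M xrM y /= yxr; apply/ltW/le_lt_trans/xrM.
  by rewrite -(subrK x y) addrC (le_trans (ler_normD _ _))// lerD2l.
apply: closed_le_continuous; last exact: cst_continuous.
by apply: continuous_norm_fun; exact: continuous_subr_cst.
Qed.

Lemma compact_thicken_subset K Omega : compact K -> open Omega -> K `<=` Omega ->
  exists2 r : R, 0 < r & forall x y, K x -> `|y - x| <= r -> Omega y.
Proof.
move=> /compact_near_coveringP cK oO KO.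
have : \forall r \near (0 : R)^'+, K `<=` (fun x => forall y, `|y - x| <= r -> Omega y).
  apply: cK => x /KO Ox.
  have /nbhs_ballP[e /= e0 xeO] : nbhs x Omega by exact: open_nbhs_nbhs.
  have e20 : 0 < e / 2 by rewrite divr_gt0.
  exists (ball x (e / 2), [set r | r < e / 2]) => /=.
    by split; [exact: nbhsx_ballx|exact: nbhs_right_lt].
  move=> [x' r] /= []; rewrite -ball_normE/= => xx' re y yx'; apply: xeO.
  rewrite -ball_normE/= (_ : x - y = (x - x') - (y - x')); last by rewrite opprB addrA subrK.
  by rewrite (splitr e) (le_lt_trans (ler_normB _ _))// ltrD// (le_lt_trans yx').
move=> H; have [r [/= Hr r0]] := filter_ex (filterI H (nbhs_right_gt 0)).
by exists r => // x y Kx; exact: Hr.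
Qed.

Lemma compact_thicken K (r : R) : compact K ->
  compact [set y | exists2 x, K x & `|y - x| <= r].
Proof.
move=> cK; apply: bounded_closed_compact.
  have [M [Mr KM]] := compact_bounded cK.
  exists (M + 1 + r); split; first exact: num_real.
  move=> N MN y [x Kx yx]; apply/ltW/(le_lt_trans _ MN).
  rewrite -(subrK x y) addrC (le_trans (ler_normD _ _))// lerD// KM//.
  by rewrite ltrDl.
pose P := [set p : 'rV[R]_n * 'rV[R]_n | `|p.1 - p.2| <= r].
have cP : closed P.
  apply: closed_le_continuous; last exact: cst_continuous.
  apply: continuous_norm_fun.
  by apply: continuous_sub; [exact: continuous_fst|exact: continuous_snd].
exact: (closed_exists_compact cK cP).
Qed.

Lemma dotv_ge0 x : 0 <= dotv x x.
Proof. by apply: sumr_ge0 => i _; rewrite -expr2 sqr_ge0. Qed.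

Lemma compact_bound K f : compact K -> continuous f ->
  exists2 M, 0 < M & forall x, K x -> `|f x| <= M.
Proof.
move=> cK cf.
have cfK : compact (f @` K) by apply: continuous_compact => //; exact: continuous_subspaceT.
have [M [Mr fM]] := compact_bounded cfK.
exists (`|M| + 1); first by rewrite ltr_wpDl.
by move=> x Kx; apply: fM; [rewrite (le_lt_trans (ler_norm M))// ltrDl|exists x].
Qed.

Lemma compact_argmin K f : compact K -> continuous f -> K !=set0 ->
  exists2 x, K x & forall y, K y -> f x <= f y.
Proof.
move=> cK cf K0.
have [|x + xm] := EVT_min_rV K0 cK (f := f); first exact: continuous_subspaceT.
by rewrite inE => Kx; exists x => // y Ky; apply: xm; rewrite inE.
Qed.

(** A penalty replaces a separation theorem: f + k |. - x|^2 with k large has a minimum y over B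
    close to x, and by convexity -2k (y - x) is a subgradient of f at y. These subgradients are
    bounded independently of k, so the set [S] of points with a bounded subgradient is closed and
    has x in its closure. *)
Lemma subgradient_exists Omega f x : open Omega -> convex_set Omega ->
  continuous f -> convex_on Omega f -> Omega x -> subdifferential Omega f x !=set0.
Proof.
move=> oO cO cf cvf Ox.
have [|r r0 xrO] := @compact_thicken_subset [set x] Omega (@compact_set1 _ x) oO.
  by move=> _ ->.
have {xrO} xrO y : `|y - x| <= r -> Omega y by exact: xrO.
pose B := [set y | `|y - x| <= r].
have cB : compact B by exact: compact_norm_ball.
have [M M0 BM] := compact_bound cB cf.
have r20 : 0 < r / 2 by rewrite divr_gt0.
pose Q := [set q : 'rV[R]_n | `|q - 0| <= 2 * M / (r / 2)].
have cQ : compact Q by exact: compact_norm_ball.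
pose S := [set y | exists2 q, Q q & subdifferential Omega f y q].
have cS : closed S.
  pose P := [set p : 'rV[R]_n * 'rV[R]_n | subdifferential Omega f p.1 p.2].
  apply: (@closed_exists_compact _ _ Q P cQ).
  apply: (closed_subdifferential (X := fst) (Q := snd)) => //.
    exact: continuous_fst.
  exact: continuous_snd.
suff [q _ qx] : S x by exists q.
rewrite (closure_id S).1// => U /nbhs_ballP[e /= e0 xeU].
pose d := Num.min (e / 2) (r / 2).
have d0 : 0 < d by rewrite lt_min !divr_gt0.
(* On B the values of f differ by at most 2 M, so a point at distance d or more from x pays a
   penalty that no decrease of f compensates. *)
have [k kM] : exists k : R, 0 < k /\ 2 * M < k * d ^+ 2.
  exists ((2 * M + 1) / d ^+ 2); split; first by rewrite divr_gt0 ?exprn_gt0// addr_gt0 ?mulr_gt0.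
  by rewrite divfK ?expf_neq0 ?gt_eqF// ltrDl.
pose h y := f y + k * dotv (y - x) (y - x).
have ch : continuous h.
  apply: continuous_add => //; apply: continuous_mul; first exact: cst_continuous.
  by apply: continuous_dotv; exact: continuous_subr_cst.
have Bx : B x by rewrite /B/= subrr normr0 ltW.
have [y By ymin] := compact_argmin cB ch (ex_intro _ x Bx).
have dot_ge (z : 'rV[R]_n) : `|z| ^+ 2 <= dotv z z.
  have [->|z0] := eqVneq `|z| 0; first by rewrite expr0n; exact: dotv_ge0.
  have [[i' i] /= zi] := mx_norm_neq0 z0.
  rewrite -[`|z|]/(mx_norm z) zi (ord1 i') real_normK ?num_real//.
  rewrite /dotv (bigD1 i)//= expr2 lerDl; apply: sumr_ge0 => j _.
  by rewrite -expr2 sqr_ge0.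
have fM w : B w -> - M <= f w <= M by move=> /BM; rewrite ler_norml.
have yx : `|y - x| < d.
  rewrite -(ltr_pXn2r (_ : (0 < 2)%N))// ?nnegrE ?(ltW d0)//.
  rewrite (le_lt_trans (dot_ge _))// -(ltr_pM2l kM.1) (le_lt_trans _ kM.2)//.
  have := ymin _ Bx; rewrite /h subrr dotv0r mulr0 addr0.
  by have /andP[? ?] := fM _ By; have /andP[? ?] := fM _ Bx; lra.
have yr2 : `|y - x| < r / 2 by rewrite (lt_le_trans yx)// ge_min lexx orbT.
have Oy : Omega y by exact: xrO.
exists y; split; last first.
  apply: xeU; rewrite -ball_normE/= distrC (lt_le_trans yx)// ge_min.
  by rewrite ler_pdivrMr// ler_peMr ?ler1n// ltW.
have qy : subdifferential Omega f y (- (2 * k) *: (y - x)).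
  move=> z Oz; rewrite dotvZl.
  set b := dotv (z - y) (z - y); set a := dotv (y - x) (z - y).
  have b0 : 0 <= b by rewrite (le_trans _ (dot_ge _)) ?sqr_ge0.
  (* Comparison of the minimum with the point at parameter t on the segment from y to z. After
     division by t the quadratic term leaves the error t k b, which tends to 0 with t. *)
  have small t : 0 < t -> t <= 1 -> t * `|z - y| <= r / 2 -> f y - 2 * k * a <= f z + t * (k * b).
    move=> t0 t1 tz.
    have yt : y + t *: (z - y) = t *: z + (1 - t) *: y.
      by rewrite scalerBr scalerBl scale1r addrC -addrA; congr (_ + _); rewrite addrC.
    have Byt : B (y + t *: (z - y)).
      rewrite /B/= addrAC (le_trans (ler_normD _ _))// normrZ (gtr0_norm t0).
      by rewrite (splitr r) lerD// ltW.
    have := ymin _ Byt; rewrite /h [in f (y + _)]yt.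
    have := cvf z y t Oz Oy; rewrite t1 ltW// => /(_ isT).
    have -> : dotv (y + t *: (z - y) - x) (y + t *: (z - y) - x) =
        dotv (y - x) (y - x) + 2 * t * a + t * (t * b).
      by rewrite (addrAC y) (dotv_sqrD (y - x)) !dotvZr dotvZl -/a -/b; ring.
    move=> h1 h2; rewrite -(ler_pM2l t0) mulrBr mulrDr; lra.
  rewrite mulNr; apply/ler_addgt0Pr => e' e'0.
  have [t [t0 t1 tz tb]] : exists t, [/\ 0 < t, t <= 1, t * `|z - y| <= r / 2 & t * (k * b) <= e'].
    exists (Num.min 1 (Num.min (r / 2 / (`|z - y| + 1)) (e' / (k * b + 1)))).
    have kb : 0 <= k * b by rewrite mulr_ge0// ltW// kM.1.
    have z1 : 0 < `|z - y| + 1 by rewrite ltr_wpDl.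
    have kb1 : 0 < k * b + 1 by rewrite ltr_wpDl.
    split.
    - by rewrite !lt_min ltr01 !divr_gt0.
    - by rewrite ge_min lexx.
    - apply: (@le_trans _ _ (r / 2 / (`|z - y| + 1) * `|z - y|)).
        by rewrite ler_wpM2r// !ge_min lexx orbT.
      by rewrite mulrAC ler_pdivrMr// ler_wpM2l ?lerDl// ltW.
    - apply: (@le_trans _ _ (e' / (k * b + 1) * (k * b))).
        by rewrite ler_wpM2r// !ge_min lexx !orbT.
      by rewrite mulrAC ler_pdivrMr// ler_wpM2l ?lerDl// ltW.
  by have := small t t0 t1 tz; lra.
exists (- (2 * k) *: (y - x)) => //.
rewrite /Q/= subr0; apply: norm_rV_le; first by rewrite divr_ge0 ?mulr_ge0 ?ltW.
move=> i; apply: (@slopes_coord_bound _ _ B f [set y] (r / 2) M) => //.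
- move=> w z -> zy; rewrite /B/= -(subrK y z) -addrA (le_trans (ler_normD _ _))//.
  by rewrite (splitr r) lerD// ltW.
- by exists y => // z Bz; apply: qy; exact: xrO.
Qed.

End convexity.

(** * Superadditivity of the Monge-Ampere measure *)

Section superadditivity.
Context {R : realType} {n : nat}.
Hypothesis n_gt0 : (0 < n)%N.
Implicit Types (x y q : 'rV[R]_n) (Z S K A B C : set 'rV[R]_n) (f g h : 'rV[R]_n -> R).
Local Notation mu := (@lebesgue_outer R n).

Lemma caratheodory_compact K : compact K -> mu.-caratheodory K.
Proof.
move=> cK; apply: caratheodory_closed => //.
by apply: compact_closed => //; exact: norm_hausdorff.
Qed.

Lemma compact_lebesgue_outer_fin K : compact K -> mu K \is a fin_num.
Proof.
move=> cK; rewrite ge0_fin_numE ?lebesgue_outer_ge0//.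
have [M M0 KM] := compact_bound cK (f := fun x => `|x|) (@norm_continuous _ _).
apply: (@bounded_lebesgue_outer_fin _ _ n_gt0 _ M) => x /KM + i; rewrite normr_id.
exact/le_trans/coord_le_norm.
Qed.

(* Two translates of A and B inside C overlap only in a hyperplane, when A is
   moved by the lowest point of B and B by the highest point of A. *)
Lemma lebesgue_outer_sumset A B C : compact A -> compact B -> A !=set0 -> B !=set0 ->
  (forall a b, A a -> B b -> C (a + b)) -> (mu A + mu B <= mu C)%E.
Proof.
move=> cA cB A0 B0 ABC.
pose i := Ordinal n_gt0.
have ci : continuous (fun x : 'rV[R]_n => x 0 i) by exact: coord_continuous.
have ci' : continuous (fun x : 'rV[R]_n => 0 - x 0 i).
  by apply: continuous_sub => //; exact: cst_continuous.
have [a Aa amax] := compact_argmin cA ci' A0.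
have [b Bb bmin] := compact_argmin cB ci B0.
rewrite -(lebesgue_outer_translate n_gt0 A b) -(lebesgue_outer_translate n_gt0 B a).
apply: (@le_trans _ _ (mu ([set x + b | x in A] `|` [set x + a | x in B]))).
  apply: lebesgue_outerU.
    exact/caratheodory_translate/caratheodory_compact.
  apply/eqP; rewrite eq_le lebesgue_outer_ge0 andbT.
  rewrite -(hyperplane_lebesgue_outer0 n_gt0 i (a 0 i + b 0 i)).
  apply: le_lebesgue_outer => _ [[x Ax <-] [y By /esym xy]] /=.
  have := congr1 (fun v : 'rV[R]_n => v 0 i) xy; rewrite !mxE.
  by have := amax _ Ax; have := bmin _ By; lra.
apply: le_lebesgue_outer => z [[x Ax <-]|[x Bx <-]]; first exact: ABC.
by rewrite addrC; exact: ABC.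
Qed.

Lemma uniform_continuity_compact K f (e : R) : compact K -> continuous f -> 0 < e ->
  exists2 d : R, 0 < d & forall x y, K x -> `|y - x| < d -> `|f y - f x| < e.
Proof.
move=> /compact_near_coveringP cK cf e0.
have : \forall d \near (0 : R)^'+,
    K `<=` (fun x => forall y, `|y - x| < d -> `|f y - f x| < e).
  apply: cK => x _.
  have e20 : 0 < e / 2 by rewrite divr_gt0.
  have /nbhs_ballP[d /= d0 xdf] : nbhs x (f @^-1` ball (f x) (e / 2)).
    by apply: cf; exact: nbhsx_ballx.
  have d20 : 0 < d / 2 by rewrite divr_gt0.
  exists (ball x (d / 2), [set r | r < d / 2]) => /=.
    by split; [exact: nbhsx_ballx|exact: nbhs_right_lt].
  move=> [x' r] /= []; rewrite -ball_normE/= => xx' re y yx'.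
  have h1 : ball (f x) (e / 2) (f x').
    by apply: xdf; apply: (le_ball _ _); last (by rewrite -ball_normE; exact: xx'); lra.
  have h2 : ball (f x) (e / 2) (f y).
    apply: xdf; rewrite -ball_normE/= (_ : x - y = (x - x') - (y - x')).
      by rewrite (splitr d) (le_lt_trans (ler_normB _ _))// ltrD// (lt_trans yx').
    by rewrite opprB addrA subrK.
  move: h1 h2; rewrite -!ball_normE/= distrC => h1 h2.
  rewrite (_ : f y - f x' = - ((f x' - f x) + (f x - f y))); last by ring.
  by rewrite normrN (splitr e) (le_lt_trans (ler_normD _ _))// ltrD.
move=> H; have [r [/= Hr r0]] := filter_ex (filterI H (nbhs_right_gt 0)).
by exists r => // x y Kx; exact: Hr.
Qed.

Lemma finite_net K (d : R) : compact K -> 0 < d ->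
  exists X : seq 'rV[R]_n, [/\ uniq X, (forall x, x \in X -> K x) &
    forall z, K z -> exists2 x, x \in X & `|x - z| < d].
Proof.
move=> + d0; rewrite compact_cover => /(_ _ K (fun x => ball x d)) [||D DK KD].
- by move=> x _; exact: ball_open.
- by move=> x Kx; exists x => //; exact: ballxx.
exists (finmap.enum_fset D); split.
- exact: finmap.fset_uniq.
- by move=> x /DK /set_mem.
- move=> z /KD[x xD]; rewrite -ball_normE => xz.
  by exists x.
Qed.

(** The inequality is tested at t y + (1 - t) x, with t so small that this point is within r of x;
    convexity then allows division by t. *)
Lemma subdifferential_local Omega Z h x q (r : R) : convex_on Omega h -> 0 < r ->
  Omega x -> (forall y, `|y - x| <= r -> Z y) ->
  subdifferential Z h x q -> subdifferential Omega h x q.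
Proof.
move=> ch r0 Ox xrZ qx y Oy.
pose t := Num.min 1 (r / (`|y - x| + 1)).
have yx1 : 0 < `|y - x| + 1 by rewrite ltr_wpDl.
have t0 : 0 < t by rewrite lt_min ltr01 divr_gt0.
have t1 : t <= 1 by rewrite ge_min lexx.
have e : t *: y + (1 - t) *: x - x = t *: (y - x).
  by rewrite scalerBr scalerBl scale1r addrC addrA (addrC (- x)) addrA subrK.
have := ch y x t Oy Ox; rewrite (ltW t0) t1 => /(_ isT).
have /qx : Z (t *: y + (1 - t) *: x).
  apply: xrZ; rewrite e normrZ gtr0_norm//.
  apply: (@le_trans _ _ (r / (`|y - x| + 1) * `|y - x|)).
    by rewrite ler_wpM2r// ge_min lexx orbT.
  by rewrite mulrAC ler_pdivrMr// ler_wpM2l ?lerDl// ltW.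
rewrite e dotvZr => h1 h2.
by rewrite -(ler_pM2l t0); lra.
Qed.

(* The slopes touching at distinct points overlap only in null sets, and at each point
   the slopes of f and g add up to slopes of f + g. *)
Lemma slopes_finite_superadditive (X P : seq 'rV[R]_n) f g (r : R) :
  continuous f -> continuous g -> uniq P -> {subset P <= X} ->
  (forall x, x \in P -> exists2 q, subdifferential [set` X] f x q & `|q| <= r) ->
  (forall x, x \in P -> exists2 q, subdifferential [set` X] g x q & `|q| <= r) ->
  (mu (slopes [set` X] f [set` P] `&` [set q | (`|q| <= r)%R]) +
   mu (slopes [set` X] g [set` P] `&` [set q | (`|q| <= r)%R]) <=
   mu (slopes [set` X] (f \+ g)%R [set` P] `&` [set q | (`|q| <= r + r)%R]))%E.
Proof.
move=> cf cg.
(* On a finite set the slopes may be unbounded; the balls restore the compactness that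
   [lebesgue_outer_sumset] requires. *)
have cB s : compact [set q : 'rV[R]_n | `|q| <= s].
  rewrite (_ : [set q | _] = [set q : 'rV[R]_n | `|q - 0| <= s]).
    exact: compact_norm_ball.
  by apply/seteqP; split => q /=; rewrite subr0.
have csl h s S : continuous h -> compact S ->
    compact (slopes [set` X] h S `&` [set q | `|q| <= s]).
  move=> ch cS; apply: (@subclosed_compact _ _ _ _ (cB s)) => //.
  apply: closedI; first exact: closed_slopes.
  by apply: compact_closed; [exact: norm_hausdorff|exact: cB].
have cfg : continuous (f \+ g)%R by exact: continuous_add.
have cX : compact [set` X] by apply: finite_compact; exact: finite_seq.
elim: P => [|x P IH] /=.
  move=> _ _ _ _.
  have -> : [set` (nil : seq 'rV[R]_n)] = set0 by apply/seteqP; split => y.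
  by rewrite /slopes !bigcup_set0 !set0I !lebesgue_outer0 adde0.
move=> /andP[xP uP] PX fP gP.
have consE : [set` x :: P] = [set x] `|` [set` P].
  apply/seteqP; split => y /=; first by rewrite inE => /orP[/eqP ->|yP]; [left|right].
  by rewrite inE => -[->|->]; rewrite ?eqxx ?orbT.
rewrite consE !slopesU !setIUl.
have x0 h : slopes [set` X] h [set x] = subdifferential [set` X] h x by exact: bigcup_set1.
apply: (@le_trans _ _ (mu (slopes [set` X] (f \+ g)%R [set x] `&` [set q | (`|q| <= r + r)%R]) +
   mu (slopes [set` X] (f \+ g)%R [set` P] `&` [set q | (`|q| <= r + r)%R]))%E); last first.
  apply: lebesgue_outerU.
    by apply/caratheodory_compact/csl => //; exact: compact_set1.
  apply/eqP; rewrite eq_le lebesgue_outer_ge0 andbT.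
  rewrite -(@slopes_disjoint_null _ _ n_gt0 [set` X] (f \+ g)%R [set x] [set` P] cfg cX).
  - by apply: le_lebesgue_outer => q [[? _] [? _]].
  - by move=> _ ->; apply: PX; rewrite inE eqxx.
  - by move=> y Py; apply: PX; rewrite inE; apply/orP; right.
  - by apply/seteqP; split => // y [->]; rewrite /= (negbTE xP).
apply: (@le_trans _ _ ((mu (slopes [set` X] f [set x] `&` [set q | (`|q| <= r)%R]) +
    mu (slopes [set` X] g [set x] `&` [set q | (`|q| <= r)%R])) +
   (mu (slopes [set` X] f [set` P] `&` [set q | (`|q| <= r)%R]) +
    mu (slopes [set` X] g [set` P] `&` [set q | (`|q| <= r)%R])))%E).
  by rewrite addeACA leeD// lebesgue_outer_setU_le.
apply: leeD; last first.
  apply: IH => //.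
  - by move=> y Py; apply: PX; rewrite inE Py orbT.
  - by move=> y Py; apply: fP; rewrite inE Py orbT.
  - by move=> y Py; apply: gP; rewrite inE Py orbT.
have [qf qfx qfr] := fP x (mem_head _ _).
have [qg qgx qgr] := gP x (mem_head _ _).
rewrite !x0; apply: lebesgue_outer_sumset.
- by rewrite -x0; apply: csl => //; exact: compact_set1.
- by rewrite -x0; apply: csl => //; exact: compact_set1.
- by exists qf.
- by exists qg.
move=> a b [ax /= ar] [bx /= br]; split => /=; last first.
  by rewrite (le_trans (ler_normD _ _))// lerD.
by move=> y Xy; have := ax y Xy; have := bx y Xy; rewrite dotvDl /=; lra.
Qed.

End superadditivity.

(** * Passage from finite nets to compact sets *)

Section superadditivity_limit.
Context {R : realType} {n : nat}.
Hypothesis n_gt0 : (0 < n)%N.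
Implicit Types (x y q : 'rV[R]_n) (Z S K : set 'rV[R]_n) (f g h phi : 'rV[R]_n -> R).
Local Notation mu := (@lebesgue_outer R n).

Lemma closed_subdifferential_slack (T : topologicalType) (X Q : T -> 'rV[R]_n)
    (e : T -> R) (D : 'rV[R]_n -> set T) Z phi :
  continuous phi -> continuous X -> continuous Q -> continuous e ->
  (forall z, open (D z)) ->
  closed [set t | forall z, Z z -> D z t -> phi (X t) + dotv (Q t) (z - X t) <= phi z + e t].
Proof.
move=> cphi cX cQ ce oD.
rewrite (_ : [set t | _] = \bigcap_(z in Z)
    (~` D z `|` [set t | phi (X t) + dotv (Q t) (z - X t) <= phi z + e t])).
  apply: closed_bigI => z _; apply: closedU; first exact: open_closedC.
  apply: closed_le_continuous.
    apply: continuous_add; first exact: continuous_compose.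
    by apply: continuous_dotv => //; apply: continuous_sub => //; exact: cst_continuous.
  by apply: continuous_add => //; exact: cst_continuous.
apply/seteqP; split => t tZ z Zz; last by move=> Dz; case: (tZ z Zz).
by have [Dz|nDz] := pselect (D z t); [right; exact: tZ|left].
Qed.

(** An inner approximation of the slopes touching in K. The gap e away from the s-neighbourhood of K
    is robust: when the plane is moved to touch [phi] on a fine net, it still touches near K. *)
Definition gap_slopes Z phi K (s e : R) : set 'rV[R]_n := [set q | exists2 x, K x &
  subdifferential Z phi x q /\
  forall y, Z y -> (forall k, K k -> s <= `|y - k|) ->
    phi x + dotv q (y - x) + e <= phi y].

(** Slopes touching both in K and in the far set [F] are null. For any other slope, compactness of
    [F] makes the gap positive, and the gaps 1 / (k + 1) exhaust these slopes. *)
Lemma gap_slopes_measure_gt Z phi K (s : R) (c : \bar R) : continuous phi ->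
  compact Z -> compact K -> K `<=` Z -> 0 < s -> (c < mu (slopes Z phi K))%E ->
  exists2 e : R, 0 < e & (c < mu (gap_slopes Z phi K s e))%E.
Proof.
move=> cphi cZ cK KZ s0.
pose F := Z `&` [set y | forall k, K k -> s <= `|y - k|].
have cF : compact F.
  apply: (@subclosed_compact _ _ Z) => //; last exact: subIsetl.
  apply: closedI; first by apply: compact_closed; [exact: norm_hausdorff|].
  rewrite (_ : [set y | _] = \bigcap_(k in K) [set y | s <= `|y - k|]).
    apply: closed_bigI => k _; apply: closed_le_continuous; first exact: cst_continuous.
    by apply: continuous_norm_fun; exact: continuous_subr_cst.
  by apply/seteqP; split => y yK k Kk; exact: yK.
have mF : mu.-caratheodory (slopes Z phi F).
  by apply: caratheodory_closed => //; exact: closed_slopes.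
have FK : slopes Z phi K `\` slopes Z phi F `<=` \bigcup_k gap_slopes Z phi K s k.+1%:R^-1.
  move=> q [[x Kx qx] qF].
  have [F0|/set0P F0] := eqVneq F set0.
    exists 0%N => //; exists x => //; split => // y Zy yK.
    by suff : F y by rewrite F0.
  have cphiq : continuous (fun y => phi y - dotv q y).
    apply: continuous_sub => //; apply: continuous_dotv; first exact: cst_continuous.
    by move=> y; exact: cvg_id.
  have [y [Zy yK] ymin] := compact_argmin cF cphiq F0.
  have gap : 0 < phi y - (phi x + dotv q (y - x)).
    rewrite subr_gt0 lt_neqAle qx// andbT; apply/negP => /eqP eq.
    apply: qF; exists y; first by split.
    move=> z Zz; have := qx z Zz; rewrite -eq !dotvBr; lra.
  have [k _ /(_ k (leqnn k))/= kg] := near_infty_natSinv_lt (PosNum gap).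
  exists k => //; exists x => //; split => // z Zz zK.
  have := ymin z (conj Zz zK); move: kg; set d := k.+1%:R^-1.
  by rewrite !dotvBr; lra.
move=> cmu.
have [|||k ck] := @lebesgue_outer_bigcup_gt R n (fun k => gap_slopes Z phi K s k.+1%:R^-1) c.
- move=> k; apply: caratheodory_closed => //.
  have -> : gap_slopes Z phi K s k.+1%:R^-1 = [set q | exists2 x, K x &
      ([set p : 'rV[R]_n * 'rV[R]_n | subdifferential Z phi p.2 p.1] `&`
       [set p : 'rV[R]_n * 'rV[R]_n | forall y, F y -> setT p ->
          phi p.2 + dotv p.1 (y - p.2) <= phi y + (- k.+1%:R^-1)]) (q, x)].
    apply/seteqP; split => q [x Kx [qx qF]]; exists x => //; split => // y.
      by move=> [Zy yF] _ /=; have := qF y Zy yF; set d := k.+1%:R^-1; lra.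
    move=> Zy yF; have /= := qF y (conj Zy yF) Logic.I; set d := k.+1%:R^-1; lra.
  apply: closed_exists_compact => //; apply: closedI.
    apply: (closed_subdifferential (X := snd) (Q := fst)) => //.
      exact: continuous_snd.
    exact: continuous_fst.
  apply: (closed_subdifferential_slack (X := snd) (Q := fst)
    (e := fun=> - k.+1%:R^-1) (D := fun=> setT)) => //.
  + exact: continuous_snd.
  + exact: continuous_fst.
  + exact: cst_continuous.
  + by move=> _; exact: openT.
- move=> j k jk q [x Kx [qx qF]]; exists x => //; split => // y Zy yK.
  apply: le_trans (qF y Zy yK); rewrite lerD2l lef_pV2 ?posrE//.
  by rewrite ler_nat ltnS.
- apply: (lt_le_trans cmu).
  apply: (le_trans _ (le_lebesgue_outer FK)).
  rewrite (mF (slopes Z phi K)) (@slopes_disjoint_null _ _ n_gt0 Z phi K F) ?add0e//.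
  + by move=> y [].
  + by apply/seteqP; split => // y [Ky [_ /(_ y Ky)]]; rewrite subrr normr0 leNgt s0.
by exists k.+1%:R^-1.
Qed.

End superadditivity_limit.

Section superadditivity_convex.
Context {R : realType} {n : nat}.
Hypothesis n_gt0 : (0 < n)%N.
Implicit Types (x y q : 'rV[R]_n) (Z S K Omega : set 'rV[R]_n) (f g h phi : 'rV[R]_n -> R).
Local Notation mu := (@lebesgue_outer R n).

(** An outer approximation of the slopes touching in K: the plane may exceed h by e, and its base
    point [p.2] may lie at distance e from the point [p.1] of K. It absorbs the slopes of h on a
    fine net. *)
Definition slack_slopes Z h K (b e : R) : set 'rV[R]_n := [set q | `|q| <= b /\
  exists2 p : 'rV[R]_n * 'rV[R]_n, K p.1 /\ Z p.2 & `|p.2 - p.1| <= e /\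
    forall z, Z z -> h p.2 + dotv q (z - p.2) <= h z + e].

(** Closedness holds jointly in the slope and the error, so that the error can tend to 0. *)
Lemma closed_slack_slopes Z h K b : compact K -> compact Z -> continuous h ->
  closed [set t : 'rV[R]_n * R | slack_slopes Z h K b t.2 t.1].
Proof.
move=> cK cZ ch.
have cKZ : compact [set p : 'rV[R]_n * 'rV[R]_n | K p.1 /\ Z p.2] by exact: compact_setX.
pose T := (('rV[R]_n * R) * ('rV[R]_n * 'rV[R]_n))%type.
have cq : continuous (fun t : T => t.1.1).
  by apply: continuous_compose; exact: continuous_fst.
have ce : continuous (fun t : T => t.1.2).
  by apply: continuous_compose; [exact: continuous_fst|exact: continuous_snd].
have ck : continuous (fun t : T => t.2.1).
  by apply: continuous_compose; [exact: continuous_snd|exact: continuous_fst].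
have cx : continuous (fun t : T => t.2.2).
  by apply: continuous_compose; exact: continuous_snd.
rewrite (_ : [set t | _] = [set t : 'rV[R]_n * R | `|t.1| <= b] `&`
  [set t | exists2 p, [set p : 'rV[R]_n * 'rV[R]_n | K p.1 /\ Z p.2] p &
    ([set t : T | `|t.2.2 - t.2.1| <= t.1.2] `&`
     [set t : T | forall z, Z z -> setT t -> h t.2.2 + dotv t.1.1 (z - t.2.2) <= h z + t.1.2]) (t, p)]).
  apply: closedI.
    apply: closed_le_continuous; last exact: cst_continuous.
    by apply: continuous_norm_fun; exact: continuous_fst.
  apply: closed_exists_compact => //; apply: closedI.
    apply: closed_le_continuous => //; apply: continuous_norm_fun.
    exact: (continuous_sub cx ck).
  exact: (@closed_subdifferential_slack _ _ T (fun t => t.2.2) (fun t => t.1.1)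
    (fun t => t.1.2) (fun=> setT) Z h ch cx cq ce (fun=> openT)).
apply/seteqP; split => t [tb [p pKZ [pe pZ]]]; split => //; exists p => //; split => //.
  by move=> z Zz _; exact: pZ.
by move=> z Zz; exact: pZ.
Qed.

(** Continuity from above: the sets decrease with e, and by joint closedness a slope in all of them
    has error 0, that is, touches in K. *)
Lemma slack_slopes_measure_lt Z h K b (c : \bar R) : compact K -> compact Z ->
  continuous h -> (mu (slopes Z h K) < c)%E ->
  exists2 e : R, 0 < e & (mu (slack_slopes Z h K b e) < c)%E.
Proof.
move=> cK cZ ch hc.
have clE := closed_slack_slopes (b := b) cK cZ ch.
pose E j := slack_slopes Z h K b j.+1%:R^-1.
have cE j : compact (E j).
  apply: (@subclosed_compact _ _ [set q | `|q - 0| <= b]).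
  - exact: (@closed_slice _ _ _ (j.+1%:R^-1 : R) clE).
  - exact: compact_norm_ball.
  - by move=> q [qb _] /=; rewrite subr0.
have [||||k Ek] := @lebesgue_outer_bigcap_lt R n E c.
- by move=> k; exact: caratheodory_compact.
- move=> j k jk q [qb [p pKZ [pe pZ]]].
  have kj : (k.+1%:R^-1 <= j.+1%:R^-1 :> R).
    by rewrite lef_pV2 ?posrE// ler_nat ltnS.
  split => //; exists p => //; split; first exact: le_trans kj.
  by move=> z /pZ /le_trans; apply; rewrite lerD2l.
- have := compact_lebesgue_outer_fin n_gt0 (cE 0%N).
  by rewrite ge0_fin_numE ?lebesgue_outer_ge0.
- apply: le_lt_trans hc; apply: le_lebesgue_outer => q Eq.
  suff [qb [p [Kp Zp] [+ pZ]]] : slack_slopes Z h K b 0 q.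
    rewrite normr_le0 subr_eq0 => /eqP pp; exists p.1 => // z /pZ.
    by rewrite addr0 pp.
  pose C := [set t : 'rV[R]_n * R | slack_slopes Z h K b t.2 t.1].
  suff : C (q, 0) by [].
  rewrite (closure_id C).1// => U [[A B] /= [qA B0] ABU].
  have [e /= e0 eB] := B0.
  have [k _ /(_ k (leqnn k))/= ke] := near_infty_natSinv_lt (PosNum e0).
  exists (q, k.+1%:R^-1); split; first exact: Eq.
  apply: ABU; split => /=; first exact: nbhs_singleton.
  by apply: eB => /=; rewrite sub0r normrN gtr0_norm.
by exists k.+1%:R^-1.
Qed.

(** Let y be the point of the net where the shifted plane touches. The net also has a point x' near
    the original touching point x, where [phi] and the plane each change by at most e / 2. If y were
    s-far from K, the gap e at y would exceed this loss. *)
Lemma gap_slopes_sub_finite (X : seq 'rV[R]_n) Z phi K (s e b d : R) : continuous phi ->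
  K `<=` Z -> (forall x, x \in X -> Z x) ->
  (forall z, Z z -> exists2 x, x \in X & `|x - z| < d) ->
  (forall x y, Z x -> `|y - x| < d -> `|phi y - phi x| < e / 2) ->
  n%:R * (b * d) <= e / 2 -> 0 <= b ->
  gap_slopes Z phi K s e `&` [set q | `|q| <= b] `<=`
  slopes [set` X] phi [set x | x \in X /\ exists2 k, K k & `|x - k| < s].
Proof.
move=> cphi KZ XZ net unif bd b0 q [[x Kx [qx gap]] /= qb].
have Zx := KZ _ Kx.
have [x' Xx' x'x] := net _ Zx.
have cX : compact [set` X] by apply: finite_compact; exact: finite_seq.
have cphiq : continuous (fun y => phi y - dotv q y).
  apply: continuous_sub => //; apply: continuous_dotv; first exact: cst_continuous.
  by move=> y; exact: cvg_id.
have [y /= Xy ymin] := compact_argmin cX cphiq (ex_intro _ x' Xx').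
exists y; last by move=> z Xz; have := ymin z Xz; rewrite dotvBr; lra.
split => //; apply: contrapT => /forall2NP yK.
have := gap y (XZ _ Xy); have /(_ x' Xx') := ymin.
have := unif x x' Zx x'x; rewrite ltr_norml => /andP[_ h1].
have h2 : `|dotv q (x' - x)| <= e / 2.
  apply: (le_trans (dotv_norm_le _ _)); apply: le_trans bd.
  by rewrite ler_wpM2l// ler_pM// ltW.
move: h2; rewrite ler_norml !dotvBr => /andP[h2 _] h3 h4.
have /h4 : forall k, K k -> s <= `|y - k|.
  by move=> k Kk; rewrite leNgt; apply/negP => yk; case: (yK k).
lra.
Qed.

(** A plane below h on the net exceeds h elsewhere by at most e: half for the variation of h up to
    the nearest net point, half for that of the plane. *)
Lemma slopes_finite_sub_slack (X : seq 'rV[R]_n) Z h K (b e d : R) :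
  (forall x, x \in X -> Z x) ->
  (forall z, Z z -> exists2 x, x \in X & `|x - z| < d) ->
  (forall x y, Z x -> `|y - x| < d -> `|h y - h x| < e / 2) ->
  n%:R * (b * d) <= e / 2 -> 0 <= b ->
  slopes [set` X] h [set x | x \in X /\ exists2 k, K k & `|x - k| < e] `&`
    [set q | `|q| <= b] `<=` slack_slopes Z h K b e.
Proof.
move=> XZ net unif bd b0 q [[x [Xx [k Kk xk]] qx] /= qb]; split => //.
exists (k, x); split => //=; [exact: XZ|exact: ltW|].
move=> z Zz; have [x' Xx' x'z] := net _ Zz.
have := qx x' Xx'.
have := unif z x' Zz x'z; rewrite ltr_norml => /andP[_ h1].
have h2 : `|dotv q (x' - z)| <= e / 2.
  apply: (le_trans (dotv_norm_le _ _)); apply: le_trans bd.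
  by rewrite ler_wpM2l// ler_pM// ltW.
by move: h2; rewrite ler_norml !dotvBr => /andP[h2 _]; lra.
Qed.

(* The functions are restricted to finer and finer finite nets. *)
Theorem slopes_superadditive Omega f g K : open Omega -> convex_set Omega ->
  continuous f -> continuous g -> convex_on Omega f -> convex_on Omega g ->
  compact K -> K `<=` Omega ->
  (mu (slopes Omega f K) + mu (slopes Omega g K) <= mu (slopes Omega (f \+ g)%R K))%E.
Proof.
move=> oO cO cf cg vf vg cK KO.
have [r r0 rO] := compact_thicken_subset cK oO KO.
pose Z : set 'rV[R]_n := [set y | exists2 x, K x & `|y - x| <= r].
have cZ : compact Z by exact: compact_thicken.
have ZO : Z `<=` Omega by move=> y [x Kx]; exact: rO.
have KZ : K `<=` Z by move=> x Kx; exists x; rewrite // subrr normr0 ltW.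
pose h := (f \+ g)%R.
have ch : continuous h by exact: continuous_add.
have [M M0 ZM] : exists2 M : R, 0 < M & forall x, Z x -> `|f x| <= M /\ `|g x| <= M.
  have [M1 M10 ZM1] := compact_bound cZ cf.
  have [M2 M20 ZM2] := compact_bound cZ cg.
  exists (M1 + M2); first exact: addr_gt0.
  by move=> x Zx; have := ZM1 x Zx; have := ZM2 x Zx; split; lra.
pose b : R := 2 * M / (r / 2).
have r20 : 0 < r / 2 by rewrite divr_gt0.
have b0 : 0 <= b by rewrite divr_ge0 ?mulr_ge0 ?ltW.
have half_bound phi x q : (forall y, Z y -> `|phi y| <= M) ->
    (exists2 k, K k & `|x - k| <= r / 2) -> subdifferential Omega phi x q -> `|q| <= b.
  move=> phiM [k Kk xk] qx; apply: norm_rV_le => // i.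
  apply: (@slopes_coord_bound _ _ Z phi [set x] (r / 2) M) => //.
    move=> _ y -> yx; exists k => //.
    rewrite (_ : y - k = (y - x) + (x - k)); last by rewrite addrA subrK.
    by rewrite (splitr r) (le_trans (ler_normD _ _))// lerD.
  by exists x => // y /ZO Oy; exact: qx.
have fin phi : continuous phi -> (forall y, Z y -> `|phi y| <= M) ->
    mu (slopes Omega phi K) \is a fin_num.
  move=> cphi phiM; apply: compact_lebesgue_outer_fin => //.
  apply: (@subclosed_compact _ _ [set q | `|q - 0| <= b]).
  - exact: closed_slopes.
  - exact: compact_norm_ball.
  move=> q [x Kx qx]; rewrite /= subr0; apply: half_bound qx => //.
  by exists x => //; rewrite subrr normr0 ltW.
have fM y : Z y -> `|f y| <= M by move=> /ZM[].
have gM y : Z y -> `|g y| <= M by move=> /ZM[].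
have hsub : slopes Z h K `<=` slopes Omega h K.
  move=> q [x Kx qx]; exists x => //.
  apply: (subdifferential_local (convex_onD vf vg) r0) qx; first exact: KO.
  by move=> y yx; exists x.
rewrite leNgt; apply/negP => lt.
have hfin : mu (slopes Omega h K) \is a fin_num.
  by rewrite ge0_fin_numE ?lebesgue_outer_ge0// (lt_le_trans lt)// leey.
move: lt; rewrite -/h -(fineK hfin) -(fineK (fin f cf fM)) -(fineK (fin g cg gM)).
set H := fine _; set F := fine _; set G := fine _.
rewrite -EFinD lte_fin => HFG.
(* A third of the supposed defect: (F - eta) + (G - eta) = H + eta, so approximating the three
   measures up to eta already gives a contradiction. *)
pose eta : R := (F + G - H) / 3.
have eta0 : 0 < eta by rewrite divr_gt0 ?subr_gt0.
have muH : (mu (slopes Z h K) < (H + eta)%:E)%E.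
  apply: (le_lt_trans (le_lebesgue_outer hsub)).
  by rewrite -(fineK hfin) lte_fin ltrDl.
(* The order of choices matters: the slack e1 for the sum, then the neighbourhood size s <= e1, then
   the gaps e2 and e3, which depend on s, and last the mesh d. The truncation is b + b because
   slopes of f and g bounded by b are added. *)
have [e1 e10 E1] := slack_slopes_measure_lt (b + b) cK cZ ch muH.
pose s : R := Num.min e1 (r / 2).
have s0 : 0 < s by rewrite lt_min e10.
have slopesZ phi : slopes Omega phi K `<=` slopes Z phi K.
  by move=> q [x Kx qx]; exists x => // y /ZO; exact: qx.
have muF : ((F - eta)%:E < mu (slopes Z f K))%E.
  apply: (lt_le_trans _ (le_lebesgue_outer (slopesZ f))).
  by rewrite -(fineK (fin f cf fM)) lte_fin gtrBl.
have muG : ((G - eta)%:E < mu (slopes Z g K))%E.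
  apply: (lt_le_trans _ (le_lebesgue_outer (slopesZ g))).
  by rewrite -(fineK (fin g cg gM)) lte_fin gtrBl.
have [e2 e20 E2] := gap_slopes_measure_gt n_gt0 cf cZ cK KZ s0 muF.
have [e3 e30 E3] := gap_slopes_measure_gt n_gt0 cg cZ cK KZ s0 muG.
have [w w0 [we1 we2 we3]] : exists2 w : R, 0 < w & [/\ w <= s / 2, w <= e2 / 2 & w <= e3 / 2].
  exists (Num.min (s / 2) (Num.min (e2 / 2) (e3 / 2))).
    by rewrite !lt_min !divr_gt0.
  by split; rewrite !ge_min ?lexx ?orbT.
have [d [d0 df dg dh db]] : exists d : R, [/\ 0 < d,
    (forall x y, Z x -> `|y - x| < d -> `|f y - f x| < w),
    (forall x y, Z x -> `|y - x| < d -> `|g y - g x| < w),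
    (forall x y, Z x -> `|y - x| < d -> `|h y - h x| < w) &
    n%:R * ((b + b) * d) <= w].
  have [d1 d10 df] := uniform_continuity_compact cZ cf w0.
  have [d2 d20 dg] := uniform_continuity_compact cZ cg w0.
  have [d3 d30 dh] := uniform_continuity_compact cZ ch w0.
  have nb : 0 < n%:R * (b + b) + 1 by rewrite ltr_wpDl// mulr_ge0// addr_ge0.
  exists (Num.min (Num.min d1 d2) (Num.min d3 (w / (n%:R * (b + b) + 1)))); split.
  - by rewrite !lt_min d10 d20 d30 divr_gt0.
  - by move=> x y Zx; rewrite !lt_min => /andP[/andP[yx _] _]; exact: df.
  - by move=> x y Zx; rewrite !lt_min => /andP[/andP[_ yx] _]; exact: dg.
  - by move=> x y Zx; rewrite !lt_min => /andP[_ /andP[yx _]]; exact: dh.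
  - rewrite mulrA; apply: (@le_trans _ _ (n%:R * (b + b) * (w / (n%:R * (b + b) + 1)))).
      by rewrite ler_wpM2l ?mulr_ge0 ?addr_ge0// !ge_min lexx !orbT.
    by rewrite mulrCA ler_piMr ?ltW// ltr_pdivrMr// mul1r ltrDl.
have db' : n%:R * (b * d) <= w.
  by apply: le_trans db; rewrite ler_wpM2l// ler_wpM2r ?lerDl// ltW.
have [X [uX XZ net]] := finite_net cZ d0.
pose P := [seq x <- X | `[< exists2 k, K k & `|x - k| < s >]].
pose Xs : set 'rV[R]_n := [set x | x \in X /\ exists2 k, K k & `|x - k| < s].
have PE : [set` P] = Xs.
  apply/seteqP; split => x /=; rewrite mem_filter.
    by move=> /andP[/asboolP ? ?].
  by move=> [-> ?]; rewrite andbT; exact/asboolP.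
have sub phi : continuous phi -> convex_on Omega phi -> (forall y, Z y -> `|phi y| <= M) ->
    forall x, x \in P -> exists2 q, subdifferential [set` X] phi x q & `|q| <= b.
  move=> cphi vphi phiM x xP.
  have : [set` P] x by [].
  rewrite PE => -[xX [k Kk xk]].
  have [q qx] := subgradient_exists oO cO cphi vphi (ZO _ (XZ _ xX)).
  exists q; first by move=> y /XZ/ZO; exact: qx.
  apply: half_bound qx => //; exists k => //.
  by rewrite ltW// (lt_le_trans xk)// ge_min lexx orbT.
have := slopes_finite_superadditive n_gt0 cf cg (filter_uniq _ uX) _ (sub f cf vf fM) (sub g cg vg gM).
move=> /(_ (mem_subseq (filter_subseq _ _))); rewrite -/P PE.
have EH : (mu (slopes [set` X] h Xs `&`
    [set q | (`|q| <= b + b)%R]) < (H + eta)%:E)%E.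
  apply: le_lt_trans E1; apply: le_lebesgue_outer.
  have := @slopes_finite_sub_slack X Z h K (b + b) s d XZ net.
  move=> /(_ _ _ (addr_ge0 b0 b0)) sl.
  apply: subset_trans (sl _ _) _.
  - by move=> x y Zx /(dh x y Zx)/lt_le_trans; apply.
  - exact: (le_trans db we1).
  move=> q [qb [p pKZ [pe pZ]]]; split => //; exists p => //.
  have se1 : s <= e1 by rewrite ge_min lexx.
  split; first exact: le_trans se1.
  by move=> z /pZ/le_trans; apply; rewrite lerD2l.
have EL phi e : 0 < e -> w <= e / 2 -> continuous phi -> (forall y, Z y -> `|phi y| <= M) ->
    (forall x y, Z x -> `|y - x| < d -> `|phi y - phi x| < w) ->
    (mu (gap_slopes Z phi K s e) <=
     mu (slopes [set` X] phi Xs `&`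
         [set q | (`|q| <= b)%R]))%E.
  move=> e0 we cphi phiM dphi; apply: le_lebesgue_outer => q gq.
  have qb : `|q| <= b.
    have [x Kx [qx _]] := gq; apply: norm_rV_le => // i.
    apply: (@slopes_coord_bound _ _ Z phi [set x] (r / 2) M) => //; last by exists x.
    move=> _ y -> yx; exists x => //; apply: (le_trans yx).
    by rewrite ler_pdivrMr// ler_peMr ?ler1n// ltW.
  split => //; apply: (gap_slopes_sub_finite cphi KZ XZ net _ _ b0) => //; last by split; [exact: gq|].
  - by move=> x y Zx /(dphi x y Zx)/lt_le_trans; apply.
  - exact: (le_trans db' we).
have EF := lt_le_trans E2 (EL f e2 e20 we2 cf fM df).
have EG := lt_le_trans E3 (EL g e3 e30 we3 cg gM dg).
move=> /le_lt_trans /(_ EH); apply/negP; rewrite -leNgt.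
apply: le_trans (leeD (ltW EF) (ltW EG)).
by rewrite -EFinD lee_fin /eta; lra.
Qed.

(* The non-convex phi can be replaced by the supremum of its touching planes at K. *)
Theorem slopes_superadditive_touching Omega f phi K (b : R) : open Omega ->
  convex_set Omega -> continuous f -> continuous phi -> convex_on Omega f ->
  compact K -> K `<=` Omega ->
  (forall x, K x -> exists2 q, subdifferential Omega phi x q & `|q| <= b) ->
  (forall q, slopes Omega phi K q -> `|q| <= b) ->
  (mu (slopes Omega f K) + mu (slopes Omega phi K) <= mu (slopes Omega (f \+ phi)%R K))%E.
Proof.
move=> oO cO cf cphi vf cK KO Kb qb.
have [K0|/set0P[k0 Kk0]] := eqVneq K set0.
  by rewrite K0 /slopes !bigcup_set0 !lebesgue_outer0 adde0.
have [M M0 KM] := compact_bound cK cphi.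
pose planes x := [set phi p.1 + dotv p.2 (x - p.1) | p in
  [set p : 'rV[R]_n * 'rV[R]_n | K p.1 /\ subdifferential Omega phi p.1 p.2]].
pose w x := sup (planes x).
have [D D0 KD] : exists2 D : R, 0 <= D & forall k, K k -> `|k| <= D.
  have [D D0 KD] := compact_bound cK (f := fun x => `|x|) (@norm_continuous _ _).
  by exists D; [exact: ltW|move=> k /KD; rewrite normr_id].
have hs x : has_sup (planes x).
  split.
    have [q qk _] := Kb _ Kk0.
    by exists (phi k0 + dotv q (x - k0)), (k0, q).
  exists (M + n%:R * (b * (`|x| + D))) => _ [[k q] /= [Kk qk] <-].
  apply: lerD; first by apply: (le_trans (ler_norm _)); exact: KM.
  apply: (le_trans (ler_norm _)); apply: (le_trans (dotv_norm_le _ _)).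
  rewrite ler_wpM2l// ler_pM//; first by apply: qb; exists k.
  by rewrite (le_trans (ler_normB _ _))// lerD2l KD.
have wge x k q : K k -> subdifferential Omega phi k q -> phi k + dotv q (x - k) <= w x.
  by move=> Kk qk; apply: (ub_le_sup (hs x).2); exists (k, q).
have wle x c : (forall k q, K k -> subdifferential Omega phi k q ->
    phi k + dotv q (x - k) <= c) -> w x <= c.
  move=> H; apply: (ge_sup (hs x).1) => _ [[k q] /= [Kk qk] <-]; exact: H.
have wphi x : Omega x -> w x <= phi x.
  by move=> Ox; apply: wle => k q _; apply.
have wK k : K k -> w k = phi k.
  move=> Kk; apply/eqP; rewrite eq_le wphi//=; last exact: KO.
  have [q qk _] := Kb _ Kk.
  by have := wge k k q Kk qk; rewrite subrr dotv0r addr0.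
have wlip x y : w x <= w y + n%:R * (b * `|x - y|).
  apply: wle => k q Kk qk; have := wge y k q Kk qk.
  have : dotv q (x - y) <= n%:R * (b * `|x - y|).
    apply: (le_trans (ler_norm _)); apply: (le_trans (dotv_norm_le _ _)).
    by rewrite ler_wpM2l// ler_wpM2r//; apply: qb; exists k.
  by rewrite !dotvBr; lra.
have b0 : 0 <= b.
  by have [q _] := Kb _ Kk0; apply: le_trans.
have cw : continuous w.
  apply: (@lipschitz_continuous _ _ w (n%:R * b)); first exact: mulr_ge0.
  by move=> x y; rewrite -mulrA.
have vw : convex_on Omega w.
  move=> x y t Ox Oy /andP[t0 t1]; apply: wle => k q Kk qk.
  have h1 := wge x k q Kk qk; have h2 := wge y k q Kk qk.
  have -> : phi k + dotv q (t *: x + (1 - t) *: y - k) =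
      t * (phi k + dotv q (x - k)) + (1 - t) * (phi k + dotv q (y - k)).
    by rewrite !dotvBr dotvDr !dotvZr; ring.
  by rewrite lerD// ler_wpM2l// subr_ge0.
have := slopes_superadditive oO cO cf cw vf vw cK KO.
(* The envelope w agrees with [phi] on K and lies below it on Omega. Passing from [phi] to w
   therefore keeps the slopes touching in K, and passing back from f + w to f + phi keeps them
   too. *)
have sub1 : slopes Omega phi K `<=` slopes Omega w K.
  by move=> q [k Kk qk]; exists k => // y Oy; rewrite wK//; exact: wge.
have sub2 : slopes Omega (f \+ w)%R K `<=` slopes Omega (f \+ phi)%R K.
  move=> q [k Kk qk]; exists k => // y Oy /=.
  apply: le_trans (le_trans _ (qk y Oy)) _; first by rewrite /= wK.
  by rewrite lerD2l wphi.
move=> super; apply: le_trans (le_trans super (le_lebesgue_outer sub2)).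
by rewrite leeD2l// le_lebesgue_outer.
Qed.

End superadditivity_convex.

(** * Distance to the boundary and volume of admissible slopes *)

Section euclidean_geometry.
Context {R : realType} {n : nat}.
Implicit Types (x y z : 'rV[R]_n) (Omega A : set 'rV[R]_n).

Lemma enorm_ge0 x : 0 <= enorm x.
Proof. exact: sqrtr_ge0. Qed.

Lemma enorm_sqr x : enorm x ^+ 2 = dotv x x.
Proof. by rewrite sqr_sqrtr// dotv_ge0. Qed.

Lemma enormN x : enorm (- x) = enorm x.
Proof. by rewrite /enorm dotvNl dotvNr opprK. Qed.

Lemma enormB x y : enorm (x - y) = enorm (y - x).
Proof. by rewrite -enormN opprB. Qed.

Lemma enormZ (a : R) x : enorm (a *: x) = `|a| * enorm x.
Proof.
by rewrite /enorm dotvZl dotvZr mulrA -expr2 sqrtrM ?sqr_ge0// sqrtr_sqr.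
Qed.

Lemma coord_le_enorm x i : `|x 0 i| <= enorm x.
Proof.
rewrite -(@ler_pXn2r _ 2)// ?nnegrE ?enorm_ge0// enorm_sqr real_normK ?num_real//.
rewrite /dotv (bigD1 i)//= expr2 lerDl; apply: sumr_ge0 => j _.
by rewrite -expr2 sqr_ge0.
Qed.

Lemma norm_le_enorm x : `|x| <= enorm x.
Proof. by apply: norm_rV_le => [|i]; [exact: enorm_ge0|exact: coord_le_enorm]. Qed.

Lemma enorm_le_norm x : enorm x <= n%:R * `|x|.
Proof.
rewrite -(@ler_pXn2r _ 2)// ?nnegrE ?enorm_ge0 ?mulr_ge0// enorm_sqr.
apply: (le_trans (ler_norm _)); apply: (le_trans (dotv_norm_le _ _)).
rewrite exprMn -expr2 ler_wpM2r ?sqr_ge0// expr2.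
by case: (n) => [|k]; rewrite ?mulr0// ler_peMl// ler1n.
Qed.

(** Cauchy-Schwarz, by expanding the square of |y| x - |x| y. *)
Lemma dotv_le_enorm x y : dotv x y <= enorm x * enorm y.
Proof.
have [/eqP|xy0] := eqVneq (enorm x * enorm y) 0.
  rewrite mulf_eq0 => /orP[/eqP z0|/eqP z0].
    have -> : x = 0.
      by apply/rowP => i; apply/eqP; rewrite mxE -normr_le0 -z0 coord_le_enorm.
    by rewrite dotv0l mulr_ge0 ?enorm_ge0.
  have -> : y = 0.
    by apply/rowP => i; apply/eqP; rewrite mxE -normr_le0 -z0 coord_le_enorm.
  by rewrite dotv0r mulr_ge0 ?enorm_ge0.
have xy : 0 < enorm x * enorm y by rewrite lt_neqAle eq_sym xy0 mulr_ge0 ?enorm_ge0.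
have := dotv_ge0 (enorm y *: x - enorm x *: y).
rewrite -scaleNr dotv_sqrD !dotvZl !dotvZr -!enorm_sqr => h.
rewrite -(ler_pM2l xy); nra.
Qed.

Lemma enormD x y : enorm (x + y) <= enorm x + enorm y.
Proof.
rewrite -(@ler_pXn2r _ 2)// ?nnegrE ?addr_ge0 ?enorm_ge0//.
rewrite enorm_sqr dotv_sqrD -!enorm_sqr sqrrD.
by rewrite lerD2r lerD2l; have := dotv_le_enorm x y; lra.
Qed.

Lemma continuous_enorm (T : topologicalType) (f : T -> 'rV[R]_n) :
  continuous f -> continuous (fun t => enorm (f t)).
Proof.
move=> cf; apply: (@continuous_compose _ _ _ (fun t => dotv (f t) (f t)) Num.sqrt).
  exact: continuous_dotv.
exact: sqrt_continuous.
Qed.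

Lemma has_inf_dist x A : A !=set0 -> has_inf [set enorm (x - y) | y in A].
Proof.
move=> [y Ay]; split; first by exists (enorm (x - y)), y.
by exists 0 => _ [z _ <-]; exact: enorm_ge0.
Qed.

Lemma dist_le x y A : A y -> dist x A <= enorm (x - y).
Proof. by move=> Ay; apply: ge_inf; [case: (has_inf_dist x (ex_intro _ y Ay))|exists y]. Qed.

Lemma le_dist x A (c : R) : A !=set0 -> (forall y, A y -> c <= enorm (x - y)) ->
  c <= dist x A.
Proof.
move=> A0 cA; apply: lb_le_inf; first by have [y Ay] := A0; exists (enorm (x - y)), y.
by move=> _ [y Ay <-]; exact: cA.
Qed.

Lemma dist_lipschitz x y A : A !=set0 -> dist x A <= dist y A + enorm (x - y).
Proof.
move=> A0; rewrite -lerBlDr; apply: le_dist => // z Az.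
rewrite lerBlDr; apply: (le_trans (dist_le x Az)).
rewrite (_ : x - z = (x - y) + (y - z)); last by rewrite addrA subrK.
by rewrite addrC enormD.
Qed.

Lemma diam_ge Omega x y : bounded_set Omega -> Omega x -> Omega y ->
  enorm (x - y) <= diam Omega.
Proof.
move=> [M [Mr OM]] Ox Oy; apply: ub_le_sup; last by exists x => //; exists y.
exists (n%:R * ((M + 1) + (M + 1))) => _ [x' Ox' [y' Oy' <-]].
apply: (le_trans (enorm_le_norm _)); rewrite ler_wpM2l//.
by rewrite (le_trans (ler_normB _ _))// lerD// OM// ltrDl.
Qed.

Section domain.
Hypothesis n_gt0 : (0 < n)%N.

(** y minimises the distance to x over the complement of Omega, cut by a ball to be compact. Points
    of the segment just past y towards x are closer to x, hence in Omega, so y is a boundary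
    point. *)
Lemma bounded_open_nearest_boundary Omega x : open Omega -> bounded_set Omega -> Omega x ->
  exists y, [/\ boundary Omega y, dist x (boundary Omega) = enorm (x - y), 0 < enorm (x - y)
    & forall z, ~ Omega z -> enorm (x - y) <= enorm (x - z)].
Proof.
move=> oO bO Ox.
have [z1 nOz1] : exists z, ~ Omega z.
  have [M [Mr OM]] := bO.
  exists (const_mx (`|M| + 2)) => /(OM (`|M| + 1)).
  rewrite (le_lt_trans (ler_norm M)) ?ltrDl// => /(_ isT).
  apply/negP; rewrite -ltNge.
  apply: lt_le_trans (coord_le_norm _ (Ordinal n_gt0)).
  by rewrite mxE [ltRHS]ger0_norm ?addr_ge0//; lra.
pose T := ~` Omega `&` [set z | `|z - x| <= enorm (x - z1)].
have cT : compact T.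
  apply: (@subclosed_compact _ _ [set z | `|z - x| <= enorm (x - z1)]); last exact: subIsetr.
    apply: closedI; first exact: open_closedC.
    by apply: compact_closed; [exact: norm_hausdorff|exact: compact_norm_ball].
  exact: compact_norm_ball.
have ce : continuous (fun z => enorm (z - x)).
  by apply: continuous_enorm; exact: continuous_subr_cst.
have Tz1 : T z1 by split => //=; rewrite enormB norm_le_enorm.
have [y [nOy _] ymin] := compact_argmin cT ce (ex_intro _ z1 Tz1).
have {}ymin z : ~ Omega z -> enorm (x - y) <= enorm (x - z).
  move=> nOz; have [zx|zx] := leP `|z - x| (enorm (x - z1)).
    by rewrite !(enormB x); exact: ymin.
  rewrite enormB (le_trans (ymin z1 Tz1))// enormB (le_trans (ltW zx))//.
  by rewrite (enormB x) norm_le_enorm.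
have xy0 : 0 < enorm (x - y).
  rewrite lt_neqAle enorm_ge0 andbT eq_sym; apply/eqP => xy0; apply: nOy.
  suff <- : x = y by [].
  by apply/rowP => i; apply/eqP; rewrite -subr_eq0 -normr_le0 -xy0;
    have := coord_le_enorm (x - y) i; rewrite !mxE.
have clO z : ~ interior Omega z -> ~ Omega z.
  by move=> nOz Oz; apply: nOz; exact: open_nbhs_nbhs.
have by_ : boundary Omega y.
  split; last by move=> /interior_subset.
  move=> U /nbhs_ballP[e /= e0 yU].
  pose t := Num.min 1 (e / (2 * enorm (x - y))).
  have t0 : 0 < t by rewrite lt_min ltr01 divr_gt0// mulr_gt0.
  have t1 : t <= 1 by rewrite ge_min lexx.
  exists (y + t *: (x - y)); split.
    apply: contrapT => /ymin.
    rewrite (_ : x - (y + _) = (1 - t) *: (x - y)); last first.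
      by rewrite scalerBl scale1r opprD addrA.
    rewrite enormZ ger0_norm ?subr_ge0//; apply/negP; rewrite -ltNge.
    by rewrite gtr_pMl//; lra.
  apply: yU; rewrite -ball_normE/= opprD addrA subrr add0r normrN.
  apply: (le_lt_trans (norm_le_enorm _)); rewrite enormZ gtr0_norm//.
  apply: (@le_lt_trans _ _ (e / (2 * enorm (x - y)) * enorm (x - y))).
    by rewrite ler_wpM2r ?enorm_ge0// ge_min lexx orbT.
  rewrite invfM mulrA -mulrA mulVf ?gt_eqF// mulr1; lra.
exists y; split => //.
apply/eqP; rewrite eq_le dist_le//=; apply: le_dist; first by exists y.
by move=> z [_ nOz]; apply: ymin; exact: clO.
Qed.

(* Otherwise y would lie on a segment between z and a point of the inscribed ball
   around x. *)
Lemma nearest_boundary_support Omega x y z : convex_set Omega -> open Omega ->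
  Omega x -> ~ Omega y ->
  (forall z, ~ Omega z -> enorm (x - y) <= enorm (x - z)) -> Omega z ->
  dotv (y - x) (z - y) <= 0.
Proof.
move=> cO oO Ox nOy ymin Oz; rewrite leNgt; apply/negP => dot0.
pose B := dotv (z - y) (z - y).
have B0 : 0 <= B by exact: dotv_ge0.
pose t := dotv (y - x) (z - y) / (B + 1).
have B1 : 0 < B + 1 by rewrite ltr_wpDl.
have t0 : 0 < t by rewrite divr_gt0.
have tB : t * B <= dotv (y - x) (z - y).
  by rewrite mulrAC ler_pdivrMr// ler_wpM2l ?ltW// ltrDl.
pose w := y - t *: (z - y).
have Ow : Omega w.
  apply: contrapT => /ymin; apply/negP; rewrite -ltNge.
  rewrite -(@ltr_pXn2r _ 2)// ?nnegrE ?enorm_ge0// !(enormB x) !enorm_sqr.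
  rewrite (_ : w - x = (y - x) + (- t) *: (z - y)); last by rewrite scaleNr addrAC.
  rewrite dotv_sqrD !dotvZr dotvZl -/B; nra.
apply: nOy; have t1 : 0 < 1 + t by rewrite addr_gt0.
rewrite (_ : y = (1 + t)^-1 *: w + (1 - (1 + t)^-1) *: z).
  apply: convex_setP => //; rewrite invr_ge0 ltW//= invf_le1// lerDl ltW//.
apply: (@scalerI _ _ (1 + t)); first by rewrite gt_eqF.
rewrite scalerDr !scalerA mulfV ?gt_eqF// scale1r mulrBr mulfV ?gt_eqF// mulr1.
rewrite (addrC 1 t) addrK /w scalerBr opprB scalerDl scale1r addrC addrA subrK.
by [].
Qed.

(** From x' one can move towards the supporting hyperplane at y, in the direction y - x, by any
    length below the distance of x' to the boundary, without leaving Omega and thus without crossing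
    the hyperplane. The shortening of s by a minimum keeps the point strictly inside at a cost of at
    most e. *)
Lemma nearest_boundary_depth Omega x y x' : convex_set Omega -> open Omega ->
  bounded_set Omega -> Omega x -> ~ Omega y -> 0 < enorm (x - y) ->
  (forall z, ~ Omega z -> enorm (x - y) <= enorm (x - z)) -> Omega x' ->
  dist x' (boundary Omega) * enorm (x - y) <= dotv (y - x) (y - x').
Proof.
move=> cO oO bO Ox nOy xy0 ymin Ox'.
have [y' [_ -> x'y'0 y'min]] := bounded_open_nearest_boundary oO bO Ox'.
apply/ler_addgt0Pr => e e0.
pose s := (enorm (x' - y') - Num.min (enorm (x' - y') / 2) (e / enorm (x - y))) / enorm (x - y).
have s0 : 0 <= s.
  by rewrite divr_ge0 ?(ltW xy0)// subr_ge0 ge_min ler_pdivrMr// ler_peMr ?ler1n ?(ltW x'y'0).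
have Oz : Omega (x' + s *: (y - x)).
  apply: contrapT => /y'min; apply/negP; rewrite -ltNge.
  rewrite opprD addrA subrr add0r enormN enormZ ger0_norm// (enormB y) /s divfK ?gt_eqF//.
  by rewrite gtrBl lt_min !divr_gt0.
have := nearest_boundary_support cO oO Ox nOy ymin Oz.
rewrite (_ : x' + _ - y = s *: (y - x) - (y - x')); last by rewrite opprB addrAC addrC addrA.
rewrite (dotvBr _ (s *: _)) dotvZr subr_le0 -enorm_sqr -enormB => h.
rewrite -lerBlDr; apply: le_trans h.
rewrite expr2 mulrA /s divfK ?gt_eqF// mulrBl lerD2l lerN2.
apply: (@le_trans _ _ (e / enorm (x - y) * enorm (x - y))).
  by rewrite ler_wpM2r ?enorm_ge0// ge_min lexx orbT.
by rewrite divfK ?gt_eqF.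
Qed.

End domain.
End euclidean_geometry.

(** * Volume of the slopes admissible at x0 *)

Section cone_volume.
Context {R : realType} {n : nat}.
Hypothesis n_gt0 : (0 < n)%N.
Local Notation mu := (@lebesgue_outer R n).

Definition cube (c : 'rV[R]_n) (a : R) : set 'rV[R]_n :=
  box (c - const_mx a, c + const_mx a).

Lemma cube_coord (c x : 'rV[R]_n) (a : R) i : cube c a x ->
  c 0 i - a < x 0 i <= c 0 i + a.
Proof. by move=> /(_ i); rewrite in_itv/= !mxE. Qed.

Lemma disjoint_boxes_measure_ge (c : nat -> 'rV[R]_n) (a : R) (N : nat) : 0 <= a ->
  (forall j k, (j < k)%N -> cube (c j) a `&`
    cube (c k) a = set0) ->
  ((N%:R * (2 * a) ^+ n)%:E <=
   mu (\bigcup_(k in `I_N) cube (c k) a))%E.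
Proof.
move=> a0 disj; elim: N => [|N IH]; first by rewrite mul0r lebesgue_outer_ge0.
have vol : mu (cube (c N) a) = ((2 * a) ^+ n)%:E.
  rewrite lebesgue_outer_box//; congr EFin.
  rewrite /box_volume (eq_bigr (fun=> 2 * a)) ?prodr_const ?card_ord// => i _.
  rewrite !mxE (_ : c N 0 i + a - _ = 2 * a); last by ring.
  by apply/max_idPr; rewrite mulr_ge0.
rewrite (_ : \bigcup_(k in `I_N.+1) _ = cube (c N) a `|`
    \bigcup_(k in `I_N) cube (c k) a); last first.
  apply/seteqP; split => [x [k /= kN xk]|x [xN|[k /= kN xk]]].
  - move: kN; rewrite ltnS leq_eqVlt => /orP[/eqP kN|kN]; first by left; rewrite -kN.
    by right; exists k.
  - by exists N => /=.
  - by exists k => //=; rewrite ltnS ltnW.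
apply: le_trans (lebesgue_outerU _ _).
- by rewrite vol -natr1 mulrDl mul1r addrC EFinD leeD2l.
- exact: caratheodory_box.
- rewrite setI_bigcupr bigcup0 ?lebesgue_outer0// => k /= kN.
  by rewrite setIC disj.
Qed.

(* The admissible slopes contain a neighbourhood of size m / (8 n D) of the segment from 0
   to the slope of length m / (8 d0) orthogonal to a nearest supporting hyperplane; the
   segment is covered by disjoint cubes. *)
Lemma cone_slopes_volume (Omega : set 'rV[R]_n) x0 (m : R) :
  bounded_convex_domain Omega -> Omega x0 -> 0 < m ->
  exists A : set 'rV[R]_n, [/\ mu.-caratheodory A,
    (forall p x, A p -> Omega x -> dotv p (x - x0) <= m / 4) &
    ((m ^+ n)%:E <= (2 * (4 * n%:R) ^+ n * diam Omega ^+ n.-1 *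
       dist x0 (boundary Omega))%:E * mu A)%E].
Proof.
move=> [oO _ bO cO] Ox0 m0.
have [y [[_ nOy] -> d0_gt0 ymin]] := bounded_open_nearest_boundary n_gt0 oO bO Ox0.
have {}nOy : ~ Omega y by move=> Oy; apply: nOy; exact: open_nbhs_nbhs.
have supp x : Omega x -> dotv (y - x0) (x - y) <= 0.
  exact: (nearest_boundary_support cO oO Ox0 nOy ymin).
set d0 := enorm (x0 - y) in d0_gt0 ymin *.
set D := diam Omega.
have D_gt0 : 0 < D.
  have Oh : Omega (x0 + 2^-1 *: (y - x0)).
    apply: contrapT => /ymin; apply/negP; rewrite -ltNge.
    by rewrite opprD addrA subrr add0r enormN enormZ enormB ger0_norm// gtr_pMl//; lra.
  have := diam_ge bO Oh Ox0; rewrite addrAC subrr add0r enormZ enormB -/d0 ger0_norm//.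
  by apply: lt_le_trans; rewrite mulr_gt0.
have n0 : 0 < n%:R :> R by rewrite ltr0n.
(* A coordinate in which the normal is large; the cubes are separated along it. *)
have [i yi] : exists i, d0 <= n%:R * `|(y - x0) 0 i|.
  have yx0 : mx_norm (y - x0) != 0.
    apply/negP => /eqP /mx_norm_eq0 /eqP; rewrite subr_eq0 => /eqP yx.
    by move: d0_gt0; rewrite /d0 yx subrr /enorm dotv0l sqrtr0 ltxx.
  have [[i' i] /= yi] := mx_norm_neq0 yx0.
  exists i; rewrite -(ord1 i') -yi /d0 enormB; exact: enorm_le_norm.
(* Normalised so that th.(x - x0) = 1 is the supporting hyperplane through y. *)
pose th := (d0 ^+ 2)^-1 *: (y - x0).
have d2 : 0 < d0 ^+ 2 by rewrite exprn_gt0.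
have thi : (n%:R * d0)^-1 <= `|th 0 i|.
  rewrite mxE normrM gtr0_norm ?invr_gt0//.
  rewrite (_ : (n%:R * d0)^-1 = (d0 ^+ 2)^-1 * (d0 / n%:R)); last first.
    by field; rewrite !gt_eqF.
  by rewrite ler_wpM2l ?invr_ge0 ?(ltW d2)// ler_pdivrMr// mulrC.
have thi0 : 0 < `|th 0 i| by rewrite (lt_le_trans _ thi)// invr_gt0 mulr_gt0.
have th1 x : Omega x -> dotv th (x - x0) <= 1.
  move=> Ox; rewrite dotvZl ler_pdivrMl// mulr1.
  rewrite (_ : x - x0 = (x - y) + (y - x0)); last by rewrite addrA subrK.
  by rewrite dotvDr -enorm_sqr (enormB y) -/d0 gerDr supp.
(* A slope in the k-th cube is k s th plus a vector with coordinates at most a. The first part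
   contributes at most k s <= m / 8 and the second at most n a D = m / 8, which gives m / 4. *)
pose a := m / (8 * n%:R * D).
have nD : 0 < 8 * n%:R * D by rewrite !mulr_gt0.
have a0 : 0 < a by rewrite divr_gt0.
(* In coordinate i consecutive centres are 2 a apart, the side of the half-open cubes. *)
pose s := 2 * a / `|th 0 i|.
have s0 : 0 < s by rewrite divr_gt0// mulr_gt0.
pose N := (Num.truncn (m / (8 * s))).+1.
pose c k : 'rV[R]_n := (k%:R * s) *: th.
exists (\bigcup_(k in `I_N) cube (c k) a); split.
- rewrite (bigcup_mkord N (fun k => cube (c k) a)).
  apply: (@caratheodory_measurable_bigsetU _ _ mu (fun k => cube (c k) a)) => k.
  exact: caratheodory_box.
- move=> p x [k /= kN pk] Ox.
  rewrite (_ : p = c k + (p - c k)); last by rewrite addrC subrK.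
  rewrite dotvDl dotvZl.
  have ks : k%:R * s <= m / 8.
    rewrite -ler_pdivlMr// -mulrA -invfM; apply: (@le_trans _ _ (Num.truncn (m / (8 * s)))%:R).
      by rewrite ler_nat -ltnS.
    by rewrite truncn_le// divr_ge0 ?ltW// mulr_gt0.
  have h1 : k%:R * s * dotv th (x - x0) <= m / 8.
    apply: le_trans ks; rewrite ler_piMr ?th1// mulr_ge0//; exact: ltW.
  have h2 : dotv (p - c k) (x - x0) <= m / 8.
    apply: (le_trans (ler_norm _)); apply: (le_trans (dotv_norm_le _ _)).
    apply: (@le_trans _ _ (n%:R * (a * D))).
      rewrite ler_wpM2l// ler_pM//.
        apply: norm_rV_le => [|j]; first exact: ltW.
        have := cube_coord j pk; rewrite [(p - c k) 0 j]mxE [(- c k) 0 j]mxE ler_norml.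
        by move=> /andP[q1 q2]; apply/andP; split; lra.
      by rewrite (le_trans (norm_le_enorm _))// diam_ge.
    rewrite /a le_eqVlt; apply/orP; left; apply/eqP; field.
    by rewrite !gt_eqF.
  lra.
- have vol := @disjoint_boxes_measure_ge c a N (ltW a0).
  have {}vol := vol _.
  have disj j k : (j < k)%N -> cube (c j) a `&` cube (c k) a = set0.
    move=> jk; apply/seteqP; split => // x [/(cube_coord i) xj /(cube_coord i) xk].
    have cE l : c l 0 i = l%:R * (s * th 0 i) by rewrite mxE mulrA.
    move: xj xk; rewrite !cE => /andP[j1 j2] /andP[k1 k2].
    have kj : j%:R + 1 <= k%:R :> R by rewrite natr1 ler_nat.
    have sth : `|s * th 0 i| = 2 * a by rewrite normrM gtr0_norm// /s divfK ?gt_eqF.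
    have [th_ge0|th_lt0] := leP 0 (s * th 0 i).
      by move: sth j1 j2 k1 k2; rewrite ger0_norm// => ->; nra.
    have {sth} : s * th 0 i = - (2 * a) by rewrite -sth ltr0_norm// opprK.
    by move=> sth; move: j1 j2 k1 k2; rewrite sth; nra.
  have c0 : 0 <= 2 * (4 * n%:R) ^+ n * D ^+ n.-1 * d0.
    by rewrite !mulr_ge0 ?exprn_ge0 ?mulr_ge0// ltW.
  apply: le_trans (lee_wpmul2l _ (vol disj)); last by rewrite lee_fin.
  rewrite -EFinM lee_fin.
  have mE : m = 4 * n%:R * D * (2 * a).
    by rewrite /a; field; rewrite !gt_eqF.
  (* One factor diam is traded for the distance here: N >= n D |th_i| / 2, and n d0 |th_i| >= 1 by
     the choice of i. *)
  have NE : D <= 2 * d0 * N%:R.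
    have h : m / (8 * s) <= N%:R by rewrite ltW// truncnS_gt.
    apply: (@le_trans _ _ (2 * d0 * (m / (8 * s)))); last by rewrite ler_wpM2l// mulr_ge0// ltW.
    rewrite (_ : m / (8 * s) = n%:R * D * `|th 0 i| / 2); last first.
      by rewrite /s {1}mE; field; rewrite !gt_eqF.
    rewrite (_ : _ * _ = D * (n%:R * d0 * `|th 0 i|)); last by field.
    by rewrite ler_peMr ?(ltW D_gt0)// -ler_pdivrMl ?mulr_gt0// mulr1.
  rewrite {1}mE exprMn exprMn (_ : D ^+ n = D ^+ n.-1 * D); last by rewrite -exprSr prednK.
  rewrite (_ : _ * (N%:R * _) =
    (4 * n%:R) ^+ n * (D ^+ n.-1 * (2 * d0 * N%:R)) * (2 * a) ^+ n); last by ring.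
  apply: ler_wpM2r; first by rewrite exprn_ge0// mulr_ge0// ltW.
  apply: ler_wpM2l; first by rewrite exprn_ge0// mulr_ge0.
  by apply: ler_wpM2l => //; rewrite exprn_ge0// ltW.
Qed.

End cone_volume.

(** * The weighted Aleksandrov estimate *)

Section counting.
Context {R : realType} {n : nat}.
Hypothesis n_gt0 : (0 < n)%N.
Implicit Types (A B S : set 'rV[R]_n).
Local Notation mu := (@lebesgue_outer R n).
Let lam := (lebesgue_rV : {measure set (caratheodory_type mu) -> \bar R}).

Let measurable_indic_cara (D A : set (caratheodory_type mu)) : mu.-caratheodory A ->
  measurable_fun D (fun x => (\1_A x)%:E : \bar R).
Proof. by move=> mA; apply/measurable_EFinP; apply: measurable_indic; exact: mA. Qed.

Let integral_sum_indic (I : finType) (B : I -> set (caratheodory_type mu)) D :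
  mu.-caratheodory D -> (forall i, mu.-caratheodory (B i)) ->
  (\int[lam]_(x in D) (\sum_i (\1_(B i) x)%:E) = \sum_i mu (B i `&` D))%E.
Proof.
move=> mD mB.
have f0 i (x : caratheodory_type mu) : D x -> (0 <= (\1_(B i) x)%:E :> \bar R)%E.
  by rewrite lee_fin.
rewrite (@ge0_integral_sum _ _ _ lam D mD _ (fun i x => (\1_(B i) x)%:E)
  (fun i => measurable_indic_cara (D := D) (mB i)) f0).
by apply: eq_bigr => i _; rewrite (@integral_indic _ _ _ lam D mD (B i) (mB i)).
Qed.

(** Together with its converse below, this is Fubini for the counting of slopes: a pointwise bound
    on the number of sets containing a slope is integrated over A. *)
Lemma sum_indic_measure_ge (I : finType) (B : I -> set 'rV[R]_n) A (c : R) : 0 <= c ->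
  mu.-caratheodory A -> (forall i, mu.-caratheodory (B i)) ->
  (forall x, A x -> c <= \sum_i \1_(B i) x) ->
  (c%:E * mu A <= \sum_i mu (B i))%E.
Proof.
move=> c0 mA mB cB.
rewrite (_ : (c%:E * mu A)%E = \int[lam]_(x in A) cst c%:E x)%E; last first.
  by rewrite (integral_cst lam mA).
apply: (@le_trans _ _ (\int[lam]_(x in A) (\sum_i (\1_(B i) x)%:E))%E); last first.
  rewrite integral_sum_indic//; apply: lee_sum => i _.
  by apply: le_lebesgue_outer => x [].
apply: (@ge0_le_integral _ _ _ lam A mA (cst c%:E) (fun x => \sum_i (\1_(B i) x)%:E)%E).
- by move=> x _; rewrite lee_fin.
- exact: measurable_cst.
- by apply: emeasurable_sum => i; apply: measurable_indic_cara; exact: mB.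
- by move=> x Ax; rewrite sumEFin lee_fin; exact: cB.
Qed.

Lemma sum_indic_measure_le (I : finType) (B : I -> set 'rV[R]_n) A (c : R) : 0 <= c ->
  mu.-caratheodory A -> (forall i, mu.-caratheodory (B i)) ->
  (forall x, A x -> \sum_i \1_(B i) x <= c) -> (forall i, B i `<=` A) ->
  (\sum_i mu (B i) <= c%:E * mu A)%E.
Proof.
move=> c0 mA mB cB BA.
rewrite (_ : (c%:E * mu A)%E = \int[lam]_(x in A) cst c%:E x)%E; last first.
  by rewrite (integral_cst lam mA).
apply: (@le_trans _ _ (\int[lam]_(x in A) (\sum_i (\1_(B i) x)%:E))%E).
  rewrite integral_sum_indic//; apply: lee_sum => i _.
  by apply: le_lebesgue_outer => x Bx; split => //; exact: BA Bx.
apply: (@ge0_le_integral _ _ _ lam A mA (fun x => \sum_i (\1_(B i) x)%:E)%E (cst c%:E)).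
- by move=> x _; apply: sume_ge0 => i _; rewrite lee_fin.
- by apply: emeasurable_sum => i; apply: measurable_indic_cara; exact: mB.
- exact: measurable_cst.
- by move=> x Ax; rewrite sumEFin lee_fin; exact: cB.
Qed.

Lemma caratheodory_bigcup_seq (I : choiceType) (T : seq I) (G : I -> set 'rV[R]_n) :
  (forall i, mu.-caratheodory (G i)) -> mu.-caratheodory (\bigcup_(i in [set` T]) G i).
Proof.
move=> mG; rewrite bigcup_seq; elim/big_ind : _ => //.
  exact: caratheodory_measurable_set0.
exact: caratheodory_measurable_setU.
Qed.

(* A map which is a translation on each of finitely many pieces and injective up to a
   null set does not decrease the measure. *)
Lemma piecewise_translation_measure_le (T : seq 'rV[R]_n) (G : 'rV[R]_n -> set 'rV[R]_n)
    (s : R) (N : set 'rV[R]_n) : mu N = 0%E -> (forall th, mu.-caratheodory (G th)) ->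
  (forall th th' p p', th \in T -> th' \in T -> G th p -> G th' p' ->
    p + s *: th = p' + s *: th' -> ~ N (p + s *: th) -> G th' p) ->
  (mu (\bigcup_(th in [set` T]) G th) <=
   mu (\bigcup_(th in [set` T]) [set p + s *: th | p in G th])%R)%E.
Proof.
move=> N0 mG; elim: T => [|th T IH] inj.
  by rewrite (_ : [set` [::]] = set0) ?bigcup_set0//; apply/seteqP; split.
pose U := \bigcup_(th in [set` T]) G th.
pose W : set 'rV[R]_n := \bigcup_(th in [set` T]) [set p + s *: th | p in G th].
have mU : mu.-caratheodory U by exact: caratheodory_bigcup_seq.
apply: (le_trans (lebesgue_outer_setD_le _ mU)).
apply: (@le_trans _ _ (mu W + mu [set p + s *: th | p in G th `\` U]%R)%E).
  apply: leeD.
    apply: IH => th1 th2 p p' h1 h2; apply: inj; first by rewrite inE h1 orbT.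
    by rewrite inE h2 orbT.
  rewrite lebesgue_outer_translate//; apply: le_lebesgue_outer => p [[th' /= + Gp] nUp].
  by rewrite inE => /orP[/eqP <-//|h]; case: nUp; exists th'.
rewrite addeC; apply: le_trans (lebesgue_outerU _ _) _.
- apply: caratheodory_translate => //.
  exact: caratheodory_measurable_setD.
- apply/eqP; rewrite eq_le lebesgue_outer_ge0 andbT -N0; apply: le_lebesgue_outer.
  move=> _ [[p [Gp nUp] <-] [th' /= h' [p' Gp' /esym e]]].
  apply: contrapT => nN; apply: nUp; exists th' => //.
  by apply: (inj th th' p p') => //; rewrite inE ?eqxx ?h' ?orbT.
- apply: le_lebesgue_outer => q [[p [Gp _] <-]|[th' /= h' [p Gp <-]]].
    by exists th; rewrite /= ?inE ?eqxx//; exists p.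
  by exists th'; rewrite /= ?inE ?h' ?orbT//; exists p.
Qed.

Lemma sum_natr_eq (K e : nat) : \sum_(k < K) (k == e :> nat)%:R = (e < K)%:R :> R.
Proof.
elim: K => [|K IH]; first by rewrite big_ord0.
rewrite big_ord_recr/= IH [in RHS]ltnS [in RHS]leq_eqVlt (eq_sym e).
by case: (eqVneq K e) => [->|_] /=; rewrite ?ltnn ?add0r ?addr0.
Qed.

End counting.

(** * Sliding planes under phi + s kappa *)

Section weighted_slopes.
Context {R : realType} {n : nat}.
Hypothesis n_gt0 : (0 < n)%N.
Local Notation mu := (@lebesgue_outer R n).
Variables (Z C A : set 'rV[R]_n) (x0 : 'rV[R]_n) (phi kappa : 'rV[R]_n -> R)
  (T : seq 'rV[R]_n) (m : R).
Hypotheses (cZ : compact Z) (cC : compact C) (CZ : C `<=` Z) (Zx0 : Z x0).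
Hypotheses (cphi : continuous phi) (ckappa : continuous kappa).
Hypotheses (m_gt0 : 0 < m) (phix0 : phi x0 = - m).
Hypotheses (phiC : forall x, Z x -> phi x <= - (m / 4) -> C x).
Hypotheses (kappa_le : forall th x, th \in T -> kappa x <= 1 - dotv th (x - x0)).
Hypotheses (kappa_eq : forall x, exists2 th, th \in T & kappa x = 1 - dotv th (x - x0)).
Hypotheses (kappa_ge0 : forall x, Z x -> 0 <= kappa x).
Hypotheses (kappa_gt0 : forall x, C x -> 0 < kappa x).
Hypotheses (kappa_le1 : forall x, kappa x <= 1).
Hypotheses (mA : mu.-caratheodory A).
Hypothesis A_slopes : forall p x, A p -> Z x -> dotv p (x - x0) <= m / 4.

(** Step of the discretised parameter s, which takes the values k D. *)
Let D := m / 2.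
Let D_gt0 : 0 < D. Proof. by rewrite divr_gt0. Qed.
Let psi k x := phi x + k%:R * D * kappa x.
Let cpsi k : continuous (psi k).
Proof.
apply: continuous_add => //; apply: continuous_mul => //.
exact: cst_continuous.
Qed.

Let level J (j : nat) := [set x | C x /\ j.+1%:R / J%:R <= kappa x].

Let compact_level J j : compact (level J j).
Proof.
apply: (@subclosed_compact _ _ C) => //; last by move=> x [].
apply: closedI; first by apply: compact_closed => //; exact: norm_hausdorff.
by apply: closed_le_continuous => //; exact: cst_continuous.
Qed.

(* G k j th collects the slopes p in A whose touching plane for psi k = phi + s_k kappa
   touches at height in the window [-3m/2, -m/2], at a point where kappa = 1 - th.(x - x0)
   exceeds (j+1)/J; then p + s_k th is a slope of phi at this point. *)
Let G J k j th := A `&` [set p | exists2 x, level J j x &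
  subdifferential Z (psi k) x p /\ [/\ 1 - dotv th (x - x0) <= kappa x,
   - (3 * D) <= psi k x - dotv p (x - x0) & psi k x - dotv p (x - x0) <= - D]].

Let measurable_G J k j th : mu.-caratheodory (G J k j th).
Proof.
apply: caratheodory_measurable_setI => //; apply: caratheodory_closed => //.
pose W := ('rV[R]_n * 'rV[R]_n)%type.
have cval : continuous (fun t : W => psi k t.2 - dotv t.1 (t.2 - x0)).
  apply: continuous_sub.
    by apply: continuous_compose => //; exact: continuous_snd.
  apply: continuous_dotv; first exact: continuous_fst.
  by apply: continuous_sub; [exact: continuous_snd|exact: cst_continuous].
apply: (@closed_exists_compact _ _ (level J j)
  [set t : W | subdifferential Z (psi k) t.2 t.1 /\ [/\ 1 - dotv th (t.2 - x0) <= kappa t.2,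
   - (3 * D) <= psi k t.2 - dotv t.1 (t.2 - x0) &
   psi k t.2 - dotv t.1 (t.2 - x0) <= - D]]) => //.
rewrite (_ : [set t | _] = [set t : W | subdifferential Z (psi k) t.2 t.1] `&`
  ([set t : W | 1 - dotv th (t.2 - x0) <= kappa t.2] `&`
   ([set t : W | - (3 * D) <= psi k t.2 - dotv t.1 (t.2 - x0)] `&`
    [set t : W | psi k t.2 - dotv t.1 (t.2 - x0) <= - D]))); last first.
  by apply/seteqP; split => t; [move=> [? []]|move=> [? [? []]]].
apply: closedI; last apply: closedI; last apply: closedI.
- apply: (@closed_subdifferential _ _ W snd fst Z (psi k) (@cpsi k)).
    exact: continuous_snd.
  exact: continuous_fst.
- apply: closed_le_continuous.
    apply: continuous_sub; first exact: cst_continuous.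
    apply: continuous_dotv; first exact: cst_continuous.
    by apply: continuous_sub; [exact: continuous_snd|exact: cst_continuous].
  by apply: continuous_compose => //; exact: continuous_snd.
- by apply: closed_le_continuous => //; exact: cst_continuous.
- by apply: closed_le_continuous => //; exact: cst_continuous.
Qed.

(** Receives the images q = p + k D th of the sets [G]: since kappa = 1 - th.(x - x0) at the
    touching point, q.(x - x0) - phi x is k D minus the touching height, and this height lies in
    [-3 D, -D]. *)
Let Q J k j := [set q | exists2 x, level J j x & subdifferential Z phi x q /\
  k.+1%:R * D <= dotv q (x - x0) - phi x <= k.+3%:R * D].

Let measurable_Q J k j : mu.-caratheodory (Q J k j).
Proof.
apply: caratheodory_closed => //.
pose W := ('rV[R]_n * 'rV[R]_n)%type.
have cval : continuous (fun t : W => dotv t.1 (t.2 - x0) - phi t.2).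
  apply: continuous_sub.
    apply: continuous_dotv; first exact: continuous_fst.
    by apply: continuous_sub; [exact: continuous_snd|exact: cst_continuous].
  by apply: continuous_compose => //; exact: continuous_snd.
apply: (@closed_exists_compact _ _ (level J j)
  [set t : W | subdifferential Z phi t.2 t.1 /\
   k.+1%:R * D <= dotv t.1 (t.2 - x0) - phi t.2 <= k.+3%:R * D]) => //.
rewrite (_ : [set t | _] = [set t : W | subdifferential Z phi t.2 t.1] `&`
  ([set t : W | k.+1%:R * D <= dotv t.1 (t.2 - x0) - phi t.2] `&`
   [set t : W | dotv t.1 (t.2 - x0) - phi t.2 <= k.+3%:R * D])); last first.
  apply/seteqP; split => t; first by move=> [? /andP[? ?]].
  by move=> [? [? ?]]; split => //; apply/andP; split.
apply: closedI; last apply: closedI.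
- apply: (@closed_subdifferential _ _ W snd fst Z phi cphi).
    exact: continuous_snd.
  exact: continuous_fst.
- by apply: closed_le_continuous => //; exact: cst_continuous.
- by apply: closed_le_continuous => //; exact: cst_continuous.
Qed.

(** The function s kappa lies below the affine function s (1 - th.(y - x0)) and meets it at x. The
    plane thus stays below phi plus this affine function, which is then subtracted. *)
Let slope_shift k x p th : Z x -> th \in T -> 1 - dotv th (x - x0) <= kappa x ->
  subdifferential Z (psi k) x p -> subdifferential Z phi x (p + (k%:R * D) *: th).
Proof.
move=> Zx thT thx px y Zy.
have s0 : 0 <= k%:R * D by rewrite mulr_ge0// ltW.
have := px y Zy; rewrite /psi; set s := k%:R * D in s0 *.
have h1 : s * kappa y <= s * (1 - dotv th (y - x0)) by rewrite ler_wpM2l// kappa_le.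
have h2 : s * (1 - dotv th (x - x0)) <= s * kappa x by rewrite ler_wpM2l.
rewrite dotvDl dotvZl; move: h1 h2; rewrite !dotvBr; lra.
Qed.

(** If p + s th = p' + s th' touches at two distinct points, it lies in the null set
    [multiple_slopes]. If the touching points agree, p satisfies the condition for th' as well, as
    [piecewise_translation_measure_le] demands. *)
Let measure_G_le J k j :
  (mu (\bigcup_(th in [set` T]) G J k j th) <= mu (Q J k j))%E.
Proof.
apply: (le_trans (@piecewise_translation_measure_le _ _ n_gt0 T (G J k j) (k%:R * D)
  (multiple_slopes Z phi) (multiple_slopes_null n_gt0 cphi cZ) (measurable_G J k j) _)).
  move=> th th' p p' hT hT' [Ap [x Lx [px [thx w1 w2]]]] [Ap' [x' Lx' [px' [thx' w1' w2']]]] e nN.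
  have Zx : Z x by apply: CZ; case: Lx.
  have Zx' : Z x' by apply: CZ; case: Lx'.
  have xx' : x = x'.
    apply: contrapT => /eqP xx'; apply: nN; exists x, x'; split => //.
      exact: slope_shift.
    by rewrite e; exact: slope_shift.
  by split => //; exists x => //; split => //; split => //; rewrite xx'.
apply: le_lebesgue_outer => _ [th /= hT [p [Ap [x Lx [px [thx w1 w2]]]] <-]].
have Zx : Z x by apply: CZ; case: Lx.
exists x => //; split; first exact: slope_shift.
have kE : kappa x = 1 - dotv th (x - x0).
  by apply/eqP; rewrite eq_le kappa_le.
move: w1 w2; rewrite /psi kE dotvDl dotvZl -(@natr1 _ k.+2) -(@natr1 _ k.+1) -(@natr1 _ k).
by move=> w1 w2; apply/andP; split; lra.
Qed.

Let sum_Q_le J K j :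
  (\sum_(k < K) mu (Q J k j) <= 3%:E * mu (slopes Z phi (level J j)))%E.
Proof.
apply: sum_indic_measure_le => //.
- by apply: caratheodory_closed => //; exact: closed_slopes.
- move=> q [x Lx qx].
  (* The quantity q.(x - x0) - phi x is the same at all touching points of q, so q determines [c]
     and only the three indices c - 1, c - 2, c - 3 are possible for k. *)
  pose c := Num.truncn ((dotv q (x - x0) - phi x) / D).
  have QE (k : 'I_K) : Q J k j q -> (k.+1 <= c <= k.+3)%N.
    move=> [x' Lx' [qx' /andP[k1 k2]]].
    have e : dotv q (x - x0) - phi x = dotv q (x' - x0) - phi x'.
      have := qx x' (CZ Lx'.1); have := qx' x (CZ Lx.1); rewrite !dotvBr; lra.
    rewrite /c e; apply/andP; split.
      by rewrite -ltnS -(ltr_nat R) (le_lt_trans _ (truncnS_gt _))// ler_pdivlMr.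
    rewrite -(ler_nat R); apply: (@le_trans _ _ ((dotv q (x' - x0) - phi x') / D)).
      by rewrite truncn_le divr_ge0 ?(ltW D_gt0)// (le_trans _ k1)// mulr_ge0// ltW.
    by rewrite ler_pdivrMr.
  pose hit e : R := \sum_(k < K) (k == e :> nat)%:R.
  have hit1 e : hit e <= 1 by rewrite /hit sum_natr_eq; case: (e < K)%N.
  apply: (@le_trans _ _ (hit c.-1 + hit c.-2 + hit c.-2.-1)).
    rewrite /hit -!big_split; apply: ler_sum => k _ /=; rewrite indicE.
    case: (boolP (_ \in _)) => [|_]; last by rewrite !addr_ge0.
    rewrite inE => /QE /andP[k1 k2].
    have : [|| k == c.-1 :> nat, k == c.-2 :> nat | k == c.-2.-1 :> nat].
      by case: (c) k1 k2 => [|[|[|c']]]/=; lia.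
    by case/or3P => ->; [rewrite -addrA lerDl|rewrite addrAC lerDr|rewrite lerDr]; rewrite addr_ge0.
  by have := hit1 c.-1; have := hit1 c.-2; have := hit1 c.-2.-1; lra.
- by move=> k q [x Lx [qx _]]; exists x.
Qed.

Let sum_level_ge (J : nat) (r : R) : (0 < J)%N -> 0 <= r <= 1 ->
  J%:R * r - 1 <= \sum_(j < J) (j.+1%:R / J%:R <= r)%R%:R.
Proof.
move=> J0 /andP[r0 r1].
have J0' : 0 < J%:R :> R by rewrite ltr0n.
pose t := Num.truncn (J%:R * r).
have tJ : (t <= J)%N.
  rewrite -(ler_nat R); apply: (@le_trans _ _ (J%:R * r)).
    by rewrite truncn_le mulr_ge0.
  by rewrite ler_piMr// ltW.
apply: (@le_trans _ _ t%:R).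
  by rewrite lerBlDr natr1 ltW// truncnS_gt.
rewrite -natr_sum ler_nat -(big_mkord xpredT (fun j => nat_of_bool (j.+1%:R / J%:R <= r))).
rewrite (big_cat_nat _ tJ)//=.
apply: leq_trans (leq_addr _ _).
rewrite (eq_big_nat _ _ (F2 := fun=> 1%N)).
  by rewrite sum_nat_const_nat muln1 subn0.
move=> j /andP[_ jt]; rewrite ler_pdivrMr// mulrC (le_trans _ (_ : t%:R <= _))//.
  by rewrite ler_nat.
by rewrite truncn_le mulr_ge0// ltW.
Qed.

(** For each p in A the values of kappa over the steps in the window sum to at least 1. Multiplied
    by J = 2 K this is 2 K, and counting levels instead of J kappa loses at most 1 for each of the K
    steps, so p lies in at least K of the sets [B]. Each slope of [phi] is counted at most 3 times
    per level, hence K mu A <= 3 times the sum, and the factor 6 for J mu A. *)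
Theorem weighted_slopes_measure : exists2 J : nat, (0 < J)%N &
  (J%:R%:E * mu A <=
   6%:E * \sum_(j < J) mu (slopes Z phi (level J j)))%E.
Proof.
have [M M0 ZM] := compact_bound cZ cphi.
have Cx0 : C x0 by apply: phiC => //; rewrite phix0; have := m_gt0; lra.
have [xm Cxm kmin] := compact_argmin cC ckappa (ex_intro _ x0 Cx0).
have km0 := kappa_gt0 Cxm.
(* After K steps the term K D kappa outweighs the lower bound -M of [phi] on C. *)
pose K := (Num.truncn (M / (D * kappa xm))).+1.
have KM : M <= K%:R * D * kappa xm.
  rewrite -mulrA -ler_pdivrMr ?mulr_gt0//; exact/ltW/truncnS_gt.
pose J := (2 * K)%N; exists J; first by rewrite muln_gt0.
have [X XP] : {X : nat * 'rV[R]_n -> 'rV[R]_n & forall t, Z (X t) /\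
    forall y, Z y -> psi t.1 (X t) - dotv t.2 (X t - x0) <= psi t.1 y - dotv t.2 (y - x0)}.
  apply: (@choice _ _ (fun t x => Z x /\
    forall y, Z y -> psi t.1 x - dotv t.2 (x - x0) <= psi t.1 y - dotv t.2 (y - x0))) => t.
  have ct : continuous (fun x => psi t.1 x - dotv t.2 (x - x0)).
    apply: continuous_sub => //; apply: continuous_dotv; first exact: cst_continuous.
    exact: continuous_subr_cst.
  by have [x Zx xmin] := compact_argmin cZ ct (ex_intro _ x0 Zx0); exists x.
(* Height at x0 of the plane of slope p that touches [psi k] from below. *)
pose a k p := psi k (X (k, p)) - dotv p (X (k, p) - x0).
have a0 p : a 0%N p <= - m.
  have [_ /(_ x0 Zx0)] := XP (0%N, p).
  by rewrite /a /psi !mul0r !addr0 subrr dotv0r subr0 phix0.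
have aS k p : a k.+1 p <= a k p + D * kappa (X (k, p)).
  have [_ /(_ (X (k, p)))] := XP (k.+1, p).
  move=> /(_ (XP (k, p)).1) /le_trans; apply.
  by rewrite /a /psi/= -natr1 le_eqVlt; apply/orP; left; apply/eqP; ring.
(* Since the plane rises by at most m / 4 from x0, a height below -m / 2 forces phi <= -m / 4 at the
   touching point. *)
have aC k p : A p -> a k p <= - D -> C (X (k, p)).
  move=> Ap; rewrite /a /psi => ak; apply: phiC; first by case: (XP (k, p)).
  have Zx := (XP (k, p)).1.
  have := A_slopes Ap Zx.
  have : 0 <= k%:R * D * kappa (X (k, p)).
    by rewrite mulr_ge0 ?kappa_ge0// mulr_ge0// ltW.
  by move: ak; rewrite /D; lra.
have aK p : A p -> - D <= a K p.
  move=> Ap; rewrite leNgt; apply/negP => ak.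
  have Cx := aC _ _ Ap (ltW ak); have Zx := (XP (K, p)).1.
  have := A_slopes Ap Zx; have := ZM _ Zx; rewrite ler_norml => /andP[h1 _] h2.
  have h3 : M <= K%:R * D * kappa (X (K, p)).
    by apply: (le_trans KM); rewrite ler_wpM2l ?kmin// mulr_ge0// ltW.
  by move: ak h3 m_gt0; rewrite /a /psi /D; lra.
pose win k p := (- (3 * D) <= a k p) && (a k p <= - D).
have win_sum p : A p -> 1 <= \sum_(k < K) (win k p)%:R * kappa (X (k : nat, p)).
  move=> Ap; rewrite -(ler_pM2l D_gt0) mulr1 mulr_sumr.
  (* The height truncated to [-m, -D] rises by D in total. One step adds at most D kappa <= D, so a
     step that raises the truncated height starts at -3 D or above; this fixes the window. *)
  pose b k := Num.max (- m) (Num.min (- D) (a k p)).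
  have bD : D = b K - b 0%N.
    rewrite /b (min_idPl _) ?aK// (max_idPr _) ?lerN2 ?ler_pdivrMr ?ler_peMr ?ler1n ?(ltW m_gt0)//.
    rewrite (max_idPl _); first by rewrite /D; field.
    by rewrite ge_min a0 orbT.
  rewrite [leLHS]bD -(telescope_sumr b (leq0n K)) big_mkord; apply: ler_sum => k _.
  have m2D : m = 2 * D by rewrite /D; field.
  have := aS k p; have k0 := kappa_ge0 (XP (k : nat, p)).1.
  set Dk := D * kappa _ => akS.
  have Dk0 : 0 <= Dk by rewrite mulr_ge0// ltW.
  have DkD : Dk <= D by rewrite ler_piMr ?kappa_le1// ltW.
  rewrite mulrCA -/Dk /win /b m2D.
  have [a1|a1] := leP (- (3 * D)) (a k p); have [a2|a2] := leP (a k p) (- D);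
    rewrite /= ?mul1r ?mul0r.
  - rewrite lerBlDl ge_max; apply/andP; split.
      by apply: ler_wpDr => //; rewrite le_max lexx.
    rewrite ge_min; apply/orP; right; apply: (le_trans akS).
    by rewrite lerD2r le_max lexx orbT.
  - by rewrite subr_le0 ge_max le_max lexx/= le_max; apply/orP; right; rewrite ge_min lexx.
  - rewrite subr_le0 ge_max le_max lexx/= le_max; apply/orP; left.
    rewrite ge_min; apply/orP; right; move: akS a1 DkD; lra.
  - by exfalso; move: a1 a2 D_gt0; lra.
pose B (t : 'I_K * 'I_J) := \bigcup_(th in [set` T]) G J t.1 t.2 th.
have mB t : mu.-caratheodory (B t) by apply: caratheodory_bigcup_seq.
have cover p : A p -> K%:R <= \sum_t (\1_(B t) p : R).
  move=> Ap.
  have {}win_sum := win_sum p Ap.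
  rewrite -(pair_bigA _ (fun k j => \1_(B (k, j)) p : R))/=.
  apply: (@le_trans _ _ (\sum_(k < K) ((win k p)%:R * (J%:R * kappa (X (k : nat, p)) - 1)))).
    apply: (@le_trans _ _ (J%:R * (\sum_(k < K) (win k p)%:R * kappa (X (k : nat, p))) - K%:R)).
      set S := \sum_(k < K) _ in win_sum *.
      have : K%:R <= K%:R * S by rewrite ler_peMr.
      by rewrite /J natrM; lra.
    rewrite lerBlDr mulr_sumr -[X in _ + X%:R]card_ord -sumr_const -big_split.
    apply: ler_sum => k _ /=; case: (win k p); rewrite /= ?mul1r ?mul0r ?mulr0 ?subrK//.
  apply: ler_sum => k _; have [/andP[w1 w2]|] := boolP (win k p); last first.
    by move=> _; rewrite mul0r; apply: sumr_ge0 => j _; rewrite indicE ler0n.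
  rewrite mul1r; have [Zx xmin] := XP (k : nat, p).
  have Cx := aC _ _ Ap w2.
  apply: (le_trans (@sum_level_ge J (kappa (X (k : nat, p))) _ _)); first by rewrite muln_gt0.
    by rewrite kappa_ge0// kappa_le1.
  apply: ler_sum => j _; have [lj|_] := boolP (j.+1%:R / J%:R <= kappa (X (k : nat, p)));
    last by rewrite indicE ler0n.
  rewrite indicE mem_set//.
  have [th thT thx] := kappa_eq (X (k : nat, p)).
  exists th => //; split => //; exists (X (k : nat, p)); first by split.
  split; last by split; rewrite ?thx.
  by move=> y Zy; have := xmin y Zy; rewrite /= !dotvBr; lra.
have K0 : 0 <= K%:R :> R by [].
have KA := sum_indic_measure_ge K0 mA mB cover.
have BQ : (\sum_t mu (B t) <= \sum_(j < J) (3%:E * mu (slopes Z phi (level J j))))%E.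
  rewrite -(pair_bigA _ (fun k j => mu (B (k, j))))/= exchange_big/=.
  apply: lee_sum => j _; apply: le_trans (sum_Q_le J K j).
  by apply: lee_sum => k _; exact: measure_G_le.
have -> : J%:R = 2 * K%:R :> R by rewrite /J natrM.
have -> : 6%:E = (2 * 3)%:E :> \bar R by congr EFin; ring.
rewrite !EFinM -!muleA; apply: lee_wpmul2l => //.
rewrite ge0_sume_distrr; last by move=> j _; exact: lebesgue_outer_ge0.
exact: le_trans KA BQ.
Qed.

End weighted_slopes.

(** * The weight on a convex domain *)

Section weighted_alexandrov.
Context {R : realType} {n : nat}.
Hypothesis n_gt0 : (0 < n)%N.
Local Notation mu := (@lebesgue_outer R n).

(** The value 1 on the empty list includes the affine function with gradient 0, which keeps the
    minimum at most 1; all the functions equal 1 at x0. *)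
Fixpoint min_affine (x0 : 'rV[R]_n) (T : seq 'rV[R]_n) (x : 'rV[R]_n) : R :=
  if T is th :: T' then Num.min (1 - dotv th (x - x0)) (min_affine x0 T' x) else 1.

Lemma min_affine_le1 x0 T x : min_affine x0 T x <= 1.
Proof. by elim: T => [|th T IH] //=; rewrite ge_min IH orbT. Qed.

Lemma min_affine_le x0 T x th : th \in 0 :: T ->
  min_affine x0 T x <= 1 - dotv th (x - x0).
Proof.
rewrite inE => /orP[/eqP ->|]; first by rewrite dotv0l subr0 min_affine_le1.
elim: T => [|th' T IH] //=; rewrite inE ge_min => /orP[/eqP ->|/IH ->].
  by rewrite lexx.
by rewrite orbT.
Qed.

Lemma min_affine_eq x0 T x :
  exists2 th, th \in 0 :: T & min_affine x0 T x = 1 - dotv th (x - x0).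
Proof.
elim: T => [|th T [th' th'T IH]] /=.
  by exists 0; rewrite ?inE ?eqxx// dotv0l subr0.
case: leP => _; first by exists th => //; rewrite !inE eqxx orbT.
by exists th' => //; move: th'T; rewrite !inE => /orP[->|->]; rewrite ?orbT.
Qed.

Lemma continuous_min_affine x0 T : continuous (min_affine x0 T).
Proof.
elim: T => [|th T IH] /=; first exact: cst_continuous.
apply: continuous_minr => //; apply: continuous_sub; first exact: cst_continuous.
by apply: continuous_dotv; [exact: cst_continuous|exact: continuous_subr_cst].
Qed.

Lemma closure_sub_closed (T : topologicalType) (A F : set T) :
  closed F -> A `<=` F -> closure A `<=` F.
Proof. by move=> cF AF; rewrite (closure_id F).1//; exact: closure_subset. Qed.

Lemma continuous_dist (A : set 'rV[R]_n) : A !=set0 -> continuous (fun x => dist x A).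
Proof.
move=> A0; apply: (@lipschitz_continuous _ _ _ n%:R) => // x y.
by apply: (le_trans (dist_lipschitz x y A0)); rewrite lerD2l enorm_le_norm.
Qed.

Lemma bounded_domain_closure_compact (Omega : set 'rV[R]_n) : bounded_set Omega ->
  compact (closure Omega).
Proof.
move=> [M [Mr OM]]; apply: bounded_closed_compact; last exact: closed_closure.
exists M; split => // N MN x xO.
suff : closure Omega `<=` [set x | `|x| <= N] by apply.
apply: closure_sub_closed; last by move=> y Oy; exact: OM Oy.
apply: closed_le_continuous; last exact: cst_continuous.
exact: norm_continuous.
Qed.

Definition level (C : set 'rV[R]_n) (kappa : 'rV[R]_n -> R) (J j : nat) :=
  [set x | C x /\ j.+1%:R / J%:R <= kappa x].

Section domain.
Variables (Omega : set 'rV[R]_n) (x0 : 'rV[R]_n).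
Hypotheses (dO : bounded_convex_domain Omega) (Ox0 : Omega x0).
Let d x := dist x (boundary Omega).

(** The function is (y - x).(y - z) / P, the depth of z below the supporting hyperplane at the
    boundary point y nearest to x, normalised to 1 at x0. By [nearest_boundary_depth], P >= d x0 |x
    - y|, while the numerator at z = x is |x - y|^2 with |x - y| = d x. *)
Let supporting_affine x : Omega x -> exists th : 'rV[R]_n,
  (forall z, Omega z -> 0 < 1 - dotv th (z - x0)) /\
  (1 - dotv th (x - x0)) * d x0 <= d x.
Proof.
move=> Ox; have [oO _ bO cO] := dO.
have [y [[_ nOy] dE xy0 ymin]] := bounded_open_nearest_boundary n_gt0 oO bO Ox.
have {}nOy : ~ Omega y by move=> Oy; apply: nOy; exact: open_nbhs_nbhs.
have depth z : Omega z -> d z * enorm (x - y) <= dotv (y - x) (y - z).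
  exact: (nearest_boundary_depth n_gt0 cO oO bO Ox nOy xy0 ymin).
have d_gt0 z : Omega z -> 0 < d z.
  by move=> Oz; rewrite /d; have [? [_ -> ? _]] := bounded_open_nearest_boundary n_gt0 oO bO Oz.
pose P := dotv (y - x) (y - x0).
have P0 : 0 < P by rewrite (lt_le_trans _ (depth _ Ox0))// mulr_gt0// d_gt0.
have lE z : 1 - dotv (P^-1 *: (y - x)) (z - x0) = P^-1 * dotv (y - x) (y - z).
  transitivity (P^-1 * P - P^-1 * dotv (y - x) (z - x0)).
    by rewrite dotvZl mulVf ?gt_eqF.
  by rewrite -mulrBr {2}/P -dotvBr opprB addrA subrK.
exists (P^-1 *: (y - x)); split.
  move=> z Oz; rewrite lE mulr_gt0 ?invr_gt0//.
  by rewrite (lt_le_trans _ (depth _ Oz))// mulr_gt0// d_gt0.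
rewrite lE -mulrA ler_pdivrMl// -enorm_sqr enormB {2}/d dE expr2 mulrAC ler_pM2r//.
by rewrite mulrC depth.
Qed.

Lemma weighted_alexandrov (phi : 'rV[R]_n -> R) : continuous phi ->
  (forall x, ~ Omega x -> phi x = 0) -> phi x0 < 0 ->
  exists (C : set 'rV[R]_n) (kappa : 'rV[R]_n -> R) (J : nat),
  [/\ compact C, C `<=` Omega, continuous kappa,
      (forall x, C x -> 0 <= kappa x <= 1 /\ d x0 * kappa x <= 2 * d x) & (0 < J)%N /\
      ((J%:R * (- phi x0) ^+ n)%:E <=
       (12 * (4 * n%:R) ^+ n * diam Omega ^+ n.-1 * d x0)%:E *
       \sum_(j < J) mu (slopes (closure Omega) phi
         (level C kappa J j)))%E].
Proof.
move=> cphi phi0 phix0; have [oO _ bO cO] := dO.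
pose m := - phi x0.
have m0 : 0 < m by rewrite oppr_gt0.
pose Z := closure Omega.
have cZ : compact Z by exact: bounded_domain_closure_compact.
have OZ : Omega `<=` Z by exact: subset_closure.
pose C := Z `&` [set x | phi x <= - (m / 4)].
have cC : compact C.
  apply: (@subclosed_compact _ _ Z) => //; last exact: subIsetl.
  apply: closedI; first exact: closed_closure.
  by apply: closed_le_continuous => //; exact: cst_continuous.
have CO : C `<=` Omega.
  move=> x [_ /=]; apply: contraPP => nOx; rewrite phi0//.
  by apply/negP; rewrite -ltNge oppr_lt0 divr_gt0.
have [y0 [by0 _ _ _]] := bounded_open_nearest_boundary n_gt0 oO bO Ox0.
have b0 : boundary Omega !=set0 by exists y0.
have d_gt0 z : Omega z -> 0 < d z.
  by move=> Oz; rewrite /d; have [? [_ -> ? _]] := bounded_open_nearest_boundary n_gt0 oO bO Oz.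
have [th thP] : {th : 'rV[R]_n -> 'rV[R]_n & forall x, Omega x ->
    (forall z, Omega z -> 0 < 1 - dotv (th x) (z - x0)) /\
    (1 - dotv (th x) (x - x0)) * d x0 <= d x}.
  apply: (@choice _ _ (fun x t => Omega x ->
    (forall z, Omega z -> 0 < 1 - dotv t (z - x0)) /\
    (1 - dotv t (x - x0)) * d x0 <= d x)) => x.
  have [Ox|nOx] := pselect (Omega x); last by exists 0.
  by have [t tP] := supporting_affine Ox; exists t.
have cd : continuous d by exact: continuous_dist.
have cl (t : 'rV[R]_n) : continuous (fun z : 'rV[R]_n => (1 - dotv t (z - x0)) * d x0).
  apply: continuous_mul; last exact: cst_continuous.
  apply: continuous_sub; first exact: cst_continuous.
  by apply: continuous_dotv; [exact: cst_continuous|exact: continuous_subr_cst].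
(* The affine function of x is at most d / d x0 at x itself. With the factor 2 the inequality
   becomes strict there and holds on a neighbourhood, so finitely many points of C suffice. *)
have [E EC CE] : exists2 E : seq 'rV[R]_n, (forall x, x \in E -> C x) &
    forall z, C z -> exists2 x, x \in E & (1 - dotv (th x) (z - x0)) * d x0 < 2 * d z.
  move: (cC); rewrite compact_cover.
  move=> /(_ _ C (fun x => [set z : 'rV[R]_n | (1 - dotv (th x) (z - x0)) * d x0 < 2 * d z])) [||E EC CE].
  - move=> x _; rewrite -[X in open X]setCK; apply: closed_openC.
    rewrite (_ : ~` _ = [set z : 'rV[R]_n | 2 * d z <= (1 - dotv (th x) (z - x0)) * d x0]).
      apply: closed_le_continuous => //.
      by apply: continuous_mul => //; exact: cst_continuous.
    by apply/seteqP; split => z /=; [move/negP; rewrite -leNgt|move=> h; apply/negP; rewrite -leNgt].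
  - move=> z Cz; exists z => //=; have [_ h] := thP z (CO _ Cz).
    by apply: (le_lt_trans h); have := d_gt0 z (CO z Cz); lra.
  exists (finmap.enum_fset E); first by move=> x /EC /set_mem.
  by move=> z /CE[x xE /= h]; exists x.
pose T := [seq th x | x <- E].
pose kappa := min_affine x0 T.
have kappa_gt0 x : Omega x -> 0 < kappa x.
  move=> Ox; rewrite /kappa; have [t + ->] := min_affine_eq x0 T x.
  rewrite inE => /orP[/eqP ->|]; first by rewrite dotv0l subr0.
  by move=> /mapP[y /EC/CO/thP[+ _] ->]; apply.
have kappa_ge0 x : Z x -> 0 <= kappa x.
  suff : Z `<=` [set x | 0 <= kappa x] by apply.
  apply: closure_sub_closed => [|y /kappa_gt0/ltW//].
  apply: closed_le_continuous; first exact: cst_continuous.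
  exact: continuous_min_affine.
have kappa_d x : C x -> d x0 * kappa x <= 2 * d x.
  move=> Cx; have [y yE h] := CE x Cx; rewrite mulrC.
  apply: (le_trans _ (ltW h)); rewrite ler_wpM2r ?(ltW (d_gt0 _ Ox0))//.
  by apply: min_affine_le; rewrite inE map_f ?orbT.
have [A [mA Aslope Avol]] := cone_slopes_volume n_gt0 dO Ox0 m0.
have Aslope' p x : A p -> Z x -> dotv p (x - x0) <= m / 4.
  move=> Ap; suff : Z `<=` [set x | dotv p (x - x0) <= m / 4] by apply.
  apply: closure_sub_closed => [|y Oy]; last exact: Aslope.
  apply: closed_le_continuous; last exact: cst_continuous.
  by apply: continuous_dotv; [exact: cst_continuous|exact: continuous_subr_cst].
have [J J0 JA] := @weighted_slopes_measure R n n_gt0 Z C A x0 phi kappa (0 :: T) m cZ cC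
  (@subIsetl _ _ _) (OZ _ Ox0) cphi (@continuous_min_affine x0 T) m0 (esym (opprK _))
  (fun x Zx xm => conj Zx xm) (fun t x => @min_affine_le x0 T x t) (@min_affine_eq x0 T)
  kappa_ge0 (fun x Cx => kappa_gt0 x (CO x Cx)) (@min_affine_le1 x0 T) mA Aslope'.
exists C, kappa, J; split => //; first exact: continuous_min_affine.
  move=> x Cx; split; last exact: kappa_d.
  by rewrite ltW ?kappa_gt0 ?min_affine_le1//; exact: CO.
split => //; set c := 2 * (4 * n%:R) ^+ n * diam Omega ^+ n.-1 * dist x0 (boundary Omega) in Avol.
have c0 : 0 <= c.
  rewrite !mulr_ge0 ?exprn_ge0 ?mulr_ge0 ?(ltW (d_gt0 _ Ox0))//.
  by apply: le_trans (diam_ge bO Ox0 Ox0); exact: enorm_ge0.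
(* 12 is the 2 of [cone_slopes_volume] times the 6 of [weighted_slopes_measure]. *)
rewrite (_ : 12 * _ * _ * _ = c * 6); last by rewrite /c /d; ring.
rewrite EFinM EFinM -muleA; apply: (@le_trans _ _ (c%:E * (J%:R%:E * mu A))%E).
  by rewrite muleCA; apply: lee_wpmul2l => //; rewrite lee_fin.
by apply: lee_wpmul2l => //; rewrite lee_fin.
Qed.

End domain.
End weighted_alexandrov.

(** * From the levels of the weight to the integral *)

Section integral_lower_bound.
Context {d : measure_display} {T : measurableType d} {R : realType}.
Implicit Types (nu : set T -> \bar R) (D : set T) (f : T -> \bar R).
Local Open Scope ereal_scope.

Import HBNNSimple.

Let sintegral_cst0 nu (h : T -> R) : nu set0 = 0 -> (forall x, h x = 0%R) ->
  sintegral nu h = 0.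
Proof.
move=> nu0 /funext ->; rewrite /sintegral fsbig1// => r _; rewrite preimage_cst.
by case: ifPn => [/[!inE] <-|]; rewrite ?mul0e// nu0 mule0.
Qed.

(** Read off from the definition of the integral as a supremum over simple functions, so that it
    applies to a set function not known to be additive, such as [monge_ampere_diff]. The negative
    part of f contributes 0. *)
Lemma ge_integral_sintegral nu D f (h : {nnsfun T >-> R}) : nu set0 = 0 ->
  (forall x, D x -> 0 <= f x) -> (forall x, (h x)%:E <= (f \_ D) x) ->
  sintegral nu h <= \int[nu]_(x in D) f x.
Proof.
move=> nu0 f0 hf; rewrite /integral.
have neg0 x : ((f \_ D)^\- x : \bar R) = 0.
  rewrite funenegE patchE; case: ifP => [/[!inE] Dx|_]; last by rewrite oppe0 maxxx.
  by rewrite max_r// leeNl oppe0 f0.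
have posE x : ((f \_ D)^\+ x : \bar R) = (f \_ D) x.
  rewrite funeposE patchE; case: ifP => [/[!inE] Dx|_]; last by rewrite maxxx.
  by rewrite max_l// f0.
set N := ereal_sup [set _ | _ in [set h : {nnsfun T >-> R} | forall x, _ <= (f \_ D)^\- x]].
have -> : N = 0.
  apply/eqP; rewrite eq_le; apply/andP; split.
    apply: ge_ereal_sup => _ [g /= gf <-]; rewrite sintegral_cst0// => x.
    by have := gf x; rewrite neg0 lee_fin => g0; apply/eqP; rewrite eq_le g0 /=.
  apply: ereal_sup_ubound; exists nnsfun0; last by rewrite sintegral_cst0.
  by move=> x; rewrite neg0.
rewrite sube0; apply: ereal_sup_ubound; exists h => // x.
by rewrite posE.
Qed.

(** Distinct positive values on disjoint sets make A j the exact preimage of a j under the simple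
    function, so each term of its [sintegral] involves a single A j and additivity of nu never
    enters. *)
Lemma ge_integral_levels nu D f (A : nat -> set T) (a : nat -> R) J :
  nu set0 = 0 -> (forall S, 0 <= nu S) -> (forall x, D x -> 0 <= f x) ->
  injective a -> (forall j, 0 < a j)%R -> (forall j, measurable (A j)) ->
  (forall j k x, A j x -> A k x -> j = k) -> (forall j, A j `<=` D) ->
  (forall j x, A j x -> (a j)%:E <= f x) ->
  \sum_(j < J) (a j)%:E * nu (A j) <= \int[nu]_(x in D) f x.
Proof.
move=> nu0 nu_ge0 f0 a_inj a_gt0 mA Adisj AD af.
have a_ge0 j : (0 <= a j)%R by exact: ltW.
pose h : {nnsfun T >-> R} := sum_nnsfun (fun j => scale_nnsfun (indic_nnsfun R (mA j)) (a_ge0 j)) J.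
have hE x : h x = (\sum_(j < J) a j * \1_(A j) x)%R by rewrite /h sum_nnsfunE.
have hA k x : (k < J)%N -> A k x -> h x = a k.
  move=> kJ Akx; rewrite hE (bigD1 (Ordinal kJ))//= indicE mem_set// mulr1.
  rewrite big1 ?addr0// => j jk; rewrite indicE memNset ?mulr0// => Ajx.
  by move/eqP: jk; apply; apply/val_inj; exact: Adisj Ajx Akx.
have hN x : (forall k, (k < J)%N -> ~ A k x) -> h x = 0%R.
  move=> xA; rewrite hE big1// => j _; rewrite indicE memNset ?mulr0//.
  exact: xA.
have hf x : (h x)%:E <= (f \_ D) x.
  have [[k [kJ Akx]]|/forallNP xA] := pselect (exists k, (k < J)%N /\ A k x).
    by rewrite (hA _ _ kJ Akx) patchE mem_set; [exact: af|exact: AD Akx].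
  rewrite hN; last by move=> k kJ Akx; apply: (xA k).
  by rewrite patchE; case: ifP => // /[!inE] Dx; exact: f0.
apply: le_trans (ge_integral_sintegral nu0 f0 hf).
have preE k : (k < J)%N -> h @^-1` [set a k] = A k.
  move=> kJ; apply/seteqP; split => [x /= hx|x Akx]; last exact: hA.
  have [[i [iJ Aix]]|/forallNP xA] := pselect (exists i, (i < J)%N /\ A i x).
    by move: hx; rewrite (hA _ _ iJ Aix) => /a_inj <-.
  move: hx; rewrite hN; first by move=> /eqP; rewrite lt_eqF.
  by move=> i iJ Aix; apply: (xA i).
pose F r := r%:E * nu (h @^-1` [set r]).
have FE : \sum_(j < J) (a j)%:E * nu (A j) = \sum_(r \in a @` `I_J) F r.
  rewrite fsbig_image; last by move=> i j _ _ /a_inj.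
  by rewrite -fsbig_ord; apply: eq_bigr => j _; rewrite /F preE.
have finI : finite_set (a @` `I_J) by exact/finite_image/finite_II.
have finh : finite_set (range h) by exact: fimfunP.
rewrite FE /sintegral -(fsbig_widen (range h `|` a @` `I_J) setT)//; last first.
  move=> r [_ hr] /=; rewrite preimage10 ?nu0 ?mule0// => rh.
  by apply: hr; left.
apply: lee_fsum_nneg_subset => //.
- by rewrite finite_setU.
- by move=> r; rewrite !inE; right.
- move=> r; rewrite !inE => /andP[ra].
  rewrite /in_mem/= => /set_mem[[x _ <-]|/=]; first by rewrite mule_ge0// lee_fin.
  by move=> ?; move/negP: ra; case; apply/mem_set.
Qed.

End integral_lower_bound.

(** * Zero extension and contact points *)

Section zero_extension.
Context {R : realType} {n : nat}.
Implicit Types (x y q : 'rV[R]_n) (Omega S K : set 'rV[R]_n) (u v : 'rV[R]_n -> R).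

Lemma continuous_zero_extension Omega u : open Omega ->
  {within closure Omega, continuous u} -> (forall x, boundary Omega x -> u x = 0) ->
  continuous (u \_ Omega).
Proof.
move=> oO /subspace_continuousP cu u0 x.
have nbhsF : Filter (nbhs x) by exact: (@nbhs_filter 'rV[R]_n).
have out y : ~ Omega y -> (u \_ Omega) y = 0 by move=> Oy; rewrite patchE memNset.
have inn y : Omega y -> (u \_ Omega) y = u y by move=> Oy; rewrite patchE mem_set.
apply/(@cvgrPdist_lt _ _ _ (nbhs x)) => e e0.
have [xO|xO] := pselect (closure Omega x); last first.
  have : \forall y \near x, ~ closure Omega y.
    by apply: open_nbhs_nbhs; split => //; apply: closed_openC; exact: closed_closure.
  apply: filterS => y yO; rewrite !out ?subrr ?normr0//.
    by move=> /subset_closure.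
  by move=> /subset_closure.
have := cu x xO => /(@cvgrPdist_lt _ _ _ (within _ (nbhs x))) /(_ e e0).
move=> nu.
have {}nu : nbhs x [set y | closure Omega y -> `|u x - u y| < e] by exact: nu.
have [Ox|Ox] := pselect (Omega x).
  have nO : nbhs x Omega by exact: open_nbhs_nbhs.
  apply: filterS (@filterI _ _ nbhsF _ _ nu nO) => y [uy Oy]; rewrite !inn//.
  by apply: uy; exact: subset_closure.
have ux0 : u x = 0 by apply: u0; split => // /interior_subset.
apply: filterS nu => y uy; rewrite (out x)// -ux0.
have [Oy|Oy] := pselect (Omega y); first by rewrite inn//; apply: uy; exact: subset_closure.
by rewrite out// ux0 subrr normr0.
Qed.

Lemma convex_on_zero_extension Omega u : convex_set Omega -> convex_on Omega u ->
  convex_on Omega (u \_ Omega).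
Proof.
move=> cO cu x y t Ox Oy t01; rewrite !patchE !mem_set//; first exact: cu.
exact: convex_setP.
Qed.

Lemma slopes_zero_extension Omega u S : S `<=` Omega ->
  slopes Omega (u \_ Omega) S = slopes Omega u S.
Proof.
move=> SO; apply: eq_bigcupr => x /SO Ox; apply/seteqP; split => q qx y Oy.
  by have := qx y Oy; rewrite !patchE !mem_set.
by have := qx y Oy; rewrite !patchE !mem_set.
Qed.

End zero_extension.

Section contact.
Context {R : realType} {n : nat}.
Hypothesis n_gt0 : (0 < n)%N.
Implicit Types (x y q : 'rV[R]_n) (Omega S K : set 'rV[R]_n) (u v f phi : 'rV[R]_n -> R).
Local Notation mu := (@lebesgue_outer R n).

(** K' consists of the points of K where [phi] has a slope, as [slopes_superadditive_touching]
    requires; it loses no slope touching in K, and it is compact because these slopes are bounded.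
    The finite measure allows subtraction afterwards. *)
Lemma contact_slopes_superadditive Omega f phi K : bounded_convex_domain Omega ->
  continuous f -> continuous phi -> convex_on Omega f -> compact K -> K `<=` Omega ->
  exists K', [/\ compact K', K' `<=` K, mu (slopes Omega f K') \is a fin_num &
    (mu (slopes Omega f K') + mu (slopes (closure Omega) phi K) <=
     mu (slopes Omega (f \+ phi)%R K'))%E].
Proof.
move=> [oO _ bO cO] cf cphi cvf cK KO.
have [r r0 Kr] := compact_thicken_subset cK oO KO.
have bound g : continuous g -> exists2 b, 0 <= b & forall q, slopes Omega g K q ->
    forall i, `|q 0 i| <= b.
  move=> cg; have [M M0 gM] := compact_bound (bounded_domain_closure_compact bO) cg.
  exists (2 * M / r); first by rewrite divr_ge0 ?mulr_ge0 ?ltW.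
  apply: slopes_coord_bound => // y Oy; apply: gM; exact: subset_closure.
have [b b0 phib] := bound _ cphi.
have [bf _ fb] := bound _ cf.
have phib' q : slopes Omega phi K q -> `|q| <= b by move=> /phib; exact: norm_rV_le.
pose B := [set q : 'rV[R]_n | `|q - 0| <= b].
have cB : compact B by exact: compact_norm_ball.
pose K' := K `&` [set x | exists2 q, B q & subdifferential Omega phi x q].
have cK' : compact K'.
  apply: (@subclosed_compact _ _ K) => //; last exact: subIsetl.
  apply: closedI.
    by apply: compact_closed => //; exact: norm_hausdorff.
  pose P := [set p : 'rV[R]_n * 'rV[R]_n | subdifferential Omega phi p.1 p.2].
  apply: (@closed_exists_compact _ _ B P cB).
  apply: (closed_subdifferential (X := fst) (Q := snd)) => //.
    exact: continuous_fst.
  exact: continuous_snd.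
have K'K : K' `<=` K by move=> x [].
exists K'; split => //.
  rewrite ge0_fin_numE ?lebesgue_outer_ge0//.
  apply: (@bounded_lebesgue_outer_fin _ _ n_gt0 _ bf) => q /(slopes_subset K'K).
  exact: fb.
apply: le_trans (slopes_superadditive_touching n_gt0 (b := b) _ _ _ _ _ _ _ _ _) => //.
- apply: leeD => //; apply: le_lebesgue_outer => q [x Kx qx].
  have qO : subdifferential Omega phi x q by move=> y Oy; apply: qx; exact: subset_closure.
  exists x => //; split => //; exists q => //.
  by rewrite /B/= subr0; apply: phib'; exists x.
- exact: subset_trans KO.
- by move=> x [_ [q Bq qx]]; exists q => //; move: Bq; rewrite /B/= subr0.
- by move=> q /(slopes_subset K'K); exact: phib'.
Qed.

Lemma closed_measurable_borel (S : set 'rV[R]_n) : closed S ->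
  measurable (S : set (@borel_rV R n)).
Proof.
move=> cS; rewrite -[S]setCK; apply: (@measurableC _ (@borel_rV R n)).
by apply: sub_sigma_algebra; exact: closed_openC.
Qed.

Lemma monge_ampere_zero_extension Omega u S : S `<=` Omega ->
  monge_ampere Omega u S = mu (slopes Omega (u \_ Omega) S).
Proof. by move=> SO; rewrite slopes_zero_extension. Qed.

Lemma monge_ampere_diff_ge0 Omega u v (S : set (@borel_rV R n)) :
  (0 <= monge_ampere_diff Omega u v S)%E.
Proof.
apply: ereal_sup_ubound; exists set0; first by split => //; exact: compact0.
rewrite setI0 /monge_ampere bigcup_set0 /lebesgue_rV lebesgue_outer0.
by rewrite bigcup_set0 lebesgue_outer0 sube0.
Qed.

Lemma monge_ampere_diff0 Omega u v : (@monge_ampere_diff R n Omega u v set0 = 0)%E.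
Proof.
apply/eqP; rewrite eq_le monge_ampere_diff_ge0 andbT.
apply: ge_ereal_sup => _ [K _ <-].
rewrite set0I /monge_ampere bigcup_set0 /lebesgue_rV lebesgue_outer0.
by rewrite bigcup_set0 lebesgue_outer0 sube0.
Qed.

End contact.

(** * Compact bands between the levels of the weight *)

Section levels.
Context {R : realType} {n : nat}.
Hypothesis n_gt0 : (0 < n)%N.
Implicit Types (x y q : 'rV[R]_n) (Omega S K C : set 'rV[R]_n) (f phi kappa : 'rV[R]_n -> R).
Local Notation mu := (@lebesgue_outer R n).

Lemma compact_slopes_fin Omega phi C : bounded_convex_domain Omega -> continuous phi ->
  compact C -> C `<=` Omega -> mu (slopes (closure Omega) phi C) \is a fin_num.
Proof.
move=> [oO _ bO cO] cphi cC CO; rewrite ge0_fin_numE ?lebesgue_outer_ge0//.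
have [r r0 Cr] := compact_thicken_subset cC oO CO.
have [M M0 phiM] := compact_bound (bounded_domain_closure_compact bO) cphi.
apply: (@bounded_lebesgue_outer_fin _ _ n_gt0 _ (2 * M / r)) => q qC i.
apply: (slopes_coord_bound r0 _ phiM qC) => x y Cx xy.
by apply: subset_closure; exact: (Cr x).
Qed.

Lemma compact_level C kappa J j : compact C -> continuous kappa ->
  compact (level C kappa J j).
Proof.
move=> cC ck; apply: (@subclosed_compact _ _ C) => //; last by move=> x [].
apply: closedI; first by apply: compact_closed => //; exact: norm_hausdorff.
by apply: closed_le_continuous => //; exact: cst_continuous.
Qed.

(** A slope touching in level j but not in level j + 1 touches in a half-open band of kappa. This
    band is exhausted by the compact sets [band t], and continuity from below costs at most eta. *)
Lemma level_difference_approx Z phi C kappa J j (eta : R) : continuous phi ->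
  compact C -> continuous kappa -> 0 < eta ->
  (mu (slopes Z phi (level C kappa J j)) \is a fin_num) ->
  exists K, [/\ compact K, K `<=` C,
    forall x, K x -> j.+1%:R / J%:R <= kappa x < j.+2%:R / J%:R &
    (mu (slopes Z phi (level C kappa J j)) <=
     mu (slopes Z phi (level C kappa J j.+1)) + mu (slopes Z phi K) + eta%:E)%E].
Proof.
move=> cphi cC ck eta0 sfin.
pose band t := level C kappa J j `&` [set x | kappa x <= j.+2%:R / J%:R - t.+1%:R^-1].
have cband t : compact (band t).
  apply: (@subclosed_compact _ _ (level C kappa J j)); last exact: subIsetl.
    apply: closedI; last by apply: closed_le_continuous => //; exact: cst_continuous.
    by apply: compact_closed; [exact: norm_hausdorff|exact: compact_level].
  exact: compact_level.
have caras S : compact S -> mu.-caratheodory (slopes Z phi S).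
  by move=> cS; apply: caratheodory_closed => //; exact: closed_slopes.
have sub : slopes Z phi (level C kappa J j) `\` slopes Z phi (level C kappa J j.+1) `<=`
    \bigcup_t slopes Z phi (band t).
  move=> q [[x xj qx] nq]; have [Cx jx] := xj.
  have xj1 : kappa x < j.+2%:R / J%:R.
    by rewrite ltNge; apply/negP => ?; apply: nq; exists x.
  have := xj1; rewrite -subr_gt0 => e0.
  have /(_ _ e0) [t te] := @ltr_add_invr R 0.
  exists t => //; exists x => //; split => //=.
  by move: te; rewrite add0r ltrBrDl => /ltW; rewrite -lerBrDr.
set s := mu (slopes Z phi _) in sfin *; set s1 := mu (slopes Z phi _).
have sle : (s <= s1 + mu (\bigcup_t slopes Z phi (band t)))%E.
  have := lebesgue_outer_setD_le (slopes Z phi (level C kappa J j))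
    (caras _ (@compact_level C kappa J j.+1 cC ck)).
  move=> /le_trans; apply.
  by rewrite leeD2l// le_lebesgue_outer.
have bandP t x : band t x -> j.+1%:R / J%:R <= kappa x < j.+2%:R / J%:R.
  move=> [[_ ->] /= xt]; rewrite (le_lt_trans xt)// gtrBl invr_gt0 ltr0n.
  by [].
have bandC t : band t `<=` C by move=> x [[]].
have s1_ge0 : (0 <= s1)%E by exact: lebesgue_outer_ge0.
have [s1oo|s1fin] := eqVneq s1 +oo%E.
  exists (band 0%N); split => //; first exact: bandP.
  by rewrite s1oo !addye ?leey// gt_eqF// (@lt_le_trans _ _ 0%E)// lebesgue_outer_ge0.
have {}s1fin : s1 \is a fin_num by rewrite ge0_fin_numE// ltey.
have lt : ((fine s - fine s1 - eta)%:E < mu (\bigcup_t slopes Z phi (band t)))%E.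
  rewrite !EFinB !fineK//; apply: (@lt_le_trans _ _ (s - s1)%E).
    by rewrite lteBlDr// lteDl// fin_numB sfin.
  by rewrite leeBlDl.
have [|t] := @lebesgue_outer_bigcup_gt R n _ _ (fun t => caras _ (cband t)) _ lt.
  move=> t t' tt'; apply: slopes_subset => x [xj /= xt]; split => //=.
  rewrite (le_trans xt)// lerD2l lerN2 lef_pV2 ?posrE ?ltr0n// ler_nat.
  by [].
rewrite !EFinB !fineK// => /ltW h.
exists (band t); split => //; first exact: bandP.
by move: h; rewrite leeBlDr// leeBlDl// addeA.
Qed.

(** Abel summation: a discrete layer cake formula that turns a sum over levels into a sum over bands
    with weights j + 1. *)
Lemma sum_by_parts_le (s k : nat -> R) eta J : (forall j, s j <= s j.+1 + k j + eta) ->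
  \sum_(j < J) s j <= J%:R * s J + \sum_(j < J) j.+1%:R * (k j + eta).
Proof.
move=> sk; elim: J => [|J IH]; first by rewrite !big_ord0 mul0r addr0.
rewrite !big_ord_recr /=.
have : (J.+1%:R : R) * s J <= J.+1%:R * (s J.+1 + k J + eta) by rewrite ler_wpM2l.
rewrite -(natr1 J); lra.
Qed.

Lemma level_selection Omega phi C kappa J : bounded_convex_domain Omega ->
  continuous phi -> compact C -> C `<=` Omega -> continuous kappa ->
  (forall x, C x -> kappa x <= 1) -> (0 < J)%N ->
  exists K : nat -> set 'rV[R]_n,
    (forall j, [/\ compact (K j), K j `<=` C &
      forall x, K j x -> j.+1%:R / J%:R <= kappa x < j.+2%:R / J%:R]) /\
    (\sum_(j < J) mu (slopes (closure Omega) phi (level C kappa J j)) <=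
     2%:E * \sum_(j < J) j.+1%:R%:E * mu (slopes (closure Omega) phi (K j)))%E.
Proof.
move=> dO cphi cC CO ck k1 J0.
have J0' : 0 < (J%:R : R) by rewrite ltr0n.
pose s j := mu (slopes (closure Omega) phi (level C kappa J j)).
have sfin j : s j \is a fin_num.
  apply: compact_slopes_fin => //; first exact: compact_level.
  by move=> x [/CO].
have sum_ge0 (P : nat -> set 'rV[R]_n) :
    (0 <= \sum_(j < J) j.+1%:R%:E * mu (slopes (closure Omega) phi (P j)))%E.
  by apply: sume_ge0 => j _; rewrite mule_ge0// lebesgue_outer_ge0.
pose Sg := \sum_(j < J) fine (s j).
have SgE : (\sum_(j < J) s j = Sg%:E)%E.
  by rewrite /Sg -sumEFin; apply: eq_bigr => j _; rewrite fineK.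
rewrite -/(s _) SgE; have [Sg0|Sg0] := leP Sg 0.
  exists (fun=> set0); split; first by move=> j; split => //; exact: compact0.
  by rewrite (@le_trans _ _ 0%E)// mule_ge0// (sum_ge0 (fun=> set0)).
(* The weighted errors (j + 1) eta sum to at most J^2 eta = Sg / 2, which is absorbed on the left
   and produces the factor 2. *)
pose eta := Sg / (2 * J%:R ^+ 2).
have eta0 : 0 < eta by rewrite divr_gt0 ?mulr_gt0 ?exprn_gt0.
have /choice[K Kj] j := level_difference_approx cphi cC ck eta0 (sfin j).
exists K; split; first by move=> j; have [] := Kj j.
pose k j := mu (slopes (closure Omega) phi (K j)).
have kfin j : k j \is a fin_num.
  by have [cK KC _ _] := Kj j; apply: compact_slopes_fin => //; exact: subset_trans CO.
have sk j : fine (s j) <= fine (s j.+1) + fine (k j) + eta.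
  have [_ _ _] := Kj j; rewrite -/(s _) -/(s _) -/(k _) => h.
  by rewrite -lee_fin !EFinD !fineK.
have sJ : s J = 0%E.
  rewrite /s (_ : level _ _ _ _ = set0) ?/slopes ?bigcup_set0 ?lebesgue_outer0//.
  rewrite -subset0 => x [Cx]; rewrite ler_pdivrMr// => Jx.
  have := k1 x Cx; rewrite -(ler_pM2r J0') mul1r => /(le_trans Jx).
  by rewrite ler_nat ltnn.
have := sum_by_parts_le J sk; rewrite sJ mulr0 add0r -/Sg.
have etale : \sum_(j < J) j.+1%:R * eta <= Sg / 2.
  rewrite (@le_trans _ _ (\sum_(j < J) J%:R * eta))//.
    by apply: ler_sum => j _; rewrite ler_wpM2r ?(ltW eta0)// ler_nat.
  rewrite sumr_const card_ord -mulr_natl /eta.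
  by rewrite le_eqVlt; apply/orP; left; apply/eqP; field; rewrite gt_eqF.
under eq_bigr do rewrite mulrDr.
rewrite big_split /= => h.
have -> : (\sum_(j < J) j.+1%:R%:E * mu (slopes (closure Omega) phi (K j)) =
    (\sum_(j < J) j.+1%:R * fine (k j))%:E)%E.
  by rewrite -sumEFin; apply: eq_bigr => j _; rewrite EFinM fineK.
rewrite -EFinM lee_fin; lra.
Qed.

End levels.

(** * Comparison of u and v *)

Section comparison.
Context {R : realType} {n : nat}.
Hypothesis n_gt0 : (0 < n)%N.
Local Notation mu := (@lebesgue_outer R n).
Variables (Omega : set 'rV[R]_n) (u v : 'rV[R]_n -> R).
Hypotheses (dO : bounded_convex_domain Omega)
  (cu : {within closure Omega, continuous u}) (cv : {within closure Omega, continuous v})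
  (vu : convex_function Omega u) (vv : convex_function Omega v)
  (u0 : forall x, boundary Omega x -> u x = 0)
  (v0 : forall x, boundary Omega x -> v x = 0)
  (muvu : forall S : set (@borel_rV R n), measurable S -> S `<=` Omega ->
    (monge_ampere Omega v S <= monge_ampere Omega u S)%E).
Let U := u \_ Omega.
Let V := v \_ Omega.

Let cU : continuous U.
Proof. by case: dO => oO _ _ _; exact: continuous_zero_extension. Qed.

Let cV : continuous V.
Proof. by case: dO => oO _ _ _; exact: continuous_zero_extension. Qed.

Let vU : convex_on Omega U.
Proof.
by case: dO => _ _ _ cO; apply: convex_on_zero_extension => //; exact: convex_function_on.
Qed.

Let vV : convex_on Omega V.
Proof.
by case: dO => _ _ _ cO; apply: convex_on_zero_extension => //; exact: convex_function_on.
Qed.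

Let patch_out w x : ~ Omega x -> (w \_ Omega) x = 0 :> R.
Proof. by move=> Ox; rewrite patchE memNset. Qed.

(** Where v < u, the estimate for v - u yields a level whose slopes have positive measure.
    Superadditivity on its contact set K' then makes mu_v(K') exceed the finite mu_u(K'). *)
Lemma convex_comparison x0 : Omega x0 -> u x0 <= v x0.
Proof.
move=> Ox0; rewrite leNgt; apply/negP => vu0.
pose phi := V \- U.
have cphi : continuous phi by exact: continuous_sub.
have phi0 x : ~ Omega x -> phi x = 0 by move=> Ox; rewrite /phi /U /V/= !patch_out// subrr.
have phix0 : phi x0 < 0 by rewrite /phi /U /V/= !patchE !mem_set// subr_lt0.
have [C [kappa [J [cC CO ck _ [J0 ineq]]]]] := weighted_alexandrov n_gt0 dO Ox0 cphi phi0 phix0.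
pose L j := level C kappa J j.
have LO j : L j `<=` Omega by move=> x [/CO].
have [[j Lj]|/forallNP L0] := pselect (exists j, mu (slopes (closure Omega) phi (L j)) != 0%E).
  have [K' [cK K'L fin]] :=
    contact_slopes_superadditive n_gt0 dO cU cphi vU (compact_level cC ck) (@LO j).
  have K'O : K' `<=` Omega by exact: subset_trans (@LO j).
  have -> : (U \+ phi)%R = V by apply/funext => x; rewrite /phi/= addrC subrK.
  have := muvu (closed_measurable_borel (compact_closed (@norm_hausdorff _ _) cK)) K'O.
  rewrite (@monge_ampere_zero_extension _ _ Omega v K' K'O) -/V => h /le_trans /(_ h).
  rewrite monge_ampere_zero_extension// -/U; apply/negP; rewrite -ltNge lteDl//.
  by rewrite lt0e Lj lebesgue_outer_ge0.
move: ineq; rewrite big1; last by move=> j _; apply/eqP/negPn/negP; exact: L0.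
rewrite mule0 lee_fin leNgt => /negP; apply.
by rewrite mulr_gt0 ?ltr0n// exprn_gt0// oppr_gt0.
Qed.

(** The contact set K' of K is one of the compact sets in the supremum that defines
    [monge_ampere_diff]. *)
Lemma slopes_le_monge_ampere_diff K : compact K -> K `<=` Omega ->
  (mu (slopes (closure Omega) (U \- V)%R K) <= monge_ampere_diff Omega u v K)%E.
Proof.
move=> cK KO.
have cphi : continuous (U \- V) by exact: continuous_sub.
have [K' [cK' K'K fin le]] := contact_slopes_superadditive n_gt0 dO cV cphi vV cK KO.
have K'O : K' `<=` Omega by exact: subset_trans KO.
have VUE : (V \+ (U \- V))%R = U by apply/funext => x /=; rewrite addrC subrK.
apply: (@le_trans _ _ (mu (slopes Omega U K') - mu (slopes Omega V K'))%E).
  by rewrite leeBrDl//; move: le; rewrite VUE.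
apply: ereal_sup_ubound; exists K'; first by split.
by rewrite (setIidr K'K) !monge_ampere_zero_extension.
Qed.

End comparison.

(** Passes from the linear bound on the weight to the power 1 - alpha: k <= k^b because k <= 1, and
    2^b <= 2. *)
Lemma powR_scaled_le {R : realType} (a d k b : R) : 0 <= a -> 0 <= d -> 0 <= k <= 1 ->
  0 <= b <= 1 -> a * k <= 2 * d -> a `^ b * k <= 2 * d `^ b.
Proof.
move=> a0 d0 /andP[k0 k1] /andP[b0 b1] ak.
have [->|kn0] := eqVneq k 0; first by rewrite mulr0 mulr_ge0// powR_ge0.
have {kn0} k_gt0 : 0 < k by rewrite lt0r kn0.
apply: (@le_trans _ _ ((a * k) `^ b)).
  rewrite powRM// ler_wpM2l ?powR_ge0// ger1_powR//.
  by rewrite k_gt0 k1.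
apply: (@le_trans _ _ ((2 * d) `^ b)).
  by rewrite ge0_ler_powR// nnegrE mulr_ge0.
rewrite powRM// ler_wpM2r ?powR_ge0//.
by rewrite -[leRHS]powRr1// ler_powR// ler1n.
Qed.

Theorem theorem1p4 (R : realType) (n : nat) (n_gt0 : (0 < n)%N) :
  exists2 C : R, 0 < C &
  forall (Omega : set 'rV[R]_n) (u v : 'rV[R]_n -> R),
    bounded_convex_domain Omega ->
    {within closure Omega, continuous u} ->
    {within closure Omega, continuous v} ->
    convex_function Omega u ->
    convex_function Omega v ->
    (forall x, boundary Omega x -> u x = 0) ->
    (forall x, boundary Omega x -> v x = 0) ->
    (forall S : set (@borel_rV R n), measurable S -> S `<=` Omega ->
      (monge_ampere Omega v S <= monge_ampere Omega u S)%E) ->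
  forall (alpha : R) (x0 : 'rV[R]_n), 0 <= alpha <= 1 -> Omega x0 ->
    ((`|v x0 - u x0| ^+ n)%:E <=
      (C * diam Omega ^+ n.-1 * dist x0 (boundary Omega) `^ alpha)%:E *
      \int[monge_ampere_diff Omega u v]_(x in Omega)
        (dist x (boundary Omega) `^ (1 - alpha))%:E)%E.
Proof.
have n0 : 0 < (n%:R : R) by rewrite ltr0n.
pose A : R := (4 * n%:R) ^+ n.
have A0 : 0 < A by rewrite exprn_gt0// mulr_gt0.
(* 48 is the 12 of [weighted_alexandrov], doubled by [level_selection] and again by the division by
   2 in [c]. *)
exists (48 * A); first by rewrite mulr_gt0.
move=> Omega u v dO cu cv vu vv u0 v0 muvu alpha x0 /andP[alpha0 alpha1] Ox0.
have [oO _ bO cO] := dO.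
pose d x := dist x (boundary Omega).
have d_gt0 x : Omega x -> 0 < d x.
  by move=> Ox; have [y [_ dE xy _]] := bounded_open_nearest_boundary n_gt0 oO bO Ox; rewrite /d dE.
have D0 : 0 <= diam Omega by rewrite (le_trans (enorm_ge0 (x0 - x0)))// diam_ge.
pose beta := 1 - alpha; rewrite -/beta -/(d x0).
have beta01 : 0 <= beta <= 1 by rewrite /beta; apply/andP; split; lra.
set I := (\int[_]_(x in _) _)%E.
have ge_I (K : nat -> set (@borel_rV R n)) (a : nat -> R) J : injective a ->
    (forall j, 0 < a j) -> (forall j, compact (K j : set 'rV[R]_n)) ->
    (forall j k x, K j x -> K k x -> j = k) -> (forall j, K j `<=` Omega) ->
    (forall j x, K j x -> a j <= d x `^ beta) ->
    (\sum_(j < J) (a j)%:E * monge_ampere_diff Omega u v (K j) <= I)%E.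
  move=> a_inj a0 cK disj KO aK.
  apply: (ge_integral_levels _ (monge_ampere_diff0 Omega u v)
    (monge_ampere_diff_ge0 Omega u v) _ a_inj a0 _ disj KO) => //.
  - by move=> x _; rewrite lee_fin powR_ge0.
  - by move=> j; apply: closed_measurable_borel; apply: compact_closed => //; exact: norm_hausdorff.
have I0 : (0 <= I)%E.
  have := ge_I (fun=> set0) (fun j => j.+1%:R) 0%N; rewrite big_ord0; apply => //.
  - by move=> i j /eqP; rewrite (eqr_nat R i.+1 j.+1) eqSS => /eqP.
  - by move=> j; exact: compact0.
  - by move=> j; exact: sub0set.
have uv : u x0 <= v x0 by exact: (convex_comparison n_gt0 dO cu cv vu u0 v0 muvu).
have [uvE|uvN] := eqVneq (u x0) (v x0).
  rewrite uvE subrr normr0 expr0n eqn0Ngt n_gt0 mule_ge0// lee_fin.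
  by rewrite !mulr_ge0 ?exprn_ge0 ?powR_ge0// ltW.
pose phi := (u \_ Omega \- v \_ Omega).
have cphi : continuous phi by apply: continuous_sub; exact: continuous_zero_extension.
have phi0 x : ~ Omega x -> phi x = 0.
  by move=> Ox; rewrite /phi/= !patchE memNset// subrr.
have phix0E : - phi x0 = v x0 - u x0 by rewrite /phi/= !patchE mem_set// opprB.
have phix0 : phi x0 < 0 by rewrite -oppr_gt0 phix0E subr_gt0 lt_neqAle uvN.
have [C [kappa [J [cC CO ck kP [J0 ineq]]]]] := weighted_alexandrov n_gt0 dO Ox0 cphi phi0 phix0.
rewrite -/d in kP ineq.
have [|K [KP Kle]] := level_selection n_gt0 dO cphi cC CO ck _ J0.
  by move=> x /kP[/andP[]].
have J0' : 0 < (J%:R : R) by rewrite ltr0n.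
(* By [powR_scaled_le], c kappa <= d^beta on C, so c (j + 1) / J is a lower bound for the integrand
   on the band K j. *)
pose c := d x0 `^ beta / 2.
have c0 : 0 < c by rewrite divr_gt0// powR_gt0// d_gt0.
pose T := (\sum_(j < J) j.+1%:R%:E * lebesgue_outer (slopes (closure Omega) phi (K j)))%E.
have TI : ((c / J%:R)%:E * T <= I)%E.
  apply: le_trans (ge_I K (fun j => c * (j.+1%:R / J%:R)) J _ _ _ _ _ _).
  - rewrite ge0_sume_distrr; last first.
      by move=> j _; rewrite mule_ge0// lebesgue_outer_ge0.
    apply: lee_sum => j _; rewrite muleA -EFinM.
    have -> : c / J%:R * j.+1%:R = c * (j.+1%:R / J%:R) by rewrite mulrAC mulrA.
    have cj : 0 < c * (j.+1%:R / J%:R) by rewrite (mulr_gt0 c0)// divr_gt0.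
    rewrite lee_pmul2l//.
    have [cK KC _] := KP j; apply: slopes_le_monge_ampere_diff => //.
    exact: subset_trans CO.
  - move=> i j /= /(mulfI (lt0r_neq0 c0)) /(divIf (lt0r_neq0 J0')) /eqP.
    by rewrite eqr_nat eqSS => /eqP.
  - by move=> j; rewrite (mulr_gt0 c0)// divr_gt0.
  - by move=> j; have [] := KP j.
  - have le_disj j k x : K j x -> K k x -> (j <= k)%N.
      have [_ _ jP] := KP j; have [_ _ kP'] := KP k.
      move=> /jP/andP[jx _] /kP'/andP[_ xk]; move: (le_lt_trans jx xk).
      by rewrite ltr_pM2r ?invr_gt0// ltr_nat ltnS.
    by move=> j k x Kj Kk; apply/eqP; rewrite eqn_leq !(le_disj _ _ x).
  - by move=> j; have [_ KC _] := KP j; exact: subset_trans CO.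
  - move=> j x Kx; have [_ KC jP] := KP j; have Cx := KC _ Kx.
    have /andP[jx _] := jP _ Kx; have [k01 dk] := kP _ Cx.
    have d0 y : Omega y -> 0 <= d y by move=> /d_gt0/ltW.
    have kd := powR_scaled_le (d0 _ Ox0) (d0 _ (CO _ Cx)) k01 beta01 dk.
    have : c * (j.+1%:R / J%:R) <= c * kappa x by rewrite ler_pM2l.
    move=> /le_trans; apply.
    by rewrite /c mulrAC ler_pdivrMr// [leRHS]mulrC.
rewrite -phix0E (ger0_norm (ltW _)) ?oppr_gt0//.
have pos : 0 <= 48 * A * diam Omega ^+ n.-1 * d x0 `^ alpha.
  by rewrite !mulr_ge0 ?exprn_ge0 ?powR_ge0// ltW.
apply: le_trans (lee_wpmul2l _ TI); last by rewrite lee_fin.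
have J1 : (0%:E <= (J%:R^-1)%:E :> \bar R)%E by rewrite lee_fin invr_ge0 ltW.
have := lee_wpmul2l J1 (le_trans ineq (lee_wpmul2l _ Kle)).
rewrite -EFinM mulKf ?gt_eqF// !muleA -!EFinM => /(_ _) /le_trans; apply.
  by rewrite lee_fin !mulr_ge0 ?exprn_ge0// ltW// d_gt0.
rewrite le_eqVlt; apply/orP; left; apply/eqP; congr (_%:E * _)%E.
have d0E : d x0 `^ alpha * d x0 `^ beta = d x0.
  rewrite -powRD; last by apply/implyP => _; rewrite gt_eqF ?d_gt0.
  by rewrite /beta addrC subrK powRr1// ltW// d_gt0.
rewrite -/(d x0) -[in LHS]d0E /c -/A; field; rewrite gt_eqF//.
Qed.
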